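(* Suppose $F:T_0\times\mathbb{R}^n\to\mathbb{R}$, $(t,x)\mapsto F(t,x)$, has the following properties: (i) $F(t,x)$ is measurable in $t$ for any $x\in\mathbb{R}^n$ and of class $C^1$ in $x$ for any $t\in T_0$; (ii) there exist $a\in C^1(\mathbb{R}^+,\mathbb{R}^+)$ with derivative $a'$ bounded from above and $b\in C(T_0,\mathbb{R}^+)$ such that $|F(t,x)|\le a(|x|)\,b(t)$ and $|\nabla_xF(t,x)|\le a(|x|)\,b(t)$ for any $x\in\mathbb{R}^n$ and any $t\in T_0$; (iii) the function $F(t,\cdot)$ is strictly convex for any $t\in T_0$. Then the following statements are equivalent: 1) the problem $$\Delta u(t)=\nabla F(t,u(t)),\qquad u|_{S_i^-}=u|_{S_i^+},\quad \frac{\partial u}{\partial t}\Big|_{S_i^-}=\frac{\partial u}{\partial t}\Big|_{S_i^+},\quad i=1,\dots,p,$$ has solutions; 2) there exists $\overline{x}\in\mathbb{R}^n$ such that $\displaystyle\int_{T_0}\nabla F(t,\overline{x})\,dt^1\wedge\dots\wedge dt^p=0$; 3) $\displaystyle\int_{T_0}F(t,x)\,dt^1\wedge\dots\wedge dt^p\to\infty$ as $|x|\to\infty$.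
   Context: $T_0=[0,T^1]\times\dots\times[0,T^p]\subset\mathbb{R}^p$ with $T^1,\dots,T^p>0$, $T=(T^1,\dots,T^p)$, $t=(t^1,\dots,t^p)$, and $dt^1\wedge\dots\wedge dt^p$ is Lebesgue measure. $\mathbb{R}^+=[0,\infty)$ and $|x|=\sqrt{\delta_{ij}x^ix^j}$ is the Euclidean norm on $\mathbb{R}^n$. $\nabla F(t,x)=\nabla_xF(t,x)$ is the gradient with respect to $x$. $C_T^\infty$ is the space of all indefinitely differentiable functions $\mathbb{R}^p\to\mathbb{R}^n$ that are multiple $T$-periodic (periodic in each variable $t^i$ with period $T^i$). Weak derivatives are defined with test functions in $C_T^\infty$: $w_\alpha$ is the weak derivative $\partial u/\partial t^\alpha$ of $u$ if $\int_{T_0}\delta_{ij}u^i\,\frac{\partial v^j}{\partial t^\alpha}\,dt^1\wedge\dots\wedge dt^p=-\int_{T_0}\delta_{ij}w_\alpha^i v^j\,dt^1\wedge\dots\wedge dt^p$ for all $v\in C_T^\infty$. $H_T^1$ (the Sobolev space $W_T^{1,2}$) is the Hilbert space of functions $u\in L^2[T_0,\mathbb{R}^n]$ having weak derivatives $\frac{\partial u}{\partial t}\in L^2$ in this sense, with scalar product $\langle u,v\rangle=\int_{T_0}\left(\delta_{ij}u^iv^j+\delta_{ij}\delta^{\alpha\beta}\frac{\partial u^i}{\partial t^\alpha}\frac{\partial v^j}{\partial t^\beta}\right)dt^1\wedge\dots\wedge dt^p$ (summation over repeated indices). A function $u\in H^1_T$ has weak Laplacian $\Delta u$ (an integrable $\mathbb{R}^n$-valued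 function on $T_0$) if $\int_{T_0}\delta^{\alpha\beta}\delta_{ij}\frac{\partial u^i}{\partial t^\alpha}\frac{\partial v^j}{\partial t^\beta}\,dt^1\wedge\dots\wedge dt^p=-\int_{T_0}\delta_{ij}(\Delta u)^iv^j\,dt^1\wedge\dots\wedge dt^p$ for all $v\in C^\infty_T$. $S_i^-$ and $S_i^+$ are the opposite faces of $T_0$ given by $t^i=0$ and $t^i=T^i$, identified by translation; boundary values are understood in the sense of traces. A solution of the problem in 1) is a function $u\in H_T^1$ having a weak Laplacian, satisfying the equation a.e. on $T_0$ and the boundary conditions. *)

(* Defs.v *)
(* R^p is the normed module 'rV[R]_p. *)
From HB Require Import structures.
From mathcomp Require Import all_boot all_order all_algebra.
From mathcomp Require Import all_classical all_reals all_analysis.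

Set Implicit Arguments.
Unset Strict Implicit.
Unset Printing Implicit Defensive.

Import Order.TTheory GRing.Theory Num.Theory.
Import numFieldNormedType.Exports.

Local Open Scope classical_set_scope.
Local Open Scope ring_scope.

(* [vinsert i c s] inserts the coordinate [c] at position [i] in [s]. *)
Definition vinsert (R : Type) (p : nat) (i : 'I_p) (c : R) (s : 'rV[R]_p.-1)
  : 'rV[R]_p := \row_j oapp (s ord0) c (unlift i j).

(* 'rV[R]_p with the product sigma-algebra of the Borel sets of R, that is, the
   smallest one for which the coordinates are measurable. *)
Definition borelRV (R : realType) (p : nat) : Type := 'rV[R]_p.

Definition borelRV_display : measure_display.
Proof. by constructor. Qed.

Section borelRV.
Context {R : realType} (p : nat).

Let coord : 'I_p -> borelRV R p -> measurableTypeR R :=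
  fun i (x : 'rV[R]_p) => x ord0 i.

Let borelRV_set0 : g_sigma_preimage coord set0.
Proof. exact: sigma_algebra0. Qed.

Let borelRV_setC A : g_sigma_preimage coord A -> g_sigma_preimage coord (~` A).
Proof. exact: sigma_algebraC. Qed.

Let borelRV_bigcup (F : _^nat) : (forall i, g_sigma_preimage coord (F i)) ->
  g_sigma_preimage coord (\bigcup_i (F i)).
Proof. exact: sigma_algebra_bigcup. Qed.

HB.instance Definition _ := Pointed.copy (borelRV R p) 'rV[R]_p.
HB.instance Definition _ := @isMeasurable.Build borelRV_display
  (borelRV R p) (g_sigma_preimage coord)
  borelRV_set0 borelRV_setC borelRV_bigcup.

Lemma measurable_coord (i : 'I_p) :
  measurable_fun setT
    ((fun x => (x : 'rV[R]_p) ord0 i) : borelRV R p -> measurableTypeR R).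
Proof.
move=> _ Y mY; rewrite setTI; apply: sub_sigma_algebra => /=.
rewrite -bigcup_seq/=; exists i => /=; first by rewrite mem_index_enum.
by exists Y => //; rewrite setTI.
Qed.

Lemma measurable_fun_coordP d (T : measurableType d) (f : T -> borelRV R p) :
  (forall i, measurable_fun setT
     ((fun x => (f x : 'rV[R]_p) ord0 i) : T -> measurableTypeR R)) ->
  measurable_fun setT f.
Proof.
move=> mf.
suff: g_sigma_preimage (fun i => coord i \o f) `<=` measurable.
  rewrite g_sigma_preimage_comp => prefS _ A mA.
  by apply: prefS; exists A.
apply: smallest_sub; first exact: sigma_algebra_measurable.
rewrite -bigcup_seq/=; apply: bigcup_sub => i _.
by move=> A [B mB <-]; exact: mf.
Qed.

End borelRV.

Lemma measurable_vinsert_max (R : realType) (p : nat) :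
  measurable_fun setT
    ((fun z => vinsert (@ord_max p) z.2 z.1)
      : borelRV R p * measurableTypeR R -> borelRV R p.+1).
Proof.
apply: measurable_fun_coordP => i.
rewrite [X in measurable_fun _ X](_ : _ = fun z : borelRV R p * measurableTypeR R =>
    oapp ((z.1 : 'rV[R]_p) ord0) z.2 (unlift ord_max i)); last first.
  by apply/funext => z; rewrite /vinsert mxE.
case: (unlift ord_max i) => [j|] /=; last exact: measurable_snd.
exact: (measurableT_comp (measurable_coord j) measurable_fst).
Qed.

Section product_vinsert.
Context {R : realType} (p : nat).
Variable m : {measure set (borelRV R p) -> \bar R}.

Definition product_vinsert : set (borelRV R p.+1) -> \bar R :=
  pushforward (m \x lebesgue_measure)%E
    ((fun z => vinsert (@ord_max p) z.2 z.1)
      : borelRV R p * measurableTypeR R -> borelRV R p.+1).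

Let mi := @measurable_vinsert_max R p.

HB.instance Definition _ := Measure.copy product_vinsert
  (@measure_function_pushforward__canonical__measure_function_Measure
    _ _ _ _ _ _ _ mi).

End product_vinsert.

Fixpoint borel_lebesgue (R : realType) (p : nat)
    : {measure set (borelRV R p) -> \bar R} :=
  match p with
  | 0 => \d_((0 : 'rV[R]_0) : borelRV R 0)
  | q.+1 => product_vinsert (borel_lebesgue R q)
  end.

(* R^p with the sigma-algebra of the Lebesgue measurable sets, and the
   (complete) Lebesgue measure; for p = 0, a unit point mass. *)
Definition lebRV (R : realType) (p : nat) : measurableType _ :=
  caratheodory_type ((borel_lebesgue R p)^*)%mu.

Definition leb (R : realType) (p : nat) : {measure set (lebRV R p) -> \bar R} :=
  @completed_measure_extension _ _ _ (borel_lebesgue R p).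

Section euclidean.
Context {R : realType} {n : nat}.

Definition dotv (x y : 'rV[R]_n) : R := \sum_(i < n) x ord0 i * y ord0 i.

(* the library norm of 'rV[R]_n is the supremum norm *)
Definition enorm (x : 'rV[R]_n) : R := Num.sqrt (dotv x x).

End euclidean.

Section differential_calculus.
Context {R : realType} {p : nat} {W : normedModType R}.
Implicit Type f : 'rV[R]_p -> W.

Definition partial (i : 'I_p) f : 'rV[R]_p -> W :=
  fun t => 'D_(delta_mx ord0 i) f t.

Fixpoint Ck (k : nat) f : Prop :=
  match k with
  | 0 => continuous f
  | l.+1 => continuous f /\ forall i : 'I_p,
      (forall t, derivable f t (delta_mx ord0 i)) /\ Ck l (partial i f)
  end.

Definition Coo f : Prop := forall k, Ck k f.

End differential_calculus.

Definition grad (R : realType) (n : nat) (f : 'rV[R]_n -> R) (x : 'rV[R]_n)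
  : 'rV[R]_n := \row_i partial i (f : 'rV[R]_n -> R^o) x.

Definition strictly_convex (R : realType) (n : nat) (f : 'rV[R]_n -> R) : Prop :=
  forall (x y : 'rV[R]_n) (l : R), x <> y -> 0 < l -> l < 1 ->
    f (l *: x + (1 - l) *: y) < l * f x + (1 - l) * f y.

(* [a] is of class C^1 on [0, +oo[ with derivative [a'], one-sided at 0; the
   values on ]-oo, 0[ play no role. *)
Definition C1_Rplus (R : realType) (a a' : R -> R) : Prop :=
  (forall x : R, 0 <= x ->
     (a y - a x) / (y - x) @[y --> within `[0, +oo[%classic x^'] --> a' x) /\
  {within `[0, +oo[%classic, continuous a'}.

Definition box (R : realType) (p : nat) (T : 'rV[R]_p) : set 'rV[R]_p :=
  [set t | forall i, 0 <= t ord0 i <= T ord0 i].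

Lemma measurable_box (R : realType) p (T : 'rV[R]_p) : measurable (box T : set (borelRV R p)).
Proof.
rewrite (_ : box T = \big[setI/setT]_(i < p) ((fun x : borelRV R p => (x : 'rV[R]_p) ord0 i) @^-1` `[0, T ord0 i])).
  apply: bigsetI_measurable => i _; rewrite -[X in measurable X]setTI.
  apply: (measurable_coord (R:=R) (p:=p) i); first exact: measurableT.
  exact: measurable_itv.
rewrite -bigcap_seq; apply/seteqP; split => x /= h i.
  by move=> _ /=; rewrite in_itv /= h.
have := h i; rewrite /= mem_index_enum in_itv /=; exact.
Qed.

Lemma borel_lebesgue_box (R : realType) p (T : 'rV[R]_p) : (forall i, 0 <= T ord0 i) ->
  borel_lebesgue R p (box T) = (\prod_i T ord0 i)%:E.
Proof.
elim: p T => [|p IH] T T0 /=.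
  rewrite big_ord0 diracE mem_set//=; by case.
rewrite /product_vinsert /pushforward.
rewrite (_ : _ @^-1` _ = box (\row_k T ord0 (lift ord_max k) : 'rV[R]_p) `*` `[0, T ord0 ord_max]%classic).
  rewrite product_measure1E//; last exact: measurable_box.
  rewrite IH; last by move=> i; rewrite mxE.
  rewrite [X in (_ * X)%E](_ : _ = (T ord0 ord_max)%:E); last first.
    rewrite [LHS]lebesgue_measure_itv /= lte_fin oppr0 adde0.
    by have := T0 ord_max; rewrite le_eqVlt => /orP[/eqP <-|->//]; rewrite ltxx.
  rewrite big_ord_recr /=.
  rewrite (eq_bigr (fun i => T ord0 (widen_ord (leqnSn p) i))); last first.
    by move=> i _; rewrite mxE; congr (T _ _); apply/val_inj; rewrite /= /bump leqNgt ltn_ord.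
  by rewrite EFinM.
apply/seteqP; split => -[x c] /= h.
  split => /=; last by have := h ord_max; rewrite mxE unlift_none in_itv.
  by move=> i; have := h (lift ord_max i); rewrite !mxE liftK.
move=> i; rewrite mxE; case: unliftP => [j ->|->] /=.
  by have := h.1 j; rewrite mxE.
by have := h.2; rewrite /= in_itv.
Qed.

Lemma leb_box (R : realType) p (T : 'rV[R]_p) : (forall i, 0 <= T ord0 i) ->
  leb R p (box T) = (\prod_i T ord0 i)%:E.
Proof.
move=> T0; rewrite -borel_lebesgue_box//; apply: measurable_mu_extE; exact: measurable_box.
Qed.

Section sobolev.
Context {R : realType}.
Local Notation leb := (leb R).

(* L^2(D, R^n); the sigma-algebra on the codomain is the Borel one *)
Definition L2 (p n : nat) (D : set 'rV[R]_p) (u : 'rV[R]_p -> 'rV[R]_n) : Prop :=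
  measurable_fun (D : set (lebRV R p)) (u : lebRV R p -> borelRV R n) /\
  (\int[leb p]_(t in D) (enorm (u t) ^+ 2)%:E < +oo)%E.

Definition L2_cvg (p n : nat) (D : set 'rV[R]_p)
    (phi : nat -> 'rV[R]_p -> 'rV[R]_n) (u : 'rV[R]_p -> 'rV[R]_n) : Prop :=
  (\int[leb p]_(t in D) (enorm (phi k t - u t) ^+ 2)%:E)%E @[k --> \oo] --> 0%E.

Definition integrable_rV (p n : nat) (D : set 'rV[R]_p)
    (f : 'rV[R]_p -> 'rV[R]_n) : Prop :=
  forall j, (leb p).-integrable D (fun t => (f t ord0 j)%:E).

(* componentwise integral *)
Definition integral_rV (p n : nat) (D : set 'rV[R]_p)
    (f : 'rV[R]_p -> 'rV[R]_n) : 'rV[R]_n :=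
  \row_j \int[leb p]_(t in D) f t ord0 j.

Context {p n : nat}.
Variable T : 'rV[R]_p.
Implicit Types (u v w f : 'rV[R]_p -> 'rV[R]_n).
Implicit Types (du : 'I_p -> 'rV[R]_p -> 'rV[R]_n).

Definition CooT v : Prop :=
  Coo v /\ forall (i : 'I_p) t, v (t + T ord0 i *: delta_mx ord0 i) = v t.

Definition weak_partial (al : 'I_p) u w : Prop :=
  forall v, CooT v ->
    \int[leb p]_(t in box T) dotv (u t) (partial al v t) =
    - \int[leb p]_(t in box T) dotv (w t) (v t).

(* [u] is in H^1_T, with weak partial derivatives [du] *)
Definition H1T_with u du : Prop :=
  [/\ L2 (box T) u, forall al, L2 (box T) (du al)
    & forall al, weak_partial al u (du al)].

(* weak Laplacian of a function whose weak partial derivatives are [du] *)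
Definition weak_laplacian du f : Prop :=
  integrable_rV (box T) f /\
  forall v, CooT v ->
    \int[leb p]_(t in box T) (\sum_(al < p) dotv (du al t) (partial al v t)) =
    - \int[leb p]_(t in box T) dotv (f t) (v t).

(* [g] is the trace of [w] on the face t^i = c of the box (c = 0 or c = T^i),
   the face being parametrized by the box of the remaining coordinates: the
   L^2 limit of the restrictions to the face of functions smooth up to the
   boundary that converge to [w] in the (nonperiodic) space W^{1,2}. By
   completeness, the latter means that they converge to [w] in L^2 and that
   their partial derivatives converge in L^2. *)
Definition is_trace (i : 'I_p) (c : R) w (g : 'rV[R]_p.-1 -> 'rV[R]_n) : Prop :=
  L2 (box (\row_k T ord0 (lift i k))) g /\
  exists (phi : nat -> 'rV[R]_p -> 'rV[R]_n)
         (z : 'I_p -> 'rV[R]_p -> 'rV[R]_n),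
    [/\ forall k, Coo (phi k),
        L2 (box T) w /\ L2_cvg (box T) phi w,
        forall al, L2 (box T) (z al) /\
                   L2_cvg (box T) (fun k => partial al (phi k)) (z al)
      & L2_cvg (box (\row_k T ord0 (lift i k)))
          (fun k s => phi k (vinsert i c s)) g].

Definition periodic_trace (i : 'I_p) w : Prop :=
  exists g, is_trace i 0 w g /\ is_trace i (T ord0 i) w g.

Definition is_solution (G : 'rV[R]_p -> 'rV[R]_n -> 'rV[R]_n) u : Prop :=
  exists du f,
    [/\ H1T_with u du,
        weak_laplacian du f,
        {ae leb p, forall t, box T t -> f t = G t (u t)}
      & forall i : 'I_p, periodic_trace i u /\
                         forall al, periodic_trace i (du al)].

End sobolev.

(* Main.v *)
(* 1) => 3) and 2) => 3). Testing the equation against constants, or taking [u]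
   constant, gives an integrable [u] with zero integral of [grad F(t, u(t))]. So
   [x |-> \int F(t, x + u(t)) dt] is strictly convex with a critical point at 0:
   it has a strict minimum there and grows at least linearly. As [a'] is bounded
   above, [F(t, .)] grows at most linearly and, being convex, is Lipschitz
   uniformly in [t]; hence replacing [x + u(t)] by [x] costs a bounded amount.

   3) => 2). A minimum point of the integral is a critical point.

   3) => 1). Minimise [E(u) = 1/2 \int |du|^2 + \int F(t, u)] over trigonometric
   polynomials. Poincare's inequality and 3) bound [E] from below and keep the
   mean values of a minimising sequence bounded; by the parallelogram identity
   and convexity the sequence is Cauchy in [H^1_T], and its limit solves
   [lap u = f], [f = grad F(t, u)], weakly, with [f] bounded of mean zero. The
   traces of the derivatives require [u] in [H^2]: if trigonometric polynomials
   [r_k] of mean zero tend to [f] in L^2, then [lap y_k = r_k] is solved frequency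
   by frequency, and [|d_a d_b v| <= |lap v|] in L^2 makes [y_k] converge to [u]
   up to the second derivatives. The restrictions of the [y_k] and of their
   derivatives to the faces converge, to the same limits on opposite faces.

   The sequences are chosen with squared L^2 distances of order [8^-k], so that
   completeness of L^2 is only used for geometrically fast Cauchy sequences. *)
Require Import Defs.
From HB Require Import structures.
From mathcomp Require Import all_boot all_order all_algebra.
From mathcomp Require Import all_classical all_reals all_analysis.
From mathcomp Require Import measurable_realfun ring lra.

Set Implicit Arguments.
Unset Strict Implicit.
Unset Printing Implicit Defensive.

Import Order.TTheory GRing.Theory Num.Theory.
Import numFieldNormedType.Exports.

Local Open Scope classical_set_scope.
Local Open Scope ring_scope.

(** * Square-integrable functions *)

(** No weak compactness and no Fourier series enter. A trigonometric polynomial is a finite list, on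
    which derivatives, products, the Laplacian and its inverse act entry by entry; the rest is a
    limit of polynomials in L^2. The energy is evaluated at polynomials only: the Euler equation
    comes from perturbing the terms of the minimising sequence while their excess energy tends to 0.
    It is tested against trigonometric polynomials; smooth periodic test functions need not be
    approximated, since the polynomials converging to the solution can be integrated by parts
    against any of them. Density rests on orthogonality: a function orthogonal to all trigonometric
    polynomials has zero integral over boxes []0, c[], whose indicators are bounded pointwise limits
    of such polynomials; hence over Borel sets, and it vanishes almost everywhere. The class C^1 is
    given by partial derivatives; the slope of a convex function in an arbitrary direction is
    obtained from midpoints. *)

HB.lock Definition ip {d : measure_display} {X : measurableType d} {R : realType}
    (mu : {measure set X -> \bar R}) (D : set X) (f g : X -> R) : R :=
  \int[mu]_(x in D) (f x * g x).

Section square_integrable.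
Context {d : measure_display} {X : measurableType d} {R : realType}.
Context (mu : {measure set X -> \bar R}) (D : set X).
Context (mD : measurable D) (finD : (mu D < +oo)%E).
Implicit Types f g h : X -> R.

Definition integrableR f := mu.-integrable D (EFin \o f).
Local Notation I1 := integrableR.

Definition sqint f := measurable_fun D f /\ I1 (fun x => f x ^+ 2).

Local Notation ip := (ip mu D).

Lemma ipE f g : ip f g = \int[mu]_(x in D) (f x * g x).
Proof. by rewrite ip.unlock. Qed.

Definition nrm2 f := ip f f.

Lemma nrm2E f : nrm2 f = \int[mu]_(x in D) (f x * f x).
Proof. exact: ipE. Qed.

Lemma integrableR_mfun f : I1 f -> measurable_fun D f.
Proof. by move=> /measurable_int /measurable_EFinP. Qed.

Lemma integrableR_le f g : measurable_fun D f ->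
  (forall x, D x -> `|f x| <= g x) -> I1 g -> I1 f.
Proof.
move=> mf fg Ig; apply: (le_integrable mD _ _ Ig); first exact/measurable_EFinP.
by move=> x Dx /=; rewrite lee_fin (le_trans (fg _ Dx))// ler_norm.
Qed.

Lemma eq_integrableR f g : {in D, f =1 g} -> I1 f -> I1 g.
Proof. by move=> fg; apply: eq_integrable => // x xD /=; rewrite fg. Qed.

Lemma integrableR_D f g : I1 f -> I1 g -> I1 (fun x => f x + g x).
Proof. by move=> If Ig; exact: (integrableD mD If Ig). Qed.

Lemma integrableR_B f g : I1 f -> I1 g -> I1 (fun x => f x - g x).
Proof. by move=> If Ig; exact: (integrableB mD If Ig). Qed.

Lemma integrableR_Z k f : I1 f -> I1 (fun x => k * f x).
Proof. by move=> If; exact: (integrableZl mD k If). Qed.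

Lemma integrableR_norm f : I1 f -> I1 (fun x => `|f x|).
Proof. exact: integrable_norm. Qed.

Lemma integrableR_sum (J : Type) (s : seq J) (F : J -> X -> R) :
  (forall j, I1 (F j)) -> I1 (fun x => \sum_(j <- s) F j x).
Proof.
move=> IF; elim: s => [|j s IH].
  apply: (eq_integrableR (f := cst 0)); first by move=> x _; rewrite big_nil.
  exact: integrable0.
apply: (eq_integrableR (f := fun x => F j x + \sum_(j <- s) F j x)).
  by move=> x _; rewrite big_cons.
exact: integrableR_D.
Qed.

Lemma integrableR_cst k : I1 (cst k).
Proof.
apply/integrableP; split; first exact/measurable_EFinP/measurable_cst.
under eq_integral do rewrite /=.
by rewrite integral_cst//= lte_mul_pinfty ?lee_fin.
Qed.

Lemma integrableR_bnd f k : measurable_fun D f -> (forall x, D x -> `|f x| <= k) -> I1 f.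
Proof.
by move=> mf fk; apply: (integrableR_le mf (g := cst k)) => //; exact: integrableR_cst.
Qed.

Lemma integral_sumR (J : Type) (s : seq J) (F : J -> X -> R) :
  (forall j, I1 (F j)) ->
  \int[mu]_(x in D) (\sum_(j <- s) F j x) = \sum_(j <- s) \int[mu]_(x in D) F j x.
Proof.
move=> IF; elim: s => [|j s IH].
  rewrite big_nil; under eq_Rintegral do rewrite big_nil.
  by rewrite Rintegral_cst// mul0r.
rewrite big_cons -IH -(RintegralD mD (IF j) (integrableR_sum s IF)).
by apply: eq_Rintegral => x _; rewrite big_cons.
Qed.

Lemma sqint_mfun f : sqint f -> measurable_fun D f.
Proof. by case. Qed.

Lemma sqint_le f g : measurable_fun D f -> (forall x, D x -> `|f x| <= `|g x|) ->
  sqint g -> sqint f.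
Proof.
move=> mf fg [mg Ig]; split => //; apply: integrableR_le Ig; first exact: measurable_funX.
move=> x Dx; rewrite normrX -[leRHS]ger0_norm ?sqr_ge0// normrX.
by rewrite lerXn2r ?nnegrE// fg.
Qed.

Lemma sqint_mul f g : sqint f -> sqint g -> I1 (fun x => f x * g x).
Proof.
move=> [mf If] [mg Ig]; apply: integrableR_le (integrableR_D If Ig).
  exact: measurable_funM.
move=> x _; rewrite ler_norml; apply/andP; split.
  have := sqr_ge0 (f x + g x); nra.
have := sqr_ge0 (f x - g x); nra.
Qed.

Lemma sqintZ k f : sqint f -> sqint (fun x => k * f x).
Proof.
move=> [mf If]; split; first exact: measurable_funM.
apply: eq_integrableR (integrableR_Z (k ^+ 2) If) => x _.
by rewrite exprMn.
Qed.

Lemma sqintD f g : sqint f -> sqint g -> sqint (fun x => f x + g x).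
Proof.
move=> sf sg; have [mf If] := sf; have [mg Ig] := sg.
split; first exact: measurable_funD.
apply: eq_integrableR (integrableR_D (integrableR_D If Ig)
  (integrableR_Z 2 (sqint_mul sf sg))) => x _.
by ring.
Qed.

Lemma sqintB f g : sqint f -> sqint g -> sqint (fun x => f x - g x).
Proof.
move=> sf sg; have := sqintD sf (sqintZ (-1) sg).
by congr sqint; apply/funext => x; rewrite mulN1r.
Qed.

Lemma sqint_bnd f k : measurable_fun D f -> (forall x, D x -> `|f x| <= k) -> sqint f.
Proof.
move=> mf fk; split => //; apply: (integrableR_bnd (k := k ^+ 2)).
  exact: measurable_funX.
move=> x Dx; rewrite normrX lerXn2r ?nnegrE ?fk//.
by rewrite (le_trans _ (fk _ Dx)).
Qed.

Lemma sqint_cst k : sqint (cst k).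
Proof. by apply: (@sqint_bnd _ `|k|) => //; exact: measurable_cst. Qed.

Lemma sqint_sum (J : Type) (s : seq J) (F : J -> X -> R) :
  (forall j, sqint (F j)) -> sqint (fun x => \sum_(j <- s) F j x).
Proof.
move=> IF; elim: s => [|j s IH].
  by rewrite (_ : (fun _ => _) = cst 0); [exact: sqint_cst|apply/funext => x; rewrite big_nil].
rewrite (_ : (fun _ => _) = (fun x => F j x + \sum_(j <- s) F j x)).
  exact: sqintD.
by apply/funext => x; rewrite big_cons.
Qed.

Lemma sqint_norm f : sqint f -> sqint (fun x => `|f x|).
Proof.
move=> sf; apply: (sqint_le _ _ sf) => [|x _]; last by rewrite normr_id.
by apply: measurableT_comp => //; exact: sqint_mfun.
Qed.

Lemma sqint_integrable f : sqint f -> I1 f.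
Proof.
move=> sf; have := sqint_mul sf (sqint_cst 1).
by apply: eq_integrableR => x _ /=; rewrite mulr1.
Qed.

Lemma ipC f g : ip f g = ip g f.
Proof. by rewrite !ipE; apply: eq_Rintegral => x _; rewrite mulrC. Qed.

Lemma ipDl f g h : sqint f -> sqint g -> sqint h ->
  ip (fun x => f x + g x) h = ip f h + ip g h.
Proof.
move=> sf sg sh; rewrite !ipE -(RintegralD mD (sqint_mul sf sh) (sqint_mul sg sh)).
by apply: eq_Rintegral => x _; rewrite mulrDl.
Qed.

Lemma ipZl k f h : sqint f -> sqint h -> ip (fun x => k * f x) h = k * ip f h.
Proof.
move=> sf sh; rewrite !ipE -(RintegralZl k mD (sqint_mul sf sh)).
by apply: eq_Rintegral => x _; rewrite mulrA.
Qed.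

Lemma ipBl f g h : sqint f -> sqint g -> sqint h ->
  ip (fun x => f x - g x) h = ip f h - ip g h.
Proof.
move=> sf sg sh; rewrite -[- ip g h]mulN1r -ipZl// -ipDl//; last exact: sqintZ.
by rewrite !ipE; apply: eq_Rintegral => x _; rewrite mulN1r.
Qed.

Lemma ipDr f g h : sqint f -> sqint g -> sqint h ->
  ip h (fun x => f x + g x) = ip h f + ip h g.
Proof. by move=> sf sg sh; rewrite ipC ipDl// ![ip h _]ipC. Qed.

Lemma ipZr k f h : sqint f -> sqint h -> ip h (fun x => k * f x) = k * ip h f.
Proof. by move=> sf sh; rewrite ipC ipZl// [ip h _]ipC. Qed.

Lemma ipBr f g h : sqint f -> sqint g -> sqint h ->
  ip h (fun x => f x - g x) = ip h f - ip h g.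
Proof. by move=> sf sg sh; rewrite ipC ipBl// ![ip h _]ipC. Qed.

Lemma ip_suml (J : Type) (s : seq J) (F : J -> X -> R) h :
  (forall j, sqint (F j)) -> sqint h ->
  ip (fun x => \sum_(j <- s) F j x) h = \sum_(j <- s) ip (F j) h.
Proof.
move=> sF sh; under [RHS]eq_bigr do rewrite ipE.
rewrite ipE -integral_sumR; last by move=> j; exact: sqint_mul.
by apply: eq_Rintegral => x _; rewrite mulr_suml.
Qed.

Lemma nrm2_ge0 f : 0 <= nrm2 f.
Proof. by rewrite /nrm2 ipE; apply: Rintegral_ge0 => x _; rewrite -expr2 sqr_ge0. Qed.

Lemma nrm2Z k f : sqint f -> nrm2 (fun x => k * f x) = k ^+ 2 * nrm2 f.
Proof.
move=> sf; rewrite /nrm2 ipZl//; last exact: sqintZ.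
by rewrite ipC ipZl// mulrA.
Qed.

Lemma nrm2D f g : sqint f -> sqint g ->
  nrm2 (fun x => f x + g x) = nrm2 f + 2 * ip f g + nrm2 g.
Proof.
move=> sf sg; rewrite /nrm2 ipDl//; last exact: sqintD.
rewrite !ipDr// [ip g f]ipC; ring.
Qed.

Lemma nrm2B f g : sqint f -> sqint g ->
  nrm2 (fun x => f x - g x) = nrm2 f - 2 * ip f g + nrm2 g.
Proof.
move=> sf sg; rewrite /nrm2 ipBl//; last exact: sqintB.
rewrite !ipBr// [ip g f]ipC; ring.
Qed.

Lemma nrm2BC f g : nrm2 (fun x => f x - g x) = nrm2 (fun x => g x - f x).
Proof. by rewrite /nrm2 !ipE; apply: eq_Rintegral => x _; rewrite -mulrNN !opprB. Qed.

Lemma nrm2_addle f g : sqint f -> sqint g ->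
  nrm2 (fun x => f x + g x) <= 2 * nrm2 f + 2 * nrm2 g.
Proof.
move=> sf sg; have := nrm2_ge0 (fun x => f x - g x).
by rewrite (nrm2D sf sg) (nrm2B sf sg); lra.
Qed.

Lemma nrm2_triangle f g h : sqint f -> sqint g -> sqint h ->
  nrm2 (fun x => f x - h x) <= 2 * nrm2 (fun x => f x - g x) + 2 * nrm2 (fun x => g x - h x).
Proof.
move=> sf sg sh; apply: le_trans (nrm2_addle (sqintB sf sg) (sqintB sg sh)).
rewrite le_eqVlt; apply/orP; left; apply/eqP.
by rewrite /nrm2 !ipE; apply: eq_Rintegral => x _; rewrite subrKA.
Qed.

(** Discriminant argument: the squared norm of [s f - g] is nonnegative for every [s]. *)
Lemma cauchy_schwarz f g : sqint f -> sqint g -> ip f g ^+ 2 <= nrm2 f * nrm2 g.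
Proof.
move=> sf sg.
have H s : 0 <= s ^+ 2 * nrm2 f - 2 * s * ip f g + nrm2 g.
  have := nrm2_ge0 (fun x => s * f x - g x).
  by rewrite nrm2B ?nrm2Z ?ipZl//; [lra|exact: sqintZ].
have := nrm2_ge0 f; rewrite le_eqVlt => /orP[/eqP f0|f0].
  rewrite -f0 mul0r; have [->|n0] := eqVneq (ip f g) 0; first by rewrite expr0n.
  (* When [f] has norm 0 the quadratic is affine in [s]; this [s] gives it the value [-1]. *)
  have := H ((nrm2 g + 1) / (2 * ip f g)); rewrite -f0 mulr0 add0r.
  rewrite (_ : 2 * _ * _ = nrm2 g + 1); first by lra.
  by field.
have := H (ip f g / nrm2 f).
rewrite (_ : _ - _ = - (ip f g ^+ 2 / nrm2 f)); last by field; rewrite gt_eqF.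
rewrite addrC subr_ge0 ler_pdivrMr// => H1.
by rewrite mulrC.
Qed.

Lemma integral_norm_le f : sqint f ->
  (\int[mu]_(x in D) `|f x|) ^+ 2 <= fine (mu D) * nrm2 f.
Proof.
move=> sf; have := cauchy_schwarz (sqint_cst 1) (sqint_norm sf).
have -> : ip (cst 1) (fun x => `|f x|) = \int[mu]_(x in D) `|f x|.
  by rewrite ipE; apply: eq_Rintegral => x _; rewrite /= mul1r.
move=> /le_trans; apply; rewrite le_eqVlt; apply/orP; left; apply/eqP.
congr (_ * _); first by rewrite /nrm2 ipE /= Rintegral_cst// !mul1r.
by rewrite /nrm2 !ipE; apply: eq_Rintegral => x _; rewrite -!expr2 -normrX ger0_norm// sqr_ge0.
Qed.

Lemma ae_eq_Rintegral f g : measurable_fun D f -> measurable_fun D g ->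
  {ae mu, forall x, D x -> f x = g x} ->
  \int[mu]_(x in D) f x = \int[mu]_(x in D) g x.
Proof.
move=> mf mg fg; congr fine; apply: ae_eq_integral => //; try exact/measurable_EFinP.
case: fg => N [mN N0 sN]; exists N; split => // x /= H; apply: sN => /= H1.
by apply: H => Dx; congr EFin; exact: H1.
Qed.

Lemma nrm2_eq0 f : sqint f -> nrm2 f = 0 -> {ae mu, forall x, D x -> f x = 0}.
Proof.
move=> [mf If] f0; have mf2 : measurable_fun D (fun x => f x ^+ 2) by exact: measurable_funX.
have H : (\int[mu]_(x in D) `|(f x ^+ 2)%:E|)%E = 0%E.
  under eq_integral do rewrite gee0_abs ?lee_fin ?sqr_ge0//.
  rewrite -[LHS]fineK; last exact: integrable_fin_num.
  by congr EFin; rewrite /nrm2 ipE in f0; exact: f0.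
have := integral_abs_eq0 mD (f := EFin \o (fun x => f x ^+ 2)).
have mm : measurable_fun D (EFin \o (fun x => f x ^+ 2)) by exact/measurable_EFinP.
have /(ae_eq_integral_abs mu mD mm) := H.
case=> N [mN N0 sN] _; exists N; split => // x /= Hx; apply: sN => /= H1; apply: Hx => Dx.
by have [] := H1 Dx; move/eqP; rewrite sqrf_eq0 => /eqP.
Qed.

Lemma nrm2_0 f : {ae mu, forall x, D x -> f x = 0} -> sqint f -> nrm2 f = 0.
Proof.
move=> f0 [mf If]; rewrite /nrm2 ipE (ae_eq_Rintegral (g := cst 0)).
- by rewrite Rintegral_cst// mul0r.
- exact: measurable_funM.
- exact: measurable_cst.
case: f0 => N [mN N0 sN]; exists N; split => // x /= Hx; apply: sN => /= H1; apply: Hx => Dx.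
by rewrite H1// mulr0.
Qed.

Lemma EFin_nrm2 f : sqint f -> (\int[mu]_(x in D) (f x ^+ 2)%:E = (nrm2 f)%:E)%E.
Proof.
by move=> [mf If]; rewrite /nrm2 ipE /Rintegral fineK//; exact: integrable_fin_num.
Qed.

Lemma sqintP f : sqint f <->
  measurable_fun D f /\ (\int[mu]_(x in D) (f x ^+ 2)%:E < +oo)%E.
Proof.
split=> [sf|[mf If]]; first by split; [case: sf|rewrite EFin_nrm2// ltry].
split => //; apply/integrableP; split; first exact/measurable_EFinP/measurable_funX.
by under eq_integral do rewrite /= ger0_norm ?sqr_ge0//.
Qed.

End square_integrable.

Lemma cvg_sumr {R : realType} (S : Type) (F : set_system S) {FF : Filter F}
    (J : Type) (s : seq J) (f : J -> S -> R) (l : J -> R) :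
  (forall j, f j x @[x --> F] --> l j) ->
  \sum_(j <- s) f j x @[x --> F] --> \sum_(j <- s) l j.
Proof. by move=> fl; apply: cvg_big => // z; exact: add_continuous. Qed.

(** * Geometrically fast Cauchy sequences *)

Section fast_cauchy.
Context {R : realType}.

(** With [e k = 2 c 2^-k], the tail of the geometric series, [u + e] decreases and [u - e]
    increases; they squeeze the limit, and the error bound comes along. *)
Lemma fast_cauchy_cvg (u : nat -> R) (c : R) :
  (forall k, `|u k.+1 - u k| <= c * 2^-1 ^+ k) ->
  exists l, u @ \oo --> l /\ forall k, `|u k - l| <= 2 * c * 2^-1 ^+ k.
Proof.
move=> uc.
pose e k : R := 2 * c * 2^-1 ^+ k.
have eS k : e k.+1 = e k / 2 by rewrite /e exprS; ring.
have e0 : e @ \oo --> (0 : R).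
  rewrite -[0](mulr0 (2 * c)); apply: cvgMr; apply: cvg_expr.
  by rewrite ger0_norm ?invr_ge0//; lra.
have uc' k : e k / 2 = c * 2^-1 ^+ k by rewrite /e; field.
pose a k := u k + e k; pose b k := u k - e k.
have ab k : b k <= a k.
  rewrite /a /b; suff : 0 <= e k by lra.
  by have := uc k; rewrite -uc'; have := normr_ge0 (u k.+1 - u k); lra.
have a_ni : {homo a : m n / (m <= n)%N >-> n <= m}.
  apply/nonincreasing_seqP => k.
  have := uc k; rewrite /a eS -uc' /=; have := ler_norm (u k.+1 - u k); lra.
have b_nd : {homo b : m n / (m <= n)%N >-> m <= n}.
  apply/nondecreasing_seqP => k.
  have := uc k; rewrite /b eS -uc' /=; have := ler_norm (- (u k.+1 - u k)); rewrite normrN; lra.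
have ca : cvgn a.
  apply: nonincreasing_is_cvgn => //; exists (b 0%N) => _ [k _ <-].
  by rewrite (le_trans (b_nd 0%N k _))//.
have ual : u @ \oo --> limn a.
  rewrite -[limn a]subr0 (_ : u = (fun k => a k - e k)); first exact: cvgB.
  by apply/funext => k; rewrite /a addrK.
have bl : b @ \oo --> limn a by rewrite -[limn a]subr0; exact: cvgB.
exists (limn a); split => // k; rewrite ler_norml.
have := nonincreasing_cvgn_ge a_ni ca k.
have := nondecreasing_cvgn_le b_nd (cvgP _ bl) k; rewrite (cvg_lim _ bl)//.
by rewrite /a /b /e; lra.
Qed.

Lemma geo_half_sum (m : nat) : \sum_(0 <= k < m) 2^-1 ^+ k <= 2 :> R.
Proof.
suff -> : \sum_(0 <= k < m) 2^-1 ^+ k = 2 - 2 * 2^-1 ^+ m :> R.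
  by rewrite lerBlDr lerDl mulr_ge0// exprn_ge0.
elim: m => [|m IH]; first by rewrite big_nil expr0; ring.
by rewrite big_nat_recr//= IH exprS; field.
Qed.

End fast_cauchy.

Section fast_complete.
Context {d : measure_display} {X : measurableType d} {R : realType}.
Context (mu : {measure set X -> \bar R}) (D : set X).
Context (mD : measurable D) (finD : (mu D < +oo)%E).
Local Notation sqint := (sqint mu D).
Local Notation nrm2 := (nrm2 mu D).
Local Notation ip := (ip mu D).

(* [\sum_k 4^k (f_{k+1} - f_k)^2] has a finite integral, hence is finite almost
   everywhere, where [f] is then a Cauchy sequence. *)
Lemma L2_fast_complete (f : nat -> X -> R) (C : R) :
  (forall k, sqint (f k)) ->
  (forall k, nrm2 (fun x => f k.+1 x - f k x) <= C * 8^-1 ^+ k) ->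
  exists g, [/\ sqint g, nrm2 (fun x => f k x - g x) @[k --> \oo] --> 0 &
    {ae mu, forall x, D x -> f k x @[k --> \oo] --> g x}].
Proof.
move=> sf fC.
(* Of the rate [8^-k], the weight [4^k] leaves [2^-k] to sum the integrals, and it bounds the
   increments pointwise by a multiple of [2^-k]. *)
pose dd k x := 4 ^+ k * (f k.+1 x - f k x) ^+ 2.
have dd0 k x : 0 <= dd k x by apply: mulr_ge0; [exact: exprn_ge0|exact: sqr_ge0].
have mdd k : measurable_fun D (dd k).
  by apply: measurable_funM => //; apply: measurable_funX; apply: measurable_funB; exact: sqint_mfun (sf _).
have ddI k : (\int[mu]_(x in D) (dd k x)%:E <= (C * 2^-1 ^+ k)%:E)%E.
  have sB := sqintB mD (sf k.+1) (sf k).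
  under eq_integral do rewrite /dd EFinM.
  rewrite ge0_integralZl//; last 2 first.
  - by apply/measurable_EFinP; apply: measurable_funX; exact: sqint_mfun sB.
  - by move=> x _; rewrite lee_fin sqr_ge0.
  rewrite (EFin_nrm2 mD sB) -EFinM lee_fin.
  apply: le_trans (ler_wpM2l _ (fC k)) _; first by rewrite exprn_ge0.
  rewrite mulrCA -exprMn (_ : 4 * 8^-1 = 2^-1)//; by field.
have C0 : 0 <= C by have := fC 0%N; rewrite expr0 mulr1; apply: le_trans (nrm2_ge0 _ _ _).
pose G x := (\sum_(0 <= k <oo) (dd k x)%:E)%E.
have G0 x : (0 <= G x)%E by apply: nneseries_ge0 => k _ _; rewrite lee_fin.
have mG : measurable_fun D G.
  by apply: ge0_emeasurable_sum => [k x _ _|k _]; [rewrite lee_fin|exact/measurable_EFinP].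
have IG : (\int[mu]_(x in D) G x <= (2 * C)%:E)%E.
  rewrite integral_nneseries//; last 2 first.
  - by move=> k; exact/measurable_EFinP.
  - by move=> k x _; rewrite lee_fin.
  apply: lime_le.
    by apply: is_cvg_nneseries => k _ _; apply: integral_ge0 => x _; rewrite lee_fin.
  apply: nearW => m; apply: (@le_trans _ _ (\sum_(0 <= k < m) (C * 2^-1 ^+ k)%:E)%E).
    by apply: lee_sum => k _.
  rewrite sumEFin lee_fin -mulr_sumr mulrC ler_wpM2r//.
  exact: geo_half_sum.
have intG : mu.-integrable D G.
  apply/integrableP; split => //.
  under eq_integral do rewrite gee0_abs//.
  by rewrite (le_lt_trans IG)// ltry.
pose E := D `&` [set x | G x \is a fin_num].
have mE : measurable E by exact: emeasurable_fin_num.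
pose Gr x := fine (G x).
have intGr : integrableR mu D Gr.
  apply: (le_integrable mD _ _ intG).
    by apply/measurable_EFinP; apply: measurableT_comp => //; exact: measurable_fine.
  move=> x _; rewrite /Gr /= ger0_norm ?fine_ge0// gee0_abs//.
  by have := G0 x; case: (G x) => //= _; rewrite leey.
have bnd x k : E x -> `|f k.+1 x - f k x| <= Num.sqrt (Gr x) * 2^-1 ^+ k.
  move=> [Dx /= Gx].
  have ddG : dd k x <= Gr x.
    rewrite -lee_fin /Gr fineK//; apply: le_trans (nneseries_lim_ge (m:=0%N) k.+1 _).
      by rewrite big_nat_recr//= leeDr// sume_ge0// => i _; rewrite lee_fin.
    by move=> i _ _; rewrite lee_fin.
  rewrite -sqrtr_sqr -[2^-1 ^+ k]ger0_norm ?exprn_ge0// -sqrtr_sqr -sqrtrM; last by rewrite /Gr fine_ge0.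
  rewrite ler_sqrt; last by rewrite mulr_ge0 ?sqr_ge0// fine_ge0.
  rewrite -exprM mulnC exprM -ler_pdivrMr ?exprn_gt0 ?invr_gt0//.
  apply: le_trans ddG; rewrite /dd mulrC -exprVn (_ : (2^-1 ^+ 2)^-1 = 4)//.
  by rewrite exprVn invrK; ring.
(* Set to 0 off [E], the sequence converges everywhere on [D], so the limit is measurable even if
   the measure is not complete. *)
pose h k x := f k x * \1_E x.
pose g x := limn (h ^~ x).
have hE k x : E x -> h k x = f k x by move=> Ex; rewrite /h indicE mem_set// mulr1.
have hNE k x : ~ E x -> h k x = 0 by move=> Ex; rewrite /h indicE memNset// mulr0.
have mh k : measurable_fun D (h k).
  by apply: measurable_funM; [exact: sqint_mfun (sf k)|exact: measurable_indic].
have sh k : sqint (h k).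
  apply: (sqint_le mD _ _ (sf k)) => // x _.
  by have [Ex|Ex] := pselect (E x); [rewrite hE|rewrite hNE// normr0].
(* The tail bound [2 sqrt(Gr x) 2^-k], squared; integrating it gives the convergence in L^2. *)
have hg x : h k x @[k --> \oo] --> g x /\ forall k, (h k x - g x) ^+ 2 <= 4 * 4^-1 ^+ k * Gr x.
  have [Ex|Ex] := pselect (E x).
    have [l [fl lb]] := fast_cauchy_cvg (fun k => bnd x k Ex).
    have hl : h k x @[k --> \oo] --> l by under eq_fun do rewrite hE//.
    have gl : g x = l by rewrite /g (cvg_lim _ hl).
    rewrite gl; split => // k; rewrite hE//.
    have := lb k; rewrite -(ler_pXn2r (n:=2)) ?nnegrE ?normr_ge0 ?mulr_ge0 ?exprn_ge0 ?sqrtr_ge0//.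
    rewrite -normrX ger0_norm ?sqr_ge0// !exprMn sqr_sqrtr ?fine_ge0//.
    rewrite -exprM mulnC exprM (_ : 2^-1 ^+ 2 = 4^-1 :> R); last by field.
    by rewrite (_ : 2 ^+ 2 = 4); [lra|ring].
  have hl : h k x @[k --> \oo] --> (0 : R) by under eq_fun do rewrite hNE//; exact: cvg_cst.
  have gl : g x = 0 by rewrite /g (cvg_lim _ hl).
  rewrite gl; split => // k; rewrite hNE// subr0 expr0n/=.
  by apply: mulr_ge0; [apply: mulr_ge0 => //; exact: exprn_ge0|exact: fine_ge0].
have mg : measurable_fun D g by apply: (measurable_fun_cvg mh) => x _; exact: (hg x).1.
have intGk k : integrableR mu D (fun x => 4 * 4^-1 ^+ k * Gr x) by exact: integrableR_Z.
have shg k : sqint (fun x => h k x - g x).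
  have mB : measurable_fun D (fun x => h k x - g x) by exact: measurable_funB.
  split => //; apply: integrableR_le (intGk k) => //; first exact: measurable_funX.
  by move=> x Dx; rewrite ger0_norm ?sqr_ge0//; exact: (hg x).2.
have sg : sqint g.
  rewrite (_ : g = fun x => h 0%N x - (h 0%N x - g x)); first exact: sqintB.
  by apply/funext => x; rewrite subKr.
have aeE : {ae mu, forall x, D x -> E x}.
  have [N [mN N0 sN]] := integrable_ae mD intG.
  exists N; split => // x /= H; apply: sN => /= H1; apply: H => Dx; split => //.
  exact: H1.
exists g; split => //.
- have -> : (fun k => nrm2 (fun x => f k x - g x)) = (fun k => nrm2 (fun x => h k x - g x)).
    apply/funext => k; rewrite !nrm2E; apply: ae_eq_Rintegral => //.
    + by apply: measurable_funM; exact: sqint_mfun (sqintB mD (sf k) sg).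
    + by apply: measurable_funM; exact: sqint_mfun (shg k).
    case: aeE => N [mN N0 sN]; exists N; split => // x /= H; apply: sN => /= H1; apply: H => Dx.
    by rewrite hE//; exact: H1.
  apply: (@squeeze_cvgr _ _ _ _ (fun=> 0) (fun k => 4^-1 ^+ k * (4 * \int[mu]_(x in D) Gr x))).
  + apply: nearW => k; rewrite nrm2_ge0/= mulrA [_ * 4]mulrC -RintegralZl//.
    rewrite nrm2E; apply: le_Rintegral; [exact: mD|exact: (shg k).2|exact: intGk|].
    by move=> x _; exact: (hg x).2.
  + exact: cvg_cst.
  + rewrite -[0 in X in _ --> X](mul0r (4 * \int[mu]_(x in D) Gr x)); apply: cvgMl.
    by apply: cvg_expr; rewrite ger0_norm ?invr_ge0//; lra.
- case: aeE => N [mN N0 sN]; exists N; split => // x /= H; apply: sN => /= H1; apply: H => Dx.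
  have Ex := H1 Dx; have := (hg x).1.
  by rewrite (_ : h ^~ x = f ^~ x)//; apply/funext => k; exact: hE.
Qed.

(** [<f, f'> - <g, g'> = <f - g, f' - g'> + <f - g, g'> + <f' - g', g>], and by Cauchy-Schwarz every
    term has a factor tending to 0. *)
Lemma ip_cvg (f f' : nat -> X -> R) g g' :
  (forall k, sqint (f k)) -> (forall k, sqint (f' k)) -> sqint g -> sqint g' ->
  nrm2 (fun x => f k x - g x) @[k --> \oo] --> 0 ->
  nrm2 (fun x => f' k x - g' x) @[k --> \oo] --> 0 ->
  ip (f k) (f' k) @[k --> \oo] --> ip g g'.
Proof.
move=> sf sf' sg sg' fg fg'.
have sB k := sqintB mD (sf k) sg; have sB' k := sqintB mD (sf' k) sg'.
have cs (u v : nat -> X -> R) (c : R) : (forall k, sqint (u k)) -> (forall k, sqint (v k)) ->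
    nrm2 (u k) @[k --> \oo] --> 0 -> nrm2 (v k) @[k --> \oo] --> c ->
    ip (u k) (v k) @[k --> \oo] --> 0.
  move=> su sv u0 vc; apply/cvgr0Pnorm_lt => e e0.
  have : nrm2 (u k) * nrm2 (v k) @[k --> \oo] --> 0 by rewrite -(mul0r c); exact: cvgM.
  move=> /cvgr0_norm_lt /(_ (e ^+ 2)); rewrite exprn_gt0// => /(_ isT).
  apply: filterS => k H.
  rewrite -(ltr_pXn2r (n:=2)) ?nnegrE// ?(ltW e0)//.
  rewrite -normrX ger0_norm ?sqr_ge0//; apply: le_lt_trans H.
  by apply: le_trans (cauchy_schwarz mD (su k) (sv k)) (ler_norm _).
suff : (fun k => ip (fun x => f k x - g x) (fun x => f' k x - g' x) + ip (fun x => f k x - g x) g'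
    + ip (fun x => f' k x - g' x) g + ip g g') @ \oo --> (0 + 0 + 0 + ip g g').
  rewrite !add0r; under eq_fun => k.
    rewrite (ipBl mD) ?(ipBr mD)// (ipBl mD)// (ipBl mD)//.
    rewrite (_ : _ + _ = ip (f k) (f' k)); last by rewrite [ip (f' k) g]ipC [ip g' g]ipC; ring.
    over.
  by [].
apply: cvgD; last exact: cvg_cst.
apply: cvgD; first apply: cvgD.
- exact: cs fg fg'.
- by apply: (cs _ (fun=> g') (nrm2 g')) => //; exact: cvg_cst.
- by apply: (cs _ (fun=> g) (nrm2 g)) => //; exact: cvg_cst.
Qed.

End fast_complete.

(** * Lebesgue measure on boxes *)

Definition rect {R : realType} {p : nat} (A : 'I_p -> set R) : set 'rV[R]_p :=
  [set t | forall i, A i (t ord0 i)].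

Section borel_rect.
Context {R : realType}.

Lemma measurable_rect p (A : 'I_p -> set R) : (forall i, measurable (A i)) ->
  measurable (rect A : set (borelRV R p)).
Proof.
move=> mA.
rewrite (_ : rect A = \bigcap_(i in [set: 'I_p])
    ((fun x : borelRV R p => (x : 'rV[R]_p) ord0 i) @^-1` A i)); last first.
  apply/seteqP; split => t /= h i; first by move=> _; exact: h.
  exact: h.
apply: fin_bigcap_measurable; first exact: finite_finset.
move=> i _; rewrite -[X in measurable X]setTI.
exact: (@measurable_coord R p i measurableT (A i) (mA i)).
Qed.

Lemma rectI p (A B : 'I_p -> set R) : rect A `&` rect B = rect (fun i => A i `&` B i).
Proof.
apply/seteqP; split => t /=; [move=> [hA hB] i|move=> h]; first by split; [exact: hA|exact: hB].
by split=> i; case: (h i).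
Qed.

(** These quadrants are closed under intersection, and each cuts the box in a smaller box with a
    corner at the origin, or in nothing; the Dynkin induction of [perp_borel] starts from them. *)
Lemma measurable_borelRV_halfspaces p :
  @measurable _ (borelRV R p) =
    <<s [set B | exists c : 'I_p -> R, B = rect (fun i => `]-oo, c i[%classic)] >>.
Proof.
set G := [set B | _]; apply/seteqP; split; last first.
  apply: smallest_sub; first exact: sigma_algebra_measurable.
  by move=> _ [c ->]; apply: measurable_rect => i; exact: measurable_itv.
apply: smallest_sub; first exact: smallest_sigma_algebra.
rewrite -bigcup_seq/=; apply: bigcup_sub => i _.
pose S := g_sigma_algebraType G.
have mi : measurable_fun [set: S] ((fun x : S => (x : 'rV[R]_p) ord0 i) : S -> measurableTypeR R).
  apply: (measurability _ (RGenInftyO.measurableE R)).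
  move=> _ [_ [c ->] <-]; rewrite setTI.
  (* A half-space in the coordinate [i] is the union over [n] of the quadrants with bound [c] there
     and [n] elsewhere. *)
  rewrite (_ : _ @^-1` _ =
    \bigcup_n (rect (fun j => `]-oo, (if j == i then c else n%:R)[%classic) : set S)).
    apply: bigcup_measurable => n _; apply: sub_sigma_algebra.
    by exists (fun j => if j == i then c else n%:R).
  apply/seteqP; split => t /=; last first.
    by move=> [n _ /(_ i)]; rewrite eqxx.
  rewrite in_itv /= => tc.
  exists (Num.truncn (\big[Num.max/0]_j t ord0 j)).+1 => // j.
  rewrite /= in_itv/=; case: eqP => [->//|_].
  apply: le_lt_trans (truncnS_gt _).
  by rewrite (bigD1 j)//= le_max lexx.
move=> _ [B mB <-]; exact: mi.
Qed.

Definition rects p : set (set (borelRV R p)) :=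
  [set B | exists2 A : 'I_p -> set R, forall i, measurable (A i) & B = rect A].

Arguments rects : clear implicits.

Lemma measurable_borelRV_rects p : @measurable _ (borelRV R p) = <<s rects p >>.
Proof.
apply/seteqP; split; last first.
  apply: smallest_sub; first exact: sigma_algebra_measurable.
  by move=> _ [A mA ->]; exact: measurable_rect.
rewrite measurable_borelRV_halfspaces.
apply: smallest_sub; first exact: smallest_sigma_algebra.
move=> _ [c ->]; apply: sub_sigma_algebra; exists (fun i => `]-oo, c i[%classic) => // i.
Qed.

Definition cube p (k : nat) : set 'rV[R]_p := rect (fun=> `[- k%:R, k%:R]%classic).

Arguments cube : clear implicits.

Lemma bigcup_cube p : \bigcup_k cube p k = setT.
Proof.
apply/seteqP; split => // t _.
exists (Num.truncn (\big[Num.max/0]_j `|t ord0 j|)).+1 => // j.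
rewrite /= in_itv/= -ler_norml; apply: ltW; apply: le_lt_trans (truncnS_gt _).
by rewrite (bigD1 j)//= le_max lexx.
Qed.

(** Rectangles generate and are closed under intersection, and the cubes, of finite measure, exhaust
    the space. *)
Lemma borelRV_measure_unique p (m1 m2 : {measure set (borelRV R p) -> \bar R}) :
  (forall A : 'I_p -> set R, (forall i, measurable (A i)) -> m1 (rect A) = m2 (rect A)) ->
  (forall k, m1 (cube p k) < +oo)%E ->
  forall B, measurable B -> m1 B = m2 B.
Proof.
move=> m12 mc B mB.
apply: (@measure_unique _ _ _ (rects p) (fun k => cube p k)) => //.
- exact: measurable_borelRV_rects.
- move=> _ _ [A mA ->] [A' mA' ->]; rewrite rectI.
  by exists (fun i => A i `&` A' i) => // i; exact: measurableI.
- by move=> k; exists (fun=> `[- k%:R, k%:R]%classic) => // i; exact: measurable_itv.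
- exact: bigcup_cube.
- by move=> _ [A mA ->]; exact: m12.
Qed.

Definition pinsert p (i : 'I_p.+1) : borelRV R p * measurableTypeR R -> borelRV R p.+1 :=
  fun z => vinsert i z.2 z.1.

Lemma measurable_pinsert p (i : 'I_p.+1) : measurable_fun setT (pinsert i).
Proof.
apply: measurable_fun_coordP => j.
rewrite [X in measurable_fun _ X](_ : _ = fun z : borelRV R p * measurableTypeR R =>
    oapp ((z.1 : 'rV[R]_p) ord0) z.2 (unlift i j)); last first.
  by apply/funext => z; rewrite /pinsert /vinsert mxE.
case: (unlift i j) => [k|] /=; last exact: measurable_snd.
exact: (measurableT_comp (measurable_coord k) measurable_fst).
Qed.

Lemma pinsert_rect p (i : 'I_p.+1) (A : 'I_p.+1 -> set R) :
  pinsert i @^-1` (rect A) = rect (fun k => A (lift i k)) `*` A i.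
Proof.
apply/seteqP; split => -[x c] /= h.
  split => /=; last by have := h i; rewrite mxE unlift_none.
  by move=> k; have := h (lift i k); rewrite !mxE liftK.
move=> j; rewrite mxE; case: unliftP => [k ->|->] /=; last exact: h.2.
exact: h.1 k.
Qed.

Lemma borel_lebesgue_rect p (A : 'I_p -> set R) : (forall i, measurable (A i)) ->
  borel_lebesgue R p (rect A) = (\prod_(i < p) lebesgue_measure (A i))%E.
Proof.
elim: p A => [|p IH] A mA /=.
  by rewrite big_ord0 diracE mem_set//= => -[].
rewrite /product_vinsert /pushforward -/(pinsert ord_max) pinsert_rect.
rewrite product_measure1E; [|by apply: measurable_rect => k; exact: mA|exact: mA].
rewrite IH// big_ord_recr/=; congr (_ * _)%E.
apply: eq_bigr => j _; congr (lebesgue_measure (A _)).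
by apply/val_inj; rewrite /= /bump leqNgt ltn_ord.
Qed.

Lemma borel_lebesgue_cube p k : (borel_lebesgue R p (cube p k) < +oo)%E.
Proof.
rewrite borel_lebesgue_rect; last by move=> i; exact: measurable_itv.
set x := (X in (X < _)%E); suff /andP[] : (0 <= x < +oo)%E by []; rewrite {}/x.
apply: (big_ind (fun x : \bar R => is_true (0 <= x < +oo)%E)) => [|x y|i _].
- by rewrite lee01 ltry.
- case/andP => x0 xy /andP[y0 yy]; rewrite mule_ge0//=.
  by apply: lte_mul_pinfty => //; rewrite ge0_fin_numE.
- by rewrite measure_ge0/= lebesgue_measure_itv/=; case: ifP => // _; rewrite -EFinB ltry.
Qed.

Definition product_pinsert p (i : 'I_p.+1) : set (borelRV R p.+1) -> \bar R :=
  pushforward (borel_lebesgue R p \x lebesgue_measure)%E (pinsert i).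

HB.instance Definition _ p (i : 'I_p.+1) := Measure.copy (product_pinsert i)
  (@measure_function_pushforward__canonical__measure_function_Measure
    _ _ _ _ _ _ _ (measurable_pinsert i)).

(** The recursive definition splits off the last coordinate. Agreement on rectangles allows any
    coordinate to be split off, as integrating in the direction [i] requires. *)
Lemma borel_lebesgue_pinsert p (i : 'I_p.+1) (B : set (borelRV R p.+1)) : measurable B ->
  borel_lebesgue R p.+1 B =
  product_pinsert i B.
Proof.
pose m2 : {measure set (borelRV R p.+1) -> \bar R} := product_pinsert i.
move: B; apply: (@borelRV_measure_unique _ (borel_lebesgue R p.+1) m2); last first.
  by move=> k; exact: borel_lebesgue_cube.
move=> A mA; rewrite borel_lebesgue_rect//= /product_pinsert /pushforward pinsert_rect.
rewrite product_measure1E; [|by apply: measurable_rect => k; exact: mA|exact: mA].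
by rewrite borel_lebesgue_rect ?(bigD1_ord i)//= 1?muleC// => k; exact: mA.
Qed.

End borel_rect.

(** * The completed measure and Fubini's theorem on boxes *)

Section leb_borel.
Context {R : realType}.

Lemma measurable_lebRV p (A : set 'rV[R]_p) :
  measurable (A : set (borelRV R p)) -> measurable (A : set (lebRV R p)).
Proof.
move=> mA; apply: (@sub_caratheodory _ _ _ (borel_lebesgue R p)).
exact: sub_sigma_algebra.
Qed.

Lemma measurable_fun_lebRV p d (Y : measurableType d) (D : set 'rV[R]_p) (f : 'rV[R]_p -> Y) :
  measurable (D : set (borelRV R p)) ->
  measurable_fun (D : set (borelRV R p)) (f : borelRV R p -> Y) ->
  measurable_fun (D : set (lebRV R p)) (f : lebRV R p -> Y).
Proof. by move=> mD mf _ B mB; apply: measurable_lebRV; exact: mf. Qed.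

Lemma lebE p (A : set 'rV[R]_p) : measurable (A : set (borelRV R p)) ->
  leb R p A = borel_lebesgue R p A.
Proof. by move=> mA; exact: measurable_mu_extE. Qed.

(** The identity, from the completed to the Borel sigma-algebra, is measurable and pushes [leb]
    forward to [borel_lebesgue]. *)
Lemma integral_leb p (D : set 'rV[R]_p) (f : 'rV[R]_p -> \bar R) :
  measurable (D : set (borelRV R p)) ->
  measurable_fun (D : set (borelRV R p)) (f : borelRV R p -> \bar R) ->
  (\int[leb R p]_(t in D) f t = \int[borel_lebesgue R p]_(t in D) f t)%E.
Proof.
move=> mD mf.
have mid : measurable_fun [set: lebRV R p] (id : lebRV R p -> borelRV R p).
  by move=> _ B mB; rewrite setTI; exact: measurable_lebRV.
have H (g : 'rV[R]_p -> \bar R) : measurable_fun (D : set (borelRV R p)) (g : borelRV R p -> \bar R) ->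
    (forall t, 0 <= g t)%E ->
    (\int[leb R p]_(t in D) g t = \int[borel_lebesgue R p]_(t in D) g t)%E.
  move=> mg g0.
  have := @ge0_integral_pushforward _ _ _ _ R _ mid (leb R p) D g mD mg (fun t _ => g0 t).
  move=> <-; apply: eq_measure_integral => A mA _; exact: lebE.
rewrite integralE [RHS]integralE; congr (_ - _)%E; apply: H => //.
- exact: measurable_funepos.
- exact: measurable_funeneg.
Qed.

(** A copy of the measure that carries the sigma-finite instance required by Fubini's theorem. *)
Definition blm p : set (borelRV R p) -> \bar R := borel_lebesgue R p.

HB.instance Definition _ p := Measure.copy (@blm p) (borel_lebesgue R p).

Lemma blm_sigma_finite p : sigma_finite setT (@blm p).
Proof.
exists (fun k => @cube R p k); first by rewrite bigcup_cube.
move=> k; split; last exact: borel_lebesgue_cube.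
by apply: measurable_rect => i; exact: measurable_itv.
Qed.

HB.instance Definition _ p := @Measure_isSigmaFinite.Build _ (borelRV R p) R (@blm p) (@blm_sigma_finite p).

Lemma box_rect p (T : 'rV[R]_p) : box T = rect (fun i => `[0, T ord0 i]%classic).
Proof. by apply/seteqP; split => t h i; have := h i; rewrite /= in_itv. Qed.

Lemma leb_box_lty p (T : 'rV[R]_p) : (leb R p (box T) < +oo)%E.
Proof.
rewrite lebE; last exact: measurable_box.
have [N HN] : exists N, box T `<=` @cube R p N.
  exists (Num.truncn (\big[Num.max/0]_j `|T ord0 j|)).+1 => t bt j.
  have /andP[t0 tT] := bt j.
  rewrite /= in_itv/= (le_trans _ t0)/=; last by rewrite oppr_le0.
  apply: (le_trans tT); apply: (le_trans (ler_norm _)); apply: ltW.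
  by apply: le_lt_trans (truncnS_gt _); rewrite (bigD1 j)//= le_max lexx.
apply: le_lt_trans (borel_lebesgue_cube p N).
apply: le_measure => //; rewrite inE; first exact: measurable_box.
by apply: measurable_rect => i; exact: measurable_itv.
Qed.

Lemma measurable_box_leb p (T : 'rV[R]_p) : measurable (box T : set (lebRV R p)).
Proof. by apply: measurable_lebRV; exact: measurable_box. Qed.

(** [f] is taken Borel, since sections of Lebesgue measurable functions may fail to be measurable.
    Fubini's theorem is applied to its extension by 0 off the box, with the product measure
    transported along [pinsert i]. *)
Lemma Fubini_box p (i : 'I_p.+1) (T : 'rV[R]_p.+1) (f : 'rV[R]_p.+1 -> R) (K : R) :
  measurable_fun setT (f : borelRV R p.+1 -> R) ->
  (forall t, box T t -> `|f t| <= K) -> 0 <= T ord0 i ->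
  let g s := \int[lebesgue_measure]_(x in `[0, T ord0 i]) f (vinsert i x s) in
  let T' := \row_k T ord0 (lift i k) in
  [/\ measurable_fun (box T' : set (borelRV R p)) (g : borelRV R p -> R),
      forall s, box T' s -> `|g s| <= K * T ord0 i &
      \int[leb R p.+1]_(t in box T) f t = \int[leb R p]_(s in box T') g s].
Proof.
move=> mf fK Ti g T'.
have mbox := measurable_box T.
have mbox' := measurable_box T'.
have mi := @measurable_pinsert R p i.
pose h := (EFin \o f) \_ (box T).
have bx (s : 'rV[R]_p) y : box T (vinsert i y s) <-> box T' s /\ `[0, T ord0 i]%classic y.
  rewrite !box_rect; have := pinsert_rect i (fun j => `[0, T ord0 j]%classic).
  move/seteqP => [h1 h2]; split.
    move=> H; have [/= H1 H2] := h1 (s, y) H; split => // k; have := H1 k.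
    by rewrite !mxE.
  move=> [H1 H2]; apply: (h2 (s, y)); split => //= k; have := H1 k.
  by rewrite /= mxE.
have mh : measurable_fun setT (h : borelRV R p.+1 -> \bar R).
  apply: (@measurable_restrictT _ _ (borelRV R p.+1) (\bar R) (box T) (EFin \o f) mbox).1.
  apply: measurable_funTS.
  exact/measurable_EFinP.
have m1box : (borel_lebesgue R p.+1 (box T) < +oo)%E by rewrite -lebE//; exact: leb_box_lty.
have Ih0 : (borel_lebesgue R p.+1).-integrable (box T : set (borelRV R p.+1)) (EFin \o f).
  by apply: (@integrableR_bnd _ _ _ _ _ mbox m1box _ K) => //; exact: measurable_funTS.
have Ih : (product_pinsert i).-integrable setT (h : borelRV R p.+1 -> \bar R).
  apply/integrableP; split => //.
  rewrite (@eq_measure_integral _ _ _ _ (borel_lebesgue R p.+1)); last first.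
    by move=> A mA _; rewrite (borel_lebesgue_pinsert i).
  by have /integrableP[] := (@integrable_mkcond _ (borelRV R p.+1) R _ (box T) (EFin \o f) mbox).1 Ih0.
have Ihi : ((@blm p \x lebesgue_measure)%E).-integrable setT (h \o pinsert i).
  apply/integrableP; split; first exact: measurableT_comp mh mi.
  have := (integrableP _ _ _ Ih).2.
  rewrite /product_pinsert (@ge0_integral_pushforward _ _ _ _ _ _ mi)//.
  by apply: measurableT_comp.
pose I : set (measurableTypeR R) := `[0, T ord0 i]%classic.
have mI : measurable I by exact: measurable_itv.
have finI : (lebesgue_measure I < +oo)%E.
  by rewrite /I lebesgue_measure_itv/=; case: ifP => // _; rewrite -EFinB ltry.
have KT0 s : box T' s -> integrableR lebesgue_measure `[0, T ord0 i]%classic (fun x => f (vinsert i x s)).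
  move=> bs; apply: (integrableR_bnd mI finI (k := K)).
  - apply: measurable_funTS.
    exact: (measurableT_comp (measurableT_comp mf mi)
      (@pair1_measurable _ _ (borelRV R p) (measurableTypeR R) s)).
  - by move=> x xT; apply: fK; exact/bx.
have FE s : fubini_F lebesgue_measure (h \o pinsert i) s = ((EFin \o g) \_ (box T')) s.
  rewrite /fubini_F /patch; case: ifPn => bs.
    rewrite /= /g /Rintegral fineK; last first.
      by apply: integrable_fin_num => //; apply: KT0; rewrite inE in bs.
    rewrite [RHS]integral_mkcond; apply: eq_integral => y _.
    rewrite /h /patch /=; have bs' := set_mem bs.
    have [yT|yT] := boolP (y \in `[0, T ord0 i]%classic).
      by rewrite mem_set//; apply/bx; split => //; exact: set_mem yT.
    by rewrite memNset// => /bx[_ yT']; move: yT; rewrite mem_set.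
  apply: integral0_eq => y _; rewrite /h /patch /= memNset// => /bx[bs' _].
  by move: bs; rewrite mem_set.
have mg : measurable_fun (box T' : set (borelRV R p)) (g : borelRV R p -> R).
  have mF : measurable_fun [set: borelRV R p] (((EFin \o g) \_ (box T')) : borelRV R p -> \bar R).
    rewrite (_ : _ \_ _ = fubini_F lebesgue_measure (h \o pinsert i)).
      exact: (@measurable_fubini_F _ _ (borelRV R p) (measurableTypeR R) R (@blm p) lebesgue_measure _ Ihi).
    by apply/funext => s; rewrite FE.
  apply/measurable_EFinP.
  exact: (@measurable_restrictT _ _ (borelRV R p) (\bar R) (box T') (EFin \o g) mbox').2.
split => //.
- move=> s bs; apply: le_trans (le_normr_Rintegral _ (KT0 s bs)) _ => //.
  have -> : K * T ord0 i = \int[lebesgue_measure]_(x in `[0, T ord0 i]) K.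
    rewrite Rintegral_cst//= lebesgue_measure_itv/= lte_fin.
    by move: Ti; rewrite le_eqVlt => /orP[/eqP <-|->]; rewrite ?ltxx ?mulr0//= subr0.
  apply: le_Rintegral => //.
  + exact: integrableR_norm (KT0 s bs).
  + exact: integrableR_cst.
  + by move=> x xT; apply: fK; exact/bx.
- rewrite /Rintegral integral_leb//; last by apply/measurable_EFinP; exact: measurable_funTS.
  rewrite integral_leb//; last exact/measurable_EFinP.
  congr fine; rewrite integral_mkcond -/h.
  rewrite (@eq_measure_integral _ _ _ _ (product_pinsert i)); last first.
    by move=> A mA _; rewrite (borel_lebesgue_pinsert i).
  rewrite (@integral_pushforward _ _ _ _ _ _ mi)//.
  rewrite preimage_setT -(@integral12_prod_meas1 _ _ (borelRV R p) (measurableTypeR R) R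
    (@blm p) lebesgue_measure _ Ihi)//.
  rewrite [RHS]integral_mkcond; apply: eq_integral => s _; exact: FE.
Qed.

End leb_borel.

(** * Row vectors *)

Section row_vectors.
Context {R : realType} {n : nat}.
Implicit Types x y : 'rV[R]_n.

Lemma rV_norm_le x (e : R) : 0 <= e -> (forall i, `|x ord0 i| <= e) -> `|x| <= e.
Proof.
move=> e0 xe; rewrite [leLHS]/Num.Def.normr/= mx_normrE.
by apply: bigmax_le => // -[i j] _ /=; rewrite ord1.
Qed.

Lemma rV_coord_le x i : `|x ord0 i| <= `|x|.
Proof.
rewrite [leRHS]/Num.Def.normr/= mx_normrE.
exact: (le_bigmax _ (fun ij : 'I_1 * 'I_n => `|x ij.1 ij.2|) (ord0, i)).
Qed.

Lemma cvg_rV (T : Type) (F : set_system T) {FF : Filter F} (f : T -> 'rV[R]_n) (l : 'rV[R]_n) :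
  (forall i, f t ord0 i @[t --> F] --> l ord0 i) -> f @ F --> l.
Proof.
move=> fl; apply/cvgrPdist_le => /= e e0.
have : \forall t \near F, forall i : 'I_n, `|l ord0 i - f t ord0 i| <= e.
  by apply: filter_forall => i; move/cvgrPdist_le : (fl i); exact.
apply: filterS => t H; apply: rV_norm_le; first exact: ltW.
by move=> i; rewrite !mxE.
Qed.

(** Suited to Lipschitz bounds under the integral: its integral is a sum of scalar integrals. *)
Definition l1norm x := \sum_i `|x ord0 i|.

Lemma l1norm_ge0 x : 0 <= l1norm x.
Proof. by apply: sumr_ge0. Qed.

Lemma l1normD x y : l1norm (x + y) <= l1norm x + l1norm y.
Proof.
by rewrite /l1norm -big_split/=; apply: ler_sum => i _; rewrite mxE ler_normD.
Qed.

Lemma l1norm_le_norm x : l1norm x <= n%:R * `|x|.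
Proof.
apply: le_trans (ler_sum _ (fun i _ => rV_coord_le x i)) _.
by rewrite sumr_const card_ord mulr_natl.
Qed.

Lemma dotvv_ge0 x : 0 <= dotv x x.
Proof. by apply: sumr_ge0 => i _; rewrite -expr2 sqr_ge0. Qed.

Lemma enorm_sqr x : enorm x ^+ 2 = \sum_i (x ord0 i) ^+ 2.
Proof. by rewrite /enorm sqr_sqrtr ?dotvv_ge0//; apply: eq_bigr => i _; rewrite expr2. Qed.

Lemma enorm_ge0 x : 0 <= enorm x.
Proof. exact: sqrtr_ge0. Qed.

Lemma enorm_le_l1norm x : enorm x <= l1norm x.
Proof.
rewrite -(ler_pXn2r (n:=2)) ?nnegrE ?enorm_ge0 ?l1norm_ge0// enorm_sqr /l1norm.
suff [] : \sum_i (x ord0 i) ^+ 2 <= (\sum_i `|x ord0 i|) ^+ 2 /\ 0 <= \sum_i `|x ord0 i| by [].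
apply: (big_ind2 (fun a b : R => a <= b ^+ 2 /\ 0 <= b)) => [|a b c d [H1 H2] [H3 H4]|i _].
- by rewrite expr0n.
- split; last exact: addr_ge0.
  by rewrite sqrrD; have := mulr_ge0 H2 H4; lra.
- by rewrite -normrX ger0_norm ?sqr_ge0.
Qed.

Lemma coord_le_enorm x i : `|x ord0 i| <= enorm x.
Proof.
rewrite -(ler_pXn2r (n:=2)) ?nnegrE ?enorm_ge0// enorm_sqr -normrX ger0_norm ?sqr_ge0//.
by rewrite (bigD1 i)//= lerDl sumr_ge0// => j _; rewrite sqr_ge0.
Qed.

End row_vectors.

(** * Superposition with Caratheodory functions *)

Section caratheodory.
Context {R : realType} {d : measure_display} {X : measurableType d} (D : set X).
Context (mD : measurable D) {n : nat}.

Lemma measurable_fun_coord (u : X -> 'rV[R]_n) :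
  measurable_fun D (u : X -> borelRV R n) <->
  forall i, measurable_fun D (fun t => u t ord0 i).
Proof.
split=> [mu i|mu].
  exact: (measurableT_comp (measurable_coord i) mu).
apply: (@measurable_restrictT _ _ X (borelRV R n) D u mD).2.
apply: measurable_fun_coordP => i.
have := (@measurable_restrictT _ _ X (measurableTypeR R) D _ mD).1 (mu i).
congr measurable_fun; apply/funext => t; rewrite /patch.
by case: ifP => //; rewrite mxE.
Qed.

Definition grid (k : nat) (x : 'rV[R]_n) : 'rV[R]_n :=
  \row_j ((Num.floor (k.+1%:R * x ord0 j))%:~R / k.+1%:R).

Lemma grid_cvg (x : 'rV[R]_n) : grid k x @[k --> \oo] --> x.
Proof.
apply: cvg_rV => j.
apply: (@squeeze_cvgr _ _ _ _ (fun k => x ord0 j - k.+1%:R^-1) (fun=> x ord0 j)).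
- apply: nearW => k; rewrite mxE.
  have k0 : 0 < k.+1%:R :> R by [].
  rewrite ler_pdivrMr// ler_pdivlMr// mulrBl mulVf ?gt_eqF//.
  rewrite [x ord0 j * _]mulrC floor_le andbT lerBlDr.
  by have := floorD1_gt (k.+1%:R * x ord0 j); rewrite intrD => /ltW.
- rewrite -[X in _ --> X]subr0; apply: cvgB; first exact: cvg_cst.
  exact: cvg_harmonic.
- exact: cvg_cst.
Qed.

(** Rounded to a grid, [u] takes countably many values, and where it takes a given one the second
    argument of [G] is fixed. Continuity in that argument allows the mesh to tend to 0. *)
Lemma measurable_fun_caratheodory (G : X -> 'rV[R]_n -> R) (u : X -> 'rV[R]_n) :
  (forall x, measurable_fun D (G ^~ x)) ->
  (forall t, D t -> continuous (G t)) ->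
  (forall i, measurable_fun D (fun t => u t ord0 i)) ->
  measurable_fun D (fun t => G t (u t)).
Proof.
move=> mG cG mu.
apply: (measurable_fun_cvg (h := fun k t => G t (grid k (u t)))); last first.
  move=> t Dt; apply: continuous_cvg; first exact: cG.
  exact: grid_cvg.
move=> k _ Y mY.
pose cell (z : 'rV[int]_n) := [set t | forall j, Num.floor (k.+1%:R * u t ord0 j) = z ord0 j].
pose pt (z : 'rV[int]_n) : 'rV[R]_n := \row_j ((z ord0 j)%:~R / k.+1%:R).
(* Grid values are enumerated by [unpickle]; a number that codes no integer vector contributes the
   empty set. *)
pose E m := if @unpickle 'rV[int]_n m is Some z then
  (D `&` cell z) `&` (D `&` (G ^~ (pt z)) @^-1` Y) else set0.
rewrite (_ : D `&` _ = \bigcup_m E m); last first.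
  apply/seteqP; split => t.
    move=> [Dt Yt]; exists (pickle (\row_j Num.floor (k.+1%:R * u t ord0 j))) => //.
    rewrite /E pickleK; split; split => //; first by move=> j; rewrite mxE.
    rewrite /= (_ : pt _ = grid k (u t))//.
    by apply/rowP => j; rewrite !mxE.
  move=> [m _]; rewrite /E; case: (unpickle m) => // z [[Dt ct] [_ Yt]].
  split => //=; rewrite (_ : grid k (u t) = pt z)//.
  by apply/rowP => j; rewrite !mxE ct.
apply: bigcup_measurable => m _; rewrite /E; case: (unpickle m) => // z.
apply: measurableI; last exact: mG.
rewrite (_ : D `&` cell z = D `&` \bigcap_(j in [set: 'I_n]) (D `&`
    (fun t => u t ord0 j) @^-1` `[(z ord0 j)%:~R / k.+1%:R, (z ord0 j + 1)%:~R / k.+1%:R[%classic)).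
  apply: measurableI => //; apply: fin_bigcap_measurable; first exact: finite_finset.
  by move=> j _; apply: mu => //; exact: measurable_itv.
have k0 : 0 < k.+1%:R :> R by [].
apply/seteqP; split => t [Dt H]; split => // j; last first.
  have [_] := H j I; rewrite /= in_itv/= ler_pdivrMr// ltr_pdivlMr// [_ * k.+1%:R]mulrC => /andP[H1 H2].
  by apply/floor_def; rewrite H1.
move=> _; split => //=; rewrite in_itv/= ler_pdivrMr// ltr_pdivlMr// [_ * k.+1%:R]mulrC.
by rewrite -(H j) floor_le floorD1_gt.
Qed.

End caratheodory.

Lemma continuous_borel {R : realType} p (f : 'rV[R]_p -> R) : continuous f ->
  measurable_fun setT (f : borelRV R p -> R).
Proof.
move=> cf.
apply: (@measurable_fun_caratheodory R _ (borelRV R p) setT measurableT p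
  (fun=> f) (id : borelRV R p -> 'rV[R]_p)) => //.
by move=> i; exact: measurable_coord.
Qed.

(** * Trigonometric polynomials *)

Section lines.
Context {R : realType} {V W : normedModType R}.

(** Turns directional derivatives into one-variable ones, to which the chain rule and the
    fundamental theorem of calculus apply. *)
Lemma is_derive_line (g : R -> W) (f : V -> W) (x : R) (t v : V) (l : W) :
  (forall h, g (h + x) = f (h *: v + t)) ->
  is_derive x 1 g l <-> is_derive t v f l.
Proof.
move=> gf.
have E : (fun h : R => h^-1 *: (g (h *: 1 + x) - g x)) =
    (fun h : R => h^-1 *: (f (h *: v + t) - f t)).
  apply/funext => h; rewrite [h *: 1]mulr1 gf.
  by have := gf 0; rewrite scale0r !add0r => ->.
by split => -[d1 d2]; split; move: d1 d2; rewrite /derivable /derive/= ?E// -?E.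
Qed.

End lines.

HB.lock Definition pd {R : realType} {p : nat} (i : 'I_p) (f : 'rV[R]_p -> R)
    : 'rV[R]_p -> R :=
  partial i (f : 'rV[R]_p -> R^o).

(** Real waves with a phase are closed under differentiation, which moves the phase by [pi / 2] and
    changes the amplitude, and products of them are sums of two; this replaces complex
    exponentials. *)
HB.lock Definition wave {R : realType} {p : nat} (xi : 'rV[R]_p) (th : R) (t : 'rV[R]_p) : R :=
  cos (dotv xi t + th).

Section trigonometric_polynomials.
Context {R : realType} {p : nat}.
Implicit Types (xi t : 'rV[R]_p) (th c : R) (i : 'I_p).

Lemma pdE i (f : 'rV[R]_p -> R) t : pd i f t = 'D_(delta_mx ord0 i) (f : 'rV[R]_p -> R^o) t.
Proof. by rewrite pd.unlock. Qed.

Lemma waveE xi th t : wave xi th t = cos (dotv xi t + th).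
Proof. by rewrite wave.unlock. Qed.

Lemma dotvDl xi zeta t : dotv (xi + zeta) t = dotv xi t + dotv zeta t.
Proof. by rewrite /dotv -big_split/=; apply: eq_bigr => i _; rewrite mxE mulrDl. Qed.

Lemma dotvDr xi t s : dotv xi (t + s) = dotv xi t + dotv xi s.
Proof. by rewrite /dotv -big_split/=; apply: eq_bigr => i _; rewrite mxE mulrDr. Qed.

Lemma dotvNl xi t : dotv (- xi) t = - dotv xi t.
Proof. by rewrite /dotv -sumrN; apply: eq_bigr => i _; rewrite mxE mulNr. Qed.

Lemma dotvZdelta xi (h : R) i : dotv xi (h *: delta_mx ord0 i) = h * xi ord0 i.
Proof.
rewrite /dotv (bigD1 i)//= big1 => [|j /negbTE ji]; rewrite !mxE eqxx/=.
  by rewrite eqxx mulr1 addr0 mulrC.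
by rewrite ji !mulr0.
Qed.

Lemma continuous_dotv xi : continuous (dotv xi).
Proof.
move=> t; apply: (@cvg_sumr _ _ (nbhs t)) => i.
by apply: cvgMr; exact: coord_continuous.
Qed.

Lemma continuous_wave xi th : continuous (wave xi th).
Proof.
rewrite (_ : wave xi th = fun t => cos (dotv xi t + th)); last first.
  by apply/funext => t; rewrite waveE.
move=> t; apply: continuous_comp; last exact: continuous_cos.
by apply: (@cvgD _ _ _ (nbhs t) _ (dotv xi) (cst th)); [exact: continuous_dotv|exact: cvg_cst].
Qed.

Lemma is_derive_wave xi th i t :
  is_derive t (delta_mx ord0 i) (wave xi th : 'rV[R]_p -> R^o) (xi ord0 i * wave xi (th + pi / 2) t).
Proof.
apply/(@is_derive_line R _ R^o (fun h => cos (h * xi ord0 i + (dotv xi t + th))) _ 0).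
  by move=> h; rewrite addr0 !waveE dotvDr dotvZdelta !addrA.
have H : is_derive (0 : R) 1 (fun h : R => h * xi ord0 i + (dotv xi t + th)) (xi ord0 i).
  have := is_deriveD (is_deriveM (is_derive_id (0 : R) (1 : R)) (is_derive_cst (xi ord0 i) (0 : R) (1 : R)))
     (is_derive_cst (dotv xi t + th) (0 : R) (1 : R)).
  by rewrite scaler0 add0r addr0 [X in is_derive _ _ _ X]mulr1.
have := is_derive1_comp (is_derive_cos _) H.
rewrite !waveE mul0r add0r addrA cosDpihalf mulrC.
by congr is_derive; rewrite mulrN mulNr.
Qed.

(** An entry is an amplitude, a frequency and a phase. Frequencies may repeat, so that sums are
    concatenations. *)
Definition tp (l : seq (R * 'rV[R]_p * R)) (t : 'rV[R]_p) : R :=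
  \sum_(w <- l) w.1.1 * wave w.1.2 w.2 t.

Definition tp_pd i (l : seq (R * 'rV[R]_p * R)) :=
  map (fun w : R * 'rV[R]_p * R => (w.1.1 * w.1.2 ord0 i, w.1.2, w.2 + pi / 2)) l.

Lemma tp_nil : tp [::] = cst 0.
Proof. by apply/funext => t; rewrite /tp big_nil. Qed.

Lemma tp_cons w l t : tp (w :: l) t = w.1.1 * wave w.1.2 w.2 t + tp l t.
Proof. by rewrite /tp big_cons. Qed.

Lemma tp_cat l l' t : tp (l ++ l') t = tp l t + tp l' t.
Proof. by rewrite /tp big_cat. Qed.

Lemma is_derive_tp l i t :
  is_derive t (delta_mx ord0 i) (tp l : 'rV[R]_p -> R^o) (tp (tp_pd i l) t).
Proof.
elim: l => [|w l IH] /=; first by rewrite tp_nil; exact: is_derive_cst.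
have := is_deriveD (is_deriveZ w.1.1 (is_derive_wave w.1.2 w.2 i t)) IH.
rewrite (_ : _ + _ = tp (w :: l)); last by apply/funext => s; rewrite tp_cons.
by congr is_derive; rewrite tp_cons /= -mulrA.
Qed.

Lemma pd_tp l i : pd i (tp l) = tp (tp_pd i l).
Proof. by apply/funext => t; rewrite pdE; have [] := is_derive_tp l i t. Qed.

Lemma continuous_tp l : continuous (tp l).
Proof.
elim: l => [|w l IH] t; first by rewrite tp_nil; exact: cst_continuous.
rewrite (_ : tp (w :: l) = fun s => w.1.1 * wave w.1.2 w.2 s + tp l s); last first.
  by apply/funext => s; rewrite tp_cons.
apply: (@cvgD _ _ _ (nbhs t) _ (fun s => w.1.1 * wave w.1.2 w.2 s) (tp l)); last exact: IH.
by apply: (@cvgMr _ _ (nbhs t)); exact: continuous_wave.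
Qed.

Lemma Coo_tp n (l : 'I_n -> seq (R * 'rV[R]_p * R)) :
  Coo (fun t => \row_j tp (l j) t).
Proof.
have cont (l' : 'I_n -> seq (R * 'rV[R]_p * R)) : continuous (fun t => \row_j tp (l' j) t).
  move=> t; apply: (@cvg_rV _ _ _ (nbhs t)) => j; rewrite mxE.
  rewrite (_ : (fun _ => _) = tp (l' j)); first exact: continuous_tp.
  by apply/funext => s; rewrite mxE.
move=> k; elim: k l => [|k IH] l /=; first exact: cont.
split; first exact: cont.
have der i t : derivable (fun t => \row_j tp (l j) t) t (delta_mx ord0 i).
  apply/derivable_mxP => a b; rewrite (_ : (fun _ => _) = tp (l b) :> (_ -> R^o)).
    by have [] := is_derive_tp (l b) i t.
  by apply/funext => s; rewrite mxE.
move=> i; split; first exact: der.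
rewrite (_ : partial i _ = fun t => \row_j tp (tp_pd i (l j)) t); first exact: IH.
apply/funext => t; rewrite /partial derive_mx//; apply/matrixP => a b; rewrite !mxE.
rewrite (_ : (fun _ => _) = tp (l b) :> (_ -> R^o)).
  by rewrite -pd_tp pdE.
by apply/funext => s; rewrite mxE.
Qed.

Lemma partial_row n (f : 'I_n -> 'rV[R]_p -> R) i t :
  (forall j, derivable (f j : _ -> R^o) t (delta_mx ord0 i)) ->
  partial i (fun t => \row_j f j t) t = \row_j pd i (f j) t.
Proof.
have E j : (fun t => (\row_j f j t) ord0 j) = f j by apply/funext => s; rewrite mxE.
move=> df; rewrite /partial derive_mx; last first.
  by apply/derivable_mxP => a b; rewrite ord1 E.
by apply/matrixP => a b; rewrite !mxE ord1 E pdE.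
Qed.

Context (T : 'rV[R]_p).

(** The dual lattice of the periods: the frequencies whose waves are [T]-periodic. *)
Definition lattice : set 'rV[R]_p :=
  [set xi | forall i, exists z : int, xi ord0 i * T ord0 i = z%:~R * (pi *+ 2)].

Lemma lattice0 : lattice 0.
Proof. by move=> i; exists 0; rewrite mxE !mul0r. Qed.

Lemma latticeD xi zeta : lattice xi -> lattice zeta -> lattice (xi + zeta).
Proof.
move=> H H' i; have [z E] := H i; have [z' E'] := H' i; exists (z + z').
by rewrite mxE mulrDl E E' intrD mulrDl.
Qed.

Lemma latticeN xi : lattice xi -> lattice (- xi).
Proof.
by move=> H i; have [z E] := H i; exists (- z); rewrite mxE mulNr E mulrNz mulNr.
Qed.

Lemma cosD2piz (a : R) (z : int) : cos (a + z%:~R * (pi *+ 2)) = cos a.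
Proof.
have H (b : R) (m : nat) : cos (b + m%:R * (pi *+ 2)) = cos b.
  by rewrite -(periodicn (@cosD2pi R) m b) mulr_natl.
case: z => m; first exact: H.
by rewrite NegzE mulrNz mulNr -[LHS](H _ m.+1) subrK.
Qed.

Lemma wave_periodic xi th i t : lattice xi ->
  wave xi th (t + T ord0 i *: delta_mx ord0 i) = wave xi th t.
Proof.
move=> /(_ i)[z E]; rewrite !waveE dotvDr dotvZdelta mulrC E.
by rewrite addrAC cosD2piz.
Qed.

Definition trig (f : 'rV[R]_p -> R) :=
  exists2 l, (forall w, w \in l -> lattice w.1.2) & f = tp l.

(** Excluding the frequency 0 gives mean value 0, Poincare's inequality and an invertible
    Laplacian. *)
Definition trig0 (f : 'rV[R]_p -> R) :=
  exists2 l, (forall w, w \in l -> lattice w.1.2 /\ w.1.2 != 0) & f = tp l.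

Lemma trig0_trig f : trig0 f -> trig f.
Proof. by move=> [l H ->]; exists l => // w /H[]. Qed.

Lemma trig_wave c xi th : lattice xi -> trig (fun t => c * wave xi th t).
Proof.
move=> H; exists [:: (c, xi, th)]; first by move=> w; rewrite inE => /eqP ->.
by apply/funext => t; rewrite tp_cons tp_nil/= addr0.
Qed.

Lemma trig_cst c : trig (cst c).
Proof.
rewrite (_ : cst c = fun t => c * wave 0 0 t); first exact: trig_wave lattice0.
apply/funext => t; rewrite !waveE /dotv big1 ?addr0 ?cos0 ?mulr1// => i _.
by rewrite mxE mul0r.
Qed.

Lemma trigD f g : trig f -> trig g -> trig (fun t => f t + g t).
Proof.
move=> [l H ->] [l' H' ->]; exists (l ++ l'); last by apply/funext => t; rewrite tp_cat.
by move=> w; rewrite mem_cat => /orP[/H|/H'].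
Qed.

Lemma trig0D f g : trig0 f -> trig0 g -> trig0 (fun t => f t + g t).
Proof.
move=> [l H ->] [l' H' ->]; exists (l ++ l'); last by apply/funext => t; rewrite tp_cat.
by move=> w; rewrite mem_cat => /orP[/H|/H'].
Qed.

Lemma tpZ c l t : c * tp l t = tp [seq (c * w.1.1, w.1.2, w.2) | w <- l] t.
Proof. by rewrite /tp big_map mulr_sumr; apply: eq_bigr => w _ /=; rewrite mulrA. Qed.

Lemma trigZ c f : trig f -> trig (fun t => c * f t).
Proof.
move=> [l H ->]; exists [seq (c * w.1.1, w.1.2, w.2) | w <- l].
  by move=> w /mapP[w' w'l ->]; exact: (H w' w'l).
by apply/funext => t; rewrite tpZ.
Qed.

Lemma trig0Z c f : trig0 f -> trig0 (fun t => c * f t).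
Proof.
move=> [l H ->]; exists [seq (c * w.1.1, w.1.2, w.2) | w <- l].
  by move=> w /mapP[w' w'l ->]; exact: (H w' w'l).
by apply/funext => t; rewrite tpZ.
Qed.

Lemma trigB f g : trig f -> trig g -> trig (fun t => f t - g t).
Proof.
move=> tf tg; rewrite (_ : (fun _ => _) = fun t => f t + (-1) * g t).
  exact: trigD tf (trigZ _ tg).
by apply/funext => t; rewrite mulN1r.
Qed.

Lemma trig0B f g : trig0 f -> trig0 g -> trig0 (fun t => f t - g t).
Proof.
move=> tf tg; rewrite (_ : (fun _ => _) = fun t => f t + (-1) * g t).
  exact: trig0D tf (trig0Z _ tg).
by apply/funext => t; rewrite mulN1r.
Qed.

Lemma trig_sum (J : Type) (s : seq J) (F : J -> 'rV[R]_p -> R) :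
  (forall j, trig (F j)) -> trig (fun t => \sum_(j <- s) F j t).
Proof.
move=> tF; elim: s => [|j s IH].
  by rewrite (_ : (fun _ => _) = cst 0); [exact: trig_cst|apply/funext => t; rewrite big_nil].
rewrite (_ : (fun _ => _) = fun t => F j t + \sum_(j <- s) F j t); first exact: trigD.
by apply/funext => t; rewrite big_cons.
Qed.

(** [cos a cos b = (cos (a + b) + cos (a - b)) / 2], pair by pair of entries. *)
Lemma trigM f g : trig f -> trig g -> trig (fun t => f t * g t).
Proof.
move=> [l H ->] [l' H' ->].
have : forall w, w \in l -> trig (fun t => w.1.1 * wave w.1.2 w.2 t * tp l' t).
  move=> w /H Hw; elim: l' H' => [|w' l' IH] H'.
    rewrite (_ : (fun _ => _) = cst 0); first exact: trig_cst.
    by apply/funext => t; rewrite tp_nil mulr0.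
  rewrite (_ : (fun _ => _) = fun t =>
     (w.1.1 * w'.1.1 / 2 * wave (w.1.2 + w'.1.2) (w.2 + w'.2) t +
      w.1.1 * w'.1.1 / 2 * wave (w.1.2 - w'.1.2) (w.2 - w'.2) t) +
     w.1.1 * wave w.1.2 w.2 t * tp l' t).
    have L' : lattice w'.1.2 by apply: H'; rewrite mem_head.
    apply: trigD; last by apply: IH => w'' w''l; apply: H'; rewrite inE w''l orbT.
    apply: trigD; apply: trig_wave; first exact: latticeD.
    by apply: latticeD => //; exact: latticeN.
  apply/funext => t; rewrite tp_cons mulrDr; congr (_ + _).
  rewrite !waveE !dotvDl dotvNl.
  rewrite (_ : _ + _ + (w.2 + w'.2) = (dotv w.1.2 t + w.2) + (dotv w'.1.2 t + w'.2)); last by ring.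
  rewrite (_ : _ + (w.2 - w'.2) = (dotv w.1.2 t + w.2) - (dotv w'.1.2 t + w'.2)); last by ring.
  move: (dotv w.1.2 t + w.2) (dotv w'.1.2 t + w'.2) => a b.
  by rewrite cosB cosD; field.
move=> {H}; elim: l => [|w l IH] H.
  rewrite (_ : (fun _ => _) = cst 0); first exact: trig_cst.
  by apply/funext => t; rewrite tp_nil mul0r.
rewrite (_ : (fun _ => _) = fun t => w.1.1 * wave w.1.2 w.2 t * tp l' t + tp l t * tp l' t).
  apply: trigD; first by apply: H; rewrite mem_head.
  by apply: IH => w' w'l; apply: H; rewrite inE w'l orbT.
by apply/funext => t; rewrite tp_cons mulrDl.
Qed.

Lemma trigX f m : trig f -> trig (fun t => f t ^+ m).
Proof.
move=> tf; elim: m => [|m IH]; first exact: (trig_cst 1).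
rewrite (_ : (fun _ => _) = fun t => f t * f t ^+ m); first exact: trigM.
by apply/funext => t; rewrite exprS.
Qed.

Lemma trig_prod (J : Type) (s : seq J) (F : J -> 'rV[R]_p -> R) :
  (forall j, trig (F j)) -> trig (fun t => \prod_(j <- s) F j t).
Proof.
move=> tF; elim: s => [|j s IH].
  by rewrite (_ : (fun _ => _) = cst 1); [exact: trig_cst|apply/funext => t; rewrite big_nil].
rewrite (_ : (fun _ => _) = fun t => F j t * \prod_(j <- s) F j t); first exact: trigM.
by apply/funext => t; rewrite big_cons.
Qed.

Lemma trig_pd i f : trig f -> trig (pd i f).
Proof.
move=> [l H ->]; exists (tp_pd i l); last exact: pd_tp.
by move=> w /mapP[w' w'l ->]; exact: (H w' w'l).
Qed.

Lemma trig0_pd i f : trig0 f -> trig0 (pd i f).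
Proof.
move=> [l H ->]; exists (tp_pd i l); last exact: pd_tp.
by move=> w /mapP[w' w'l ->]; exact: (H w' w'l).
Qed.

Lemma trig_derivable i f t : trig f -> derivable (f : _ -> R^o) t (delta_mx ord0 i).
Proof. by move=> [l _ ->]; have [] := is_derive_tp l i t. Qed.

Lemma trig_continuous f : trig f -> continuous f.
Proof. by move=> [l _ ->]; exact: continuous_tp. Qed.

Lemma trig_periodic f i t : trig f -> f (t + T ord0 i *: delta_mx ord0 i) = f t.
Proof.
move=> [l H ->]; rewrite /tp big_seq [RHS]big_seq; apply: eq_bigr => w wl.
by rewrite wave_periodic//; exact: H.
Qed.

Lemma trig_CooT n (f : 'I_n -> 'rV[R]_p -> R) : (forall j, trig (f j)) ->
  CooT T (fun t => \row_j f j t).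
Proof.
move=> tf; split.
  pose l j := s2val (cid2 (tf j)).
  rewrite (_ : (fun t => _) = fun t => \row_j tp (l j) t); first exact: Coo_tp.
  by apply/funext => t; apply/rowP => j; rewrite !mxE {1}(s2valP' (cid2 (tf j))).
by move=> i t; apply/rowP => j; rewrite !mxE trig_periodic.
Qed.

Lemma pdD i f g : trig f -> trig g -> pd i (fun t => f t + g t) = fun t => pd i f t + pd i g t.
Proof.
move=> tf tg; apply/funext => t; rewrite !pdE.
by rewrite (@deriveD _ _ _ (f : _ -> R^o) (g : _ -> R^o))//; exact: trig_derivable.
Qed.

Lemma pdZ i c f : trig f -> pd i (fun t => c * f t) = fun t => c * pd i f t.
Proof.
move=> tf; apply/funext => t; rewrite !pdE.
by rewrite (@deriveZ _ _ _ (f : _ -> R^o) c)//; exact: trig_derivable.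
Qed.

Lemma pdB i f g : trig f -> trig g -> pd i (fun t => f t - g t) = fun t => pd i f t - pd i g t.
Proof.
move=> tf tg; apply/funext => t; rewrite !pdE.
by rewrite (@deriveB _ _ _ (f : _ -> R^o) (g : _ -> R^o))//; exact: trig_derivable.
Qed.

Lemma pd_cst i c : pd i (cst c) = cst 0.
Proof. by apply/funext => t; rewrite !pdE derive_cst. Qed.

Lemma pdC i j f : trig f -> pd i (pd j f) = pd j (pd i f).
Proof.
move=> [l H ->]; rewrite !pd_tp; congr tp; rewrite /tp_pd -!map_comp.
by apply: eq_map => w /=; rewrite mulrAC.
Qed.

(** Waves of frequency 0 are constants; collecting them isolates the mean value. *)
Lemma trig_split f : trig f -> exists c g, trig0 g /\ f = fun t => c + g t.
Proof.
move=> [l H ->]; elim: l H => [|w l IH] H.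
  exists 0, (cst 0); split; first by exists [::] => //; rewrite tp_nil.
  by rewrite tp_nil; apply/funext => t; rewrite addr0.
have [c [g [tg E]]] : exists c g, trig0 g /\ tp l = fun t => c + g t.
  by apply: IH => w' w'l; apply: H; rewrite inE w'l orbT.
have [w0|w0] := eqVneq w.1.2 0.
  exists (w.1.1 * cos w.2 + c), g; split => //; apply/funext => t.
  rewrite tp_cons E !waveE w0 addrA; congr (_ * cos _ + _ + _).
  by rewrite /dotv big1 ?add0r// => i _; rewrite mxE mul0r.
exists c, (fun t => w.1.1 * wave w.1.2 w.2 t + g t); split.
  apply: trig0D => //; exists [:: w]; last by apply/funext => t; rewrite tp_cons tp_nil addr0.
  by move=> w'; rewrite inE => /eqP ->; split => //; apply: H; rewrite mem_head.
by apply/funext => t; rewrite tp_cons E addrCA.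
Qed.

End trigonometric_polynomials.

(** * The fundamental theorem of calculus, compactness of boxes *)

Section calculus.
Context {R : realType}.

Lemma FTC_continuous (G g : R -> R) (b : R) : 0 < b ->
  (forall x : R, is_derive x 1 G (g x)) -> continuous g ->
  \int[lebesgue_measure]_(x in `[0, b]) g x = G b - G 0.
Proof.
move=> b0 Gg cg.
have cG : continuous G.
  move=> x; apply: differentiable_continuous; apply/derivable1_diffP.
  by have [] := Gg x.
rewrite /Rintegral (@continuous_FTC2 R g G 0 b)//.
- exact: continuous_subspaceT.
- split.
  + by move=> x _; have [] := Gg x.
  + by apply: cvg_at_right_filter; exact: cG.
  + by apply: cvg_at_left_filter; exact: cG.
- by move=> x _; rewrite derive1E; have [_] := Gg x.
Qed.

Lemma compact_box p (T : 'rV[R]_p) : compact (box T).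
Proof.
apply: bounded_closed_compact.
  exists (\big[Num.max/0]_j `|T ord0 j|); split; first exact: num_real.
  move=> M TM t bt /=; apply: rV_norm_le.
    by apply: le_trans (ltW TM); exact: bigmax_ge_id.
  move=> i; have /andP[t0 tT] := bt i; rewrite ger0_norm//.
  apply: (le_trans tT); apply: (le_trans (ler_norm _)); apply: le_trans (ltW TM).
  exact: (le_bigmax _ (fun j => `|T ord0 j|)).
rewrite (_ : box T = \bigcap_(i in [set: 'I_p])
    ((fun x : 'rV[R]_p => x ord0 i) @^-1` [set y | 0 <= y <= T ord0 i])).
  apply: closed_bigI => i _; apply: closed_comp.
    by move=> t _; exact: coord_continuous.
  rewrite (_ : [set y | _] = `[0, T ord0 i]%classic); first exact: itv_closed.
  by apply/seteqP; split => y /=; rewrite in_itv.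
by apply/seteqP; split => t H i; [move=> _; exact: H|exact: (H i Logic.I)].
Qed.

Lemma continuous_box_bounded p (T : 'rV[R]_p) (f : 'rV[R]_p -> R) :
  {within box T, continuous f} -> exists K, forall t, box T t -> `|f t| <= K.
Proof.
move=> cf; have [[t0 bt0]|/set0P/negP/negPn/eqP b0] := pselect (box T !=set0); last first.
  by exists 0 => t; rewrite b0.
have ne : box T !=set0 by exists t0.
have cn : {within box T, continuous (fun t => `|f t|)}.
  by move=> t; apply: (@continuous_comp _ _ _ (f : subspace (box T) -> R) Num.norm t);
    [exact: cf|exact: norm_continuous].
have [c _ H] := EVT_max_rV ne (@compact_box p T) cn.
by exists `|f c| => t bt; apply: H; rewrite inE.
Qed.

Lemma vinsertDdelta p (i : 'I_p.+1) (h x : R) (s : 'rV[R]_p) :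
  vinsert i (h + x) s = h *: delta_mx ord0 i + vinsert i x s.
Proof.
apply/rowP => j; rewrite !mxE eqxx/= eq_sym; case: unliftP => [k ->|->] /=.
  by rewrite (negbTE (neq_lift _ _)) mulr0 add0r.
by rewrite eqxx mulr1.
Qed.

Lemma continuous_vinsert p (i : 'I_p.+1) (s : 'rV[R]_p) :
  continuous (fun x : R => vinsert i x s).
Proof.
move=> x; apply: (@cvg_rV _ _ _ (nbhs x)) => j.
rewrite (_ : (fun y => _) = fun y : R => oapp (s ord0) y (unlift i j)).
  by rewrite mxE; case: (unlift i j) => [k|] /=; [exact: cvg_cst|exact: cvg_id].
by apply/funext => y; rewrite mxE.
Qed.

Lemma continuous_vinsert_face p (i : 'I_p.+1) (c : R) :
  continuous (fun s : 'rV[R]_p => vinsert i c s).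
Proof.
move=> s; apply: (@cvg_rV _ _ _ (nbhs s)) => j.
rewrite (_ : (fun y => _) = fun s : 'rV[R]_p => oapp (s ord0) c (unlift i j)).
  by rewrite mxE; case: (unlift i j) => [k|] /=; [exact: coord_continuous|exact: cvg_cst].
by apply/funext => y; rewrite mxE.
Qed.

End calculus.

(** * Periodic functions and integration by parts *)

Section periodic_functions.
Context {R : realType} {p : nat}.
Context (T : 'rV[R]_p) (T0 : forall i, 0 < T ord0 i).
Local Notation sqint := (sqint (leb R p) (box T)).
Let mD := measurable_box_leb T.
Let fD := leb_box_lty T.

(** What integrating by parts in the single direction [i] takes. Trigonometric polynomials and the
    coordinates of functions in [CooT] both qualify. *)
Definition C1per (i : 'I_p) (f : 'rV[R]_p -> R) :=
  [/\ forall t, derivable (f : _ -> R^o) t (delta_mx ord0 i),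
      continuous f, continuous (pd i f) &
      forall t, f (t + T ord0 i *: delta_mx ord0 i) = f t].

Lemma C1perM i f g : C1per i f -> C1per i g ->
  C1per i (fun t => f t * g t) /\
  pd i (fun t => f t * g t) = fun t => f t * pd i g t + g t * pd i f t.
Proof.
move=> [df cf cpf pf] [dg cg cpg pg].
have E : pd i (fun t => f t * g t) = fun t => f t * pd i g t + g t * pd i f t.
  apply/funext => t; rewrite !pdE.
  by have -> := deriveM (df t) (dg t).
split; last exact: E.
split.
- by move=> t; exact: derivableM (df t) (dg t).
- by move=> t; apply: (@cvgM _ _ (nbhs t)); [exact: cf|exact: cg].
- rewrite E => t; apply: (@cvgD _ _ _ (nbhs t) _ (fun t => f t * pd i g t) (fun t => g t * pd i f t)).
    by apply: (@cvgM _ _ (nbhs t)); [exact: cf|exact: cpg].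
  by apply: (@cvgM _ _ (nbhs t)); [exact: cg|exact: cpf].
- by move=> t; rewrite pf pg.
Qed.

Lemma trig_C1per i f : trig T f -> C1per i f.
Proof.
move=> tf; split.
- by move=> t; exact: trig_derivable tf.
- exact: trig_continuous tf.
- exact: trig_continuous (trig_pd i tf).
- by move=> t; exact: trig_periodic tf.
Qed.

Lemma CooT_C1per n i (v : 'rV[R]_p -> 'rV[R]_n) j : CooT T v ->
  C1per i (fun t => v t ord0 j) /\
  forall t, partial i v t ord0 j = pd i (fun t => v t ord0 j) t.
Proof.
move=> [/(_ 1%N)[cv /(_ i)[dv cdv]] pv].
have E t : partial i v t ord0 j = pd i (fun t => v t ord0 j) t.
  by rewrite pdE /partial derive_mx// !mxE.
have cc (w : 'rV[R]_p -> 'rV[R]_n) : continuous w -> continuous (fun t => w t ord0 j).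
  by move=> cw t; apply: (@continuous_comp _ _ _ w (fun M : 'rV[R]_n => M ord0 j));
    [exact: cw|exact: coord_continuous].
split => //; split.
- by move=> t; have /derivable_mxP := dv t; exact.
- exact: cc.
- rewrite (_ : pd i _ = fun t => partial i v t ord0 j); first exact: cc.
  exact/funext.
- by move=> t; rewrite pv.
Qed.

Lemma sqint_continuous f : continuous f -> sqint f.
Proof.
move=> cf; have [K fK] := @continuous_box_bounded _ _ T f (continuous_subspaceT cf).
apply: (sqint_bnd mD fD _ fK).
apply: measurable_fun_lebRV; first exact: measurable_box.
by apply: measurable_funTS; exact: continuous_borel.
Qed.

Lemma trig_sqint f : trig T f -> sqint f.
Proof. by move=> tf; apply: sqint_continuous; exact: trig_continuous tf. Qed.

End periodic_functions.

(** Fubini's theorem in the direction [i], then the fundamental theorem of calculus. Both face terms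
    are kept because the trace inequality applies this to a function with a nonperiodic weight. *)
Lemma integral_pd {R : realType} p (T : 'rV[R]_p.+1) (i : 'I_p.+1) (f : 'rV[R]_p.+1 -> R) :
  0 < T ord0 i -> (forall t, derivable (f : _ -> R^o) t (delta_mx ord0 i)) ->
  continuous (pd i f) ->
  \int[leb R p.+1]_(t in box T) pd i f t =
  \int[leb R p]_(s in box (\row_k T ord0 (lift i k)))
    (f (vinsert i (T ord0 i) s) - f (vinsert i 0 s)).
Proof.
move=> Ti df cpf.
have [K fK] := @continuous_box_bounded _ _ T (pd i f) (continuous_subspaceT cpf).
have [_ _ ->] := Fubini_box (continuous_borel cpf) fK (ltW Ti).
apply: eq_Rintegral => s _.
have dG (x : R) : is_derive x 1 (fun x => f (vinsert i x s)) (pd i f (vinsert i x s)).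
  apply/(@is_derive_line R _ R^o _ f x (vinsert i x s) (delta_mx ord0 i)).
    by move=> h; rewrite vinsertDdelta.
  by split; [exact: df|rewrite pdE].
have cG : continuous (fun x : R => pd i f (vinsert i x s)).
  move=> x; apply: (@continuous_comp _ _ _ (fun x => vinsert i x s) (pd i f)).
    exact: continuous_vinsert.
  exact: cpf.
exact: (FTC_continuous Ti dG cG).
Qed.

Lemma vinsert_period {R : realType} p (T : 'rV[R]_p.+1) (i : 'I_p.+1) (s : 'rV[R]_p) :
  vinsert i (T ord0 i) s = vinsert i 0 s + T ord0 i *: delta_mx ord0 i.
Proof. by rewrite addrC -vinsertDdelta addr0. Qed.

Lemma integral_pd_periodic {R : realType} p (T : 'rV[R]_p) (T0 : forall i, 0 < T ord0 i) i f :
  C1per T i f -> \int[leb R p]_(t in box T) pd i f t = 0.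
Proof.
case: p T T0 i f => [|p] T T0 i f; first by case: i.
move=> [df cf cpf pf]; rewrite (integral_pd (T0 i) df cpf).
transitivity (\int[leb R p]_(s in box (\row_k T ord0 (lift i k))) (0 : R)); last first.
  by rewrite Rintegral_cst ?mul0r//; exact: measurable_box_leb.
by apply: eq_Rintegral => s _; rewrite vinsert_period pf subrr.
Qed.

Section integration_by_parts.
Context {R : realType} {p : nat}.
Context (T : 'rV[R]_p) (T0 : forall i, 0 < T ord0 i).
Local Notation ip := (ip (leb R p) (box T)).
Let mD := measurable_box_leb T.

Lemma ip_pd i f g : C1per T i f -> C1per T i g -> ip (pd i f) g = - ip f (pd i g).
Proof.
move=> Cf Cg; have [Cfg E] := C1perM Cf Cg.
have [df cf cpf pf] := Cf; have [dg cg cpg pg] := Cg.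
have := integral_pd_periodic T0 Cfg; rewrite E RintegralD//; first last.
- by apply: sqint_mul => //; exact: sqint_continuous.
- by apply: sqint_mul => //; exact: sqint_continuous.
move/eqP; rewrite -!ipE addrC addr_eq0 => /eqP <-.
by rewrite ipC.
Qed.

Lemma trig_ip_pd i f g : trig T f -> trig T g -> ip (pd i f) g = - ip f (pd i g).
Proof. by move=> tf tg; apply: ip_pd; exact: trig_C1per. Qed.

End integration_by_parts.

Lemma pd_wave {R : realType} {p : nat} (i : 'I_p) (xi : 'rV[R]_p) th :
  pd i (wave xi th) = fun t => xi ord0 i * wave xi (th + pi / 2) t.
Proof. by apply/funext => t; rewrite pdE; have [] := is_derive_wave xi th i t. Qed.

(** * The Laplacian on trigonometric polynomials *)

Section spectral.
Context {R : realType} {p : nat}.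
Context (T : 'rV[R]_p) (T0 : forall i, 0 < T ord0 i).
Local Notation ip := (ip (leb R p) (box T)).
Local Notation nrm2 := (nrm2 (leb R p) (box T)).
Local Notation sqint := (sqint (leb R p) (box T)).
Local Notation trig := (trig T).
Local Notation trig0 := (trig0 T).
Let mD := measurable_box_leb T.
Let fD := leb_box_lty T.
Implicit Types (f g v : 'rV[R]_p -> R) (xi zeta : 'rV[R]_p).

Definition lap f : 'rV[R]_p -> R := fun t => \sum_i pd i (pd i f) t.

Definition grad2 f g := \sum_i ip (pd i f) (pd i g).

Lemma grad2E f g : grad2 f g = \sum_i ip (pd i f) (pd i g).
Proof. by []. Qed.

Lemma trig_lap f : trig f -> trig (lap f).
Proof. by move=> tf; apply: trig_sum => i; do 2 apply: trig_pd. Qed.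

Lemma ip_lap f g : trig f -> trig g -> ip (lap f) g = - grad2 f g.
Proof.
move=> tf tg.
have tp i : trig (pd i f) by exact: trig_pd.
have sp i : sqint (pd i (pd i f)) by apply: trig_sqint; exact: trig_pd.
rewrite /lap (ip_suml mD _ sp (trig_sqint tg)) -sumrN; apply: eq_bigr => i _.
exact: trig_ip_pd.
Qed.

Lemma grad2C f g : grad2 f g = grad2 g f.
Proof. by apply: eq_bigr => i _; rewrite ipC. Qed.

Definition freq2 xi : R := dotv xi xi.

Lemma lap_wave xi th : lattice T xi -> lap (wave xi th) = fun t => - freq2 xi * wave xi th t.
Proof.
move=> L; apply/funext => t; rewrite /lap.
have tw th' : trig (wave xi th').
  have := trig_wave 1 th' L; congr (trig _).
  by apply/funext => s; rewrite mul1r.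
rewrite (eq_bigr (fun i => xi ord0 i * xi ord0 i * wave xi (th + pi / 2 + pi / 2) t)); last first.
  by move=> i _; rewrite pd_wave (pdZ _ _ (tw _)) pd_wave mulrA.
by rewrite -mulr_suml !waveE -[th + _ + _]addrA -splitr addrA cosDpi mulrN mulNr.
Qed.

(** The Laplacian is symmetric and waves are eigenfunctions. Frequencies of equal length are not
    separated; this is enough for multipliers that depend on [freq2] alone. *)
Lemma wave_orthogonal xi zeta th th' : lattice T xi -> lattice T zeta ->
  (freq2 xi - freq2 zeta) * ip (wave xi th) (wave zeta th') = 0.
Proof.
move=> L L'.
have tw : trig (wave xi th).
  have := trig_wave 1 th L; congr (trig _).
  by apply/funext => s; rewrite mul1r.
have tw' : trig (wave zeta th').
  have := trig_wave 1 th' L'; congr (trig _).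
  by apply/funext => s; rewrite mul1r.
have sw : sqint (wave xi th) by exact: trig_sqint.
have sw' : sqint (wave zeta th') by exact: trig_sqint.
have : ip (lap (wave xi th)) (wave zeta th') = ip (lap (wave zeta th')) (wave xi th).
  by transitivity (- grad2 (wave xi th) (wave zeta th')); [|rewrite grad2C; symmetry]; exact: ip_lap.
rewrite (lap_wave _ L) (lap_wave _ L') (ipZl mD _ sw sw') (ipZl mD _ sw' sw) [ip (wave zeta th') _]ipC => E.
by rewrite mulrBl; lra.
Qed.

(** A Fourier multiplier, acting on the representing list. *)
Definition multiplier (phi : 'rV[R]_p -> R) (l : seq (R * 'rV[R]_p * R)) :=
  map (fun w : R * 'rV[R]_p * R => (phi w.1.2 * w.1.1, w.1.2, w.2)) l.

Lemma ip_multiplier phi psi l :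
  ip (tp (multiplier phi l)) (tp (multiplier psi l)) =
  \sum_(w <- l) \sum_(w' <- l) phi w.1.2 * psi w'.1.2 * (w.1.1 * w'.1.1 *
    ip (wave w.1.2 w.2) (wave w'.1.2 w'.2)).
Proof.
have sw xi th : sqint (wave xi th) by apply: sqint_continuous; exact: continuous_wave.
have stp l' : sqint (tp l') by apply: sqint_continuous; exact: continuous_tp.
have E chi : tp (multiplier chi l) =
    fun t => \sum_(w <- l) chi w.1.2 * w.1.1 * wave w.1.2 w.2 t.
  by apply/funext => t; rewrite /tp big_map.
have sZ chi (w : R * 'rV[R]_p * R) : sqint (fun t => chi w.1.2 * w.1.1 * wave w.1.2 w.2 t).
  by apply: sqintZ mD _ _ _; exact: sw.
have sE chi : sqint (fun t => \sum_(w <- l) chi w.1.2 * w.1.1 * wave w.1.2 w.2 t).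
  by apply: sqint_sum mD fD _ _ _ _ => w; exact: sZ.
rewrite !E (ip_suml mD _ (sZ phi) (sE psi)).
apply: eq_bigr => w _; rewrite (ipZl mD _ (sw _ _) (sE psi)).
rewrite ipC (ip_suml mD _ (sZ psi) (sw _ _)).
rewrite mulr_sumr; apply: eq_bigr => w' _; rewrite (ipZl mD _ (sw _ _) (sw _ _)) ipC; ring.
Qed.

Lemma lap_tp l : (forall w, w \in l -> lattice T w.1.2) ->
  lap (tp l) = tp (multiplier (fun xi => - freq2 xi) l).
Proof.
elim: l => [|w l IH] H.
  apply/funext => t; rewrite /lap tp_nil big1// => i _.
  by rewrite !pd_cst.
have L : lattice T w.1.2 by apply: H; rewrite mem_head.
have Hl w' : w' \in l -> lattice T w'.1.2 by move=> w'l; apply: H; rewrite inE w'l orbT.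
have tl : trig (tp l) by exists l.
have tw : trig (wave w.1.2 w.2).
  have := trig_wave 1 w.2 L; congr (trig _).
  by apply/funext => s; rewrite mul1r.
have E : tp (w :: l) = fun t => w.1.1 * wave w.1.2 w.2 t + tp l t.
  by apply/funext => t; rewrite tp_cons.
apply/funext => t; rewrite /= tp_cons -IH//=.
rewrite [_ * w.1.1]mulrC -mulrA -[- _ * _]/((fun t => - freq2 w.1.2 * wave w.1.2 w.2 t) t) -lap_wave//.
rewrite E /lap mulr_sumr -big_split/=; apply: eq_bigr => i _.
rewrite (pdD i (trigZ w.1.1 tw) tl) (pdZ i w.1.1 tw).
by rewrite (pdD i (trigZ _ (trig_pd i tw)) (trig_pd i tl)) (pdZ i _ (trig_pd i tw)).
Qed.

Definition cP : R := \sum_i T ord0 i ^+ 2.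

(** Some coordinate satisfies [xi_i T_i = 2 pi z] with [z] a nonzero integer, so
    [(xi_i T_i)^2 >= 1]. The constant [cP] is not sharp: summing all [T_i^2] covers every possible
    [i]. *)
Lemma freq2_ge xi : lattice T xi -> xi != 0 -> 1 <= cP * freq2 xi.
Proof.
move=> L xi0.
have [i xii] : exists i, xi ord0 i != 0.
  apply/existsP; apply: contraR xi0 => /existsPn H; apply/eqP/rowP => i.
  by rewrite mxE; apply/eqP; have := H i; rewrite negbK.
have [z E] := L i.
have z0 : z != 0.
  by apply: contraNneq xii => z0; move/eqP: E; rewrite z0 mul0r mulf_eq0 (gt_eqF (T0 i)) orbF.
have : 1 <= (xi ord0 i * T ord0 i) ^+ 2.
  rewrite E exprMn -[X in X <= _]mulr1; apply: ler_pM => //.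
    have : 1 <= (z * z)%:~R :> R by rewrite ler1z -gtz0_ge1 -expr2 exprn_even_gt0.
    by rewrite intrM expr2.
  have := @pi_ge2 R; rewrite -[pi *+ 2]mulr_natl; move: (@pi R) => q q2; nra.
move=> /le_trans; apply; rewrite exprMn mulrC; apply: ler_pM; rewrite ?sqr_ge0//.
  by rewrite /cP (bigD1 i)//= lerDl sumr_ge0// => j _; rewrite sqr_ge0.
rewrite /freq2 /dotv (bigD1 i)//= -expr2 lerDl sumr_ge0// => j _.
by rewrite -expr2 sqr_ge0.
Qed.

Lemma freq2_gt0 xi : lattice T xi -> xi != 0 -> 0 < freq2 xi.
Proof.
move=> L xi0; have := freq2_ge L xi0; have : 0 <= freq2 xi by exact: dotvv_ge0.
rewrite le_eqVlt => /orP[/eqP <-|//]; by rewrite mulr0 ler10.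
Qed.

Lemma cP_ge0 : 0 <= cP.
Proof. by apply: sumr_ge0 => i _; exact: sqr_ge0. Qed.

(* Waves of different frequencies are orthogonal, so the multiplier
   [cP |xi|^2 - 1] acts on one factor of the inner product as its square root
   does on both. *)
Lemma poincare f : trig0 f -> nrm2 f <= cP * grad2 f f.
Proof.
move=> [l H ->].
have HL w : w \in l -> lattice T w.1.2 by case/H.
have tl : trig (tp l) by exists l.
rewrite -subr_ge0 -[grad2 _ _]opprK -(ip_lap tl tl) (lap_tp HL).
pose phi xi := cP * freq2 xi - 1.
have E1 : tp l = tp (multiplier (fun=> 1) l).
  rewrite (_ : multiplier (fun=> 1) l = l)//; rewrite /multiplier -[RHS]map_id.
  by apply: eq_map => -[[c xi] th] /=; rewrite mul1r.
set m := multiplier _ l.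
have En : nrm2 (tp l) = ip (tp (multiplier (fun=> 1) l)) (tp (multiplier (fun=> 1) l)).
  by rewrite -E1.
have Eg : ip (tp m) (tp l) = ip (tp m) (tp (multiplier (fun=> 1) l)) by rewrite -E1.
rewrite En Eg /m !ip_multiplier.
apply: le_trans (nrm2_ge0 (leb R p) (box T) (tp (multiplier (fun xi => Num.sqrt (phi xi)) l))) _.
rewrite /nrm2 ip_multiplier mulrN -mulNr mulr_sumr -sumrB big_seq [leRHS]big_seq.
rewrite le_eqVlt; apply/orP; left; apply/eqP; apply: eq_bigr => w wl.
rewrite mulr_sumr -sumrB big_seq [RHS]big_seq; apply: eq_bigr => w' w'l.
have := wave_orthogonal w.2 w'.2 (HL _ wl) (HL _ w'l).
set W := ip (wave _ _) _ => /eqP; rewrite mulf_eq0 => /orP[|/eqP ->]; last by rewrite !mulr0 subrr.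
rewrite subr_eq0 => /eqP E; have phiE : phi w'.1.2 = phi w.1.2 by rewrite /phi E.
rewrite phiE -[Num.sqrt _ * Num.sqrt _]expr2 sqr_sqrtr; last first.
  by rewrite /phi subr_ge0; apply: freq2_ge; case: (H _ wl).
rewrite /phi; ring.
Qed.

Lemma trig0_lap_inv f : trig0 f -> exists2 v, trig0 v & lap v = f.
Proof.
move=> [l H ->]; exists (tp (multiplier (fun xi => - (freq2 xi)^-1) l)).
  by exists (multiplier (fun xi => - (freq2 xi)^-1) l) => // w /mapP[w' w'l ->]; exact: (H w' w'l).
rewrite lap_tp; last by move=> w /mapP[w' w'l ->]; exact: (H w' w'l).1.
apply/funext => t; rewrite /tp big_map big_map big_seq [RHS]big_seq.
apply: eq_bigr => w wl /=; have [L w0] := H w wl.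
by rewrite mulrA mulrNN divff ?mul1r// gt_eqF//; exact: freq2_gt0.
Qed.

(** Such an [f] is a Laplacian, hence a sum of derivatives of periodic functions. *)
Lemma integral_trig0 f : trig0 f -> \int[leb R p]_(t in box T) f t = 0.
Proof.
move=> /trig0_lap_inv[v /trig0_trig tv <-].
have Ipp i : integrableR (leb R p) (box T) (pd i (pd i v)).
  by apply: (sqint_integrable mD fD); apply: trig_sqint; do 2 apply: trig_pd.
rewrite (integral_sumR mD _ Ipp) big1// => i _.
by apply: (integral_pd_periodic T0); apply: trig_C1per; exact: trig_pd.
Qed.

(** Two integrations by parts give [|d_i d_j v|^2 = <d_i d_i v, d_j d_j v>], and the right-hand
    sides, summed over [i] and [j], make [|lap v|^2]. *)
Lemma nrm2_pd_pd_le v a b : trig v -> nrm2 (pd a (pd b v)) <= nrm2 (lap v).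
Proof.
move=> tv.
have tpp i j : trig (pd i (pd j v)) by do 2 apply: trig_pd.
have E i j : nrm2 (pd i (pd j v)) = ip (pd i (pd i v)) (pd j (pd j v)).
  have tpj := trig_pd j tv; have tpi := trig_pd i tv.
  rewrite /nrm2 (trig_ip_pd T0 i tpj (tpp i j)).
  have -> : pd i (pd i (pd j v)) = pd j (pd i (pd i v)).
    by rewrite (pdC i j tv) (pdC i j tpi).
  by rewrite -(trig_ip_pd T0 j tpj (tpp i i)) ipC.
have -> : nrm2 (lap v) = \sum_i \sum_j nrm2 (pd i (pd j v)).
  have sl : sqint (lap v) by exact: trig_sqint (trig_lap tv).
  have sp i : sqint (pd i (pd i v)) by exact: trig_sqint (tpp i i).
  rewrite /nrm2 {1}/lap (ip_suml mD _ sp sl); apply: eq_bigr => i _.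
  by rewrite ipC {1}/lap (ip_suml mD _ sp (sp i)); apply: eq_bigr => j _; rewrite ipC -E.
rewrite (bigD1 a)//= (bigD1 b)//= -addrA lerDl addr_ge0//.
  by apply: sumr_ge0 => j _; exact: nrm2_ge0.
by apply: sumr_ge0 => i _; apply: sumr_ge0 => j _; exact: nrm2_ge0.
Qed.

End spectral.

(** * Density of the trigonometric polynomials *)

Section dominated_convergence_real.
Context {d : measure_display} {X : measurableType d} {R : realType}.
Context (mu : {measure set X -> \bar R}) (D : set X) (mD : measurable D).

Lemma dominated_cvgR (f_ : nat -> X -> R) (f g : X -> R) :
  (forall n, measurable_fun D (f_ n)) -> measurable_fun D f ->
  {ae mu, forall x, D x -> f_ n x @[n --> \oo] --> f x} ->
  integrableR mu D g -> (forall n x, D x -> `|f_ n x| <= g x) ->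
  integrableR mu D f /\
  \int[mu]_(x in D) f_ n x @[n --> \oo] --> \int[mu]_(x in D) f x.
Proof.
move=> mf_ mf f_f Ig f_g.
have [] := @dominated_convergence _ X R mu D mD (fun n => EFin \o f_ n) (EFin \o f) (EFin \o g).
- by move=> n; exact/measurable_EFinP.
- exact/measurable_EFinP.
- case: f_f => N [mN N0 sN]; exists N; split => // x /= H; apply: sN => /= H1; apply: H => Dx.
  by apply: cvg_EFin; [exact: nearW|exact: H1].
- exact: Ig.
- by apply: aeW => x n Dx; rewrite /= lee_fin f_g.
move=> If _ c; split => //; apply: fine_cvg.
by rewrite /Rintegral fineK//; exact: integrable_fin_num.
Qed.

End dominated_convergence_real.

(** * Polynomial approximation of a step *)

Section step_approximation.
Context {R : realType}.

Lemma bernoulli (x : R) (n : nat) : -1 <= x -> 1 + n%:R * x <= (1 + x) ^+ n.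
Proof.
move=> x1; elim: n => [|n IH]; first by rewrite mul0r addr0 expr0.
rewrite exprS; have x0 : 0 <= 1 + x by lra.
apply: le_trans (ler_wpM2l x0 IH).
rewrite -natr1; have : 0 <= n%:R * x ^+ 2 by rewrite mulr_ge0 ?sqr_ge0.
by rewrite expr2; lra.
Qed.

(** For [r = s^2], Bernoulli's inequality bounds [n s^n], and the remaining factor [s^n] tends to
    0. *)
Lemma cvg_natrX (r : R) : 0 <= r -> r < 1 -> n%:R * r ^+ n @[n --> \oo] --> 0.
Proof.
rewrite le_eqVlt => /orP[/eqP <- _|r0 r1].
  rewrite (_ : (fun _ => _) = cst 0); first exact: cvg_cst.
  by apply/funext => -[|n]; rewrite ?mul0r// exprS mul0r mulr0.
pose s := Num.sqrt r; have s0 : 0 < s by rewrite sqrtr_gt0.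
have rs : r = s ^+ 2 by rewrite sqr_sqrtr// ltW.
have s1 : s < 1 by rewrite -sqrtr1 ltr_sqrt.
pose C := (s^-1 - 1)^-1.
have C0 : 0 < s^-1 - 1 by rewrite subr_gt0 invf_gt1.
have nC n : n%:R * s ^+ n <= C.
  have := @bernoulli (s^-1 - 1) n; rewrite [1 + (_ - 1)]addrC subrK => H.
  have {}H : n%:R * (s^-1 - 1) <= s^-1 ^+ n.
    have H1 : -1 <= s^-1 - 1 by lra.
    by have := H H1; lra.
  rewrite /C -div1r ler_pdivlMr// mulrAC -ler_pdivlMr ?exprn_gt0//.
  by rewrite mul1r -exprVn.
apply: (@squeeze_cvgr _ _ _ _ (fun=> 0) (fun n => C * s ^+ n)).
- apply: nearW => n; rewrite mulr_ge0 ?exprn_ge0 ?(ltW r0)//=.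
  by rewrite rs exprAC expr2 mulrA ler_wpM2r// exprn_ge0// ltW.
- exact: cvg_cst.
- rewrite -[X in _ --> X](mulr0 C); apply: cvgMr; apply: cvg_expr.
  by rewrite ger0_norm// ltW.
Qed.

(* Weierstrass' polynomials: as [n] grows they tend to [1] on [0, 1/2[ and, thanks
   to the factor [n] in the exponent, to [0] on all of [1/2, 1]. *)
Definition step_approx (y : R) (n : nat) : R := (1 - y ^+ n) ^+ (n * 2 ^ n).

Lemma step_approx_bound (y : R) n : 0 <= y <= 1 -> 0 <= step_approx y n <= 1.
Proof.
move=> /andP[y0 y1].
have h0 : 0 <= 1 - y ^+ n by rewrite subr_ge0 exprn_ile1.
rewrite /step_approx exprn_ge0//= exprn_ile1// lerBlDr lerDl exprn_ge0//.
Qed.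

(** Let [N = n 2^n]. For [y < 1/2], Bernoulli gives [(1 - y^n)^N >= 1 - N y^n], where
    [N y^n = n (2 y)^n] tends to 0. For [y >= 1/2], it gives [(1 + y^n)^N >= n + 1], while
    [(1 - y^n)^N (1 + y^n)^N <= 1]. *)
Lemma step_approx_cvg (y : R) : 0 <= y <= 1 ->
  step_approx y n @[n --> \oo] --> if y < 2^-1 then (1 : R) else 0.
Proof.
move=> y01; have /andP[y0 y1] := y01; case: ifPn => [y2|]; last rewrite -leNgt => y2.
- have H n : 1 - n%:R * (2 * y) ^+ n <= step_approx y n.
    have := @bernoulli (- y ^+ n) (n * 2 ^ n); rewrite lerN2 exprn_ile1// => /(_ isT).
    by apply: le_trans; rewrite natrM natrX exprMn mulrN mulrA.
  apply: (@squeeze_cvgr _ _ _ _ (fun n => 1 - n%:R * (2 * y) ^+ n) (fun=> 1)).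
  + by apply: nearW => n; rewrite H/=; have /andP[] := step_approx_bound n y01.
  + rewrite -[X in _ --> X]subr0; apply: cvgB; first exact: cvg_cst.
    by apply: cvg_natrX; lra.
  + exact: cvg_cst.
- have H n : step_approx y n <= n.+1%:R^-1.
    have yn0 : 0 <= y ^+ n by exact: exprn_ge0.
    have yn1 : y ^+ n <= 1 by exact: exprn_ile1.
    have B : n.+1%:R <= (1 + y ^+ n) ^+ (n * 2 ^ n).
      apply: le_trans (bernoulli _ _); last by lra.
      rewrite -nat1r lerD2l natrM natrX -mulrA -exprMn ler_peMr// exprn_ege1//.
      by lra.
    rewrite -[leRHS]mul1r ler_pdivlMr//.
    apply: (@le_trans _ _ (step_approx y n * (1 + y ^+ n) ^+ (n * 2 ^ n))).
      by rewrite ler_wpM2l//; have /andP[] := step_approx_bound n y01.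
    rewrite /step_approx -exprMn exprn_ile1//; last by nra.
    by apply: mulr_ge0; lra.
  apply: (@squeeze_cvgr _ _ _ _ (fun=> 0) (fun n => n.+1%:R^-1)).
  + by apply: nearW => n; rewrite H andbT; have /andP[] := step_approx_bound n y01.
  + exact: cvg_cst.
  + exact: cvg_harmonic.
Qed.

End step_approximation.

(** * Approximation of indicators of boxes by trigonometric polynomials *)

Section arcs.
Context {R : realType} {p : nat}.
Context (T : 'rV[R]_p) (T0 : forall i, 0 < T ord0 i).

(** The angle on the right is [2 pi / L] times [x - c / 2], the signed distance to the midpoint of
    the arc, whose half-length [c / 2] corresponds to the angle [pi c / L]. *)
Lemma cos_arc (L c x : R) : 0 < c <= L -> 0 <= x <= L ->
  (cos (pi * c / L) < cos (2 * pi * x / L - pi * c / L)) = (0 < x < c).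
Proof.
move=> /andP[c0 cL] /andP[x0 xL].
have L0 : 0 < L by exact: lt_le_trans cL.
have pi0 := @pi_gt0 R.
pose k := pi / L; have k0 : 0 < k by rewrite divr_gt0.
have kL : k * L = pi by rewrite /k mulfVK// gt_eqF.
rewrite (_ : pi * c / L = k * c); last by rewrite /k mulrAC.
rewrite (_ : 2 * pi * x / L = 2 * (k * x)); last by rewrite /k; field; rewrite gt_eqF.
have ck : k * c \in `[0, pi] by rewrite in_itv/= -kL ler_pM2l// cL andbT mulr_ge0// ltW.
have [xc|xc] := ltP x c; last first.
  rewrite andbF; apply/negbTE; rewrite -leNgt.
  have kxc : k * c <= k * x by rewrite ler_pM2l.
  have kxL : k * x <= pi by rewrite -kL ler_pM2l.
  have [H|H] := leP (2 * (k * x) - k * c) pi.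
    rewrite le_eqVlt; have := ltr_cos ck (y := 2 * (k * x) - k * c).
    rewrite in_itv/= H andbT => ->; last by have := itvP ck; rewrite in_itv/= in ck; case/andP : ck => *; lra.
    have : k * c <= 2 * (k * x) - k * c by lra.
    by rewrite le_eqVlt => /orP[/eqP <-|->]; rewrite ?eqxx ?orbT.
  (* An angle beyond [pi] is reflected to [2 pi] minus itself, back into [[0, pi]], where the cosine
     decreases. *)
  rewrite -[leLHS]cosN -(cosD2pi (- _)) -[pi *+ 2]mulr_natl opprB.
  rewrite in_itv/= in ck; case/andP : (ck) => ck0 ckpi.
  have cos_le (a b : R) : 0 <= a -> a <= b -> b <= pi -> cos b <= cos a.
    move=> a0 ab bpi; move: ab; rewrite le_eqVlt => /orP[/eqP ->//|ab].
    by apply: ltW; rewrite ltr_cos// in_itv/=; apply/andP; split; lra.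
  by apply: cos_le; lra.
rewrite andbT; have [x00|x00] := ltP 0 x; last first.
  have -> : x = 0 by lra.
  by rewrite !mulr0 sub0r cosN ltxx.
rewrite -[cos (2 * _ - _)]cos_norm ltr_cos//.
  rewrite ltr_norml; have : k * x < k * c by rewrite ltr_pM2l.
  have : 0 < k * x by rewrite mulr_gt0.
  by move=> *; apply/andP; split; lra.
rewrite in_itv/= normr_ge0/=; rewrite in_itv/= in ck; case/andP : (ck) => ck0 ckpi.
have : k * x < k * c by rewrite ltr_pM2l.
have : 0 < k * x by rewrite mulr_gt0.
by move=> *; rewrite ler_norml; apply/andP; split; lra.
Qed.

(* Less than [1/2] exactly for [0 < t^i < c]. *)
Definition arc_fun (i : 'I_p) (c : R) (t : 'rV[R]_p) : R :=
  2^-1 - (cos (2 * pi * t ord0 i / T ord0 i - pi * c / T ord0 i) - cos (pi * c / T ord0 i)) / 4.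

Lemma arc_fun01 i c t : 0 <= arc_fun i c t <= 1.
Proof.
rewrite /arc_fun; set a := cos _; set b := cos (pi * c / _).
have := cos_le1 (2 * pi * t ord0 i / T ord0 i - pi * c / T ord0 i).
have := cos_geN1 (2 * pi * t ord0 i / T ord0 i - pi * c / T ord0 i).
have := cos_le1 (pi * c / T ord0 i).
have := cos_geN1 (pi * c / T ord0 i).
by rewrite -/a -/b => *; apply/andP; split; lra.
Qed.

Lemma trig_arc_fun i c : trig T (arc_fun i c).
Proof.
pose xi : 'rV[R]_p := (2 * pi / T ord0 i) *: delta_mx ord0 i.
have Ti : T ord0 i != 0 by rewrite gt_eqF.
have L : lattice T xi.
  move=> j; exists (j == i)%:Z; rewrite !mxE eqxx/= eq_sym; case: eqP => [->|_]; last first.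
    by rewrite mulr0 !mul0r.
  by rewrite mulr1 mulfVK ?gt_eqF// mul1r mulr_natl.
rewrite (_ : arc_fun i c = fun t => (2^-1 + cos (pi * c / T ord0 i) / 4) +
   (- 4^-1) * wave xi (- (pi * c / T ord0 i)) t).
  exact: trigD (trig_cst _ _) (trig_wave _ _ L).
apply/funext => t; rewrite waveE /arc_fun.
have -> : dotv xi t = 2 * pi * t ord0 i / T ord0 i.
  rewrite (_ : dotv xi t = dotv t xi); last by apply: eq_bigr => k _; rewrite mulrC.
  by rewrite dotvZdelta; field.
by rewrite mulrBl opprB mulNr; ring.
Qed.

Definition box_approx (c : 'I_p -> R) (n : nat) (t : 'rV[R]_p) : R :=
  \prod_i step_approx (arc_fun i (c i) t) n.

Lemma trig_box_approx c n : trig T (box_approx c n).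
Proof.
apply: trig_prod => i; apply: trigX; apply: trigB (trig_cst _ 1) _.
by apply: trigX; exact: trig_arc_fun.
Qed.

Lemma box_approx_bound c n t : 0 <= box_approx c n t <= 1.
Proof.
apply: (big_ind (fun x : R => is_true (0 <= x <= 1))) => [|x y|i _].
- by rewrite ler01 lexx.
- by move=> /andP[? ?] /andP[? ?]; rewrite mulr_ge0//= mulr_ile1.
- exact/step_approx_bound/arc_fun01.
Qed.

Lemma box_approx_cvg (c : 'I_p -> R) t : (forall i, 0 < c i <= T ord0 i) -> box T t ->
  box_approx c n t @[n --> \oo] --> (\1_(rect (fun i => `]0, c i[%classic)) t : R).
Proof.
move=> cT bt; rewrite indicE.
have -> : (t \in rect (fun i => `]0, c i[%classic))%:R =
    \prod_i (if arc_fun i (c i) t < 2^-1 then (1 : R) else 0).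
  have E i : (arc_fun i (c i) t < 2^-1) = (0 < t ord0 i < c i).
    rewrite /arc_fun -(cos_arc (cT i) (bt i)).
    by apply/idP/idP => H; lra.
  have [/set_mem H|H] := boolP (t \in _).
    by rewrite big1// => i _; rewrite E; have := H i; rewrite /= in_itv/= => ->.
  have [i Hi] : exists i, ~~ (0 < t ord0 i < c i).
    apply/existsP; apply: contraR H => /existsPn H; apply/mem_set => i.
    by rewrite /= in_itv/=; have := H i; rewrite negbK.
  by rewrite (bigD1 i)//= E (negbTE Hi) mul0r.
apply: cvg_big => //; first by move=> z; exact: mul_continuous.
by move=> i _; exact/step_approx_cvg/arc_fun01.
Qed.

End arcs.

(** * Functions orthogonal to all trigonometric polynomials *)

Section completeness.
Context {R : realType} {p : nat}.
Context (T : 'rV[R]_p) (T0 : forall i, 0 < T ord0 i).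
Local Notation mu := (leb R p).
Local Notation D := (box T).
Local Notation ip := (ip (leb R p) (box T)).
Local Notation sqint := (sqint (leb R p) (box T)).
Local Notation trig := (trig T).
Let mD := measurable_box_leb T.
Let fD := leb_box_lty T.

Lemma leb_hyperplane (i : 'I_p) (c : R) : leb R p [set t | t ord0 i = c] = 0%E.
Proof.
have E : [set t : 'rV[R]_p | t ord0 i = c] =
    rect (fun j => if j == i then [set c] else setT).
  apply/seteqP; split => t /= => [tc j|/(_ i)]; last by rewrite eqxx.
  by case: eqP => [->|].
have mA j : measurable (if j == i then [set c] else [set: measurableTypeR R]).
  by case: ifP => _; [exact: measurable_set1|exact: measurableT].
transitivity (leb R p (rect (fun j => if j == i then [set c] else setT))).
  by congr (leb R p _); exact: E.
rewrite lebE; last exact: measurable_rect.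
by rewrite borel_lebesgue_rect// (bigD1 i)//= eqxx lebesgue_measure_set1 mul0e.
Qed.

Lemma measurable_hyperplane (i : 'I_p) (c : R) :
  measurable ([set t | t ord0 i = c] : set (lebRV R p)).
Proof.
apply: measurable_lebRV.
have := @measurable_coord R p i measurableT [set c] (measurable_set1 c).
by rewrite setTI.
Qed.

(** The limits of the approximations are indicators of open boxes, so the faces have to be discarded
    as a null set. *)
Definition box_bdry : set 'rV[R]_p :=
  \big[setU/set0]_i ([set t : 'rV[R]_p | t ord0 i = 0] `|` [set t : 'rV[R]_p | t ord0 i = T ord0 i]).

Lemma box_bdry_null : measurable (box_bdry : set (lebRV R p)) /\ leb R p box_bdry = 0%E.
Proof.
pose P (A : set 'rV[R]_p) := measurable (A : set (lebRV R p)) /\ leb R p A = 0%E.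
have P0 : P set0 by split; [exact: measurable0|exact: measure0].
have PU A B : P A -> P B -> P (A `|` B).
  by move=> [mA A0] [mB B0]; split; [exact: measurableU|rewrite null_set_setU].
suff : P box_bdry by [].
have PF i : true -> P ([set t : 'rV[R]_p | t ord0 i = 0] `|` [set t : 'rV[R]_p | t ord0 i = T ord0 i]).
  by move=> _; apply: PU; split; [exact: measurable_hyperplane|exact: leb_hyperplane
    |exact: measurable_hyperplane|exact: leb_hyperplane].
rewrite /box_bdry.
exact (@big_ind _ P _ _ P0 PU _ (index_enum 'I_p) (fun=> true)
  (fun i => [set t : 'rV[R]_p | t ord0 i = 0] `|` [set t : 'rV[R]_p | t ord0 i = T ord0 i]) PF).
Qed.

Section orthogonal.
Context (h : 'rV[R]_p -> R) (sh : sqint h) (hperp : forall v, trig v -> ip h v = 0).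
Let Ih : integrableR mu D h := sqint_integrable mD fD sh.

(** Dominated convergence along [box_approx], with bound [|h|]. *)
Lemma perp_rect (c : 'I_p -> R) : (forall i, 0 < c i <= T ord0 i) ->
  \int[mu]_(t in D) (h t * \1_(rect (fun i => `]0, c i[%classic)) t) = 0.
Proof.
move=> cT; set A := rect _.
have mA : measurable (A : set (lebRV R p)).
  by apply: measurable_lebRV; apply: measurable_rect => i; exact: measurable_itv.
have mh := sqint_mfun sh.
have mq n : measurable_fun (D : set (lebRV R p)) (box_approx T c n).
  exact: sqint_mfun (trig_sqint (trig_box_approx T0 c n)).
have [] := @dominated_cvgR _ _ R mu D mD (fun n t => h t * box_approx T c n t)
   (fun t => h t * \1_A t) (fun t => `|h t|).
- by move=> n; exact: measurable_funM.
- by apply: measurable_funM => //; exact: measurable_indic.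
- by apply: aeW => t Dt; apply: cvgMr; exact: box_approx_cvg.
- exact: integrableR_norm.
- move=> n t Dt; rewrite normrM ler_piMr//.
  by have /andP[? ?] := box_approx_bound T c n t; rewrite ger0_norm.
move=> _; rewrite (_ : (fun n => _) = cst 0); last first.
  by apply/funext => n; rewrite -ipE; apply: hperp; exact: trig_box_approx.
by move=> /(cvg_lim _) <-//; rewrite lim_cst.
Qed.

(** Dynkin induction: up to the boundary of the box, the generating quadrants cut it in the sets of
    [perp_rect], or in nothing. *)
Lemma perp_borel (B : set 'rV[R]_p) : measurable (B : set (borelRV R p)) ->
  (\int[mu]_(t in D `&` B) (h t)%:E = 0)%E.
Proof.
rewrite measurable_borelRV_halfspaces; move: B.
have ID : mu.-integrable D (EFin \o h) by exact: Ih.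
have IB (B : set 'rV[R]_p) : measurable (B : set (borelRV R p)) -> mu.-integrable (D `&` B) (EFin \o h).
  by move=> mB; apply: integrableS ID => //; apply: measurableI => //; exact: measurable_lebRV.
have HD : (\int[mu]_(t in D) (h t)%:E = 0)%E.
  have := hperp (trig_cst T 1); rewrite ipE => H.
  rewrite -[LHS]fineK; last exact: integrable_fin_num.
  by congr EFin; rewrite -[RHS]H; apply: eq_Rintegral => t _; rewrite mulr1.
apply: (@dynkin_induction _ (borelRV R p)).
- exact: measurable_borelRV_halfspaces.
- move=> _ _ [c ->] [c' ->]; exists (fun i => Num.min (c i) (c' i)).
  rewrite rectI; congr rect; apply/funext => i; apply/seteqP; split => x /=.
    by rewrite !in_itv/= lt_min => -[-> ->].
  by rewrite !in_itv/= lt_min => /andP[].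
- by rewrite setIT.
(* The bounds are clipped to the box; if one of them is not positive, the quadrant misses the
   box. *)
- move=> _ [c ->]; pose c' i := Num.min (c i) (T ord0 i).
  have [c0|/forallPn[i ci]] := boolP [forall i, 0 < c i]; last first.
    rewrite (_ : D `&` _ = set0) ?integral_set0//.
    apply/seteqP; split => t //= [bt /(_ i)]; rewrite /= in_itv/= => tc.
    have /andP[t0 _] := bt i; move: ci; rewrite -leNgt => /(lt_le_trans tc).
    by rewrite ltNge t0.
  have c'T i : 0 < c' i <= T ord0 i.
    by rewrite lt_min T0 (forallP c0)/= ge_min lexx orbT.
  have := perp_rect c'T; set A := rect _ => H.
  have [mN N0] := box_bdry_null.
  rewrite (negligible_integral mN _ _ N0)//; last 2 first.
  + by apply: measurableI => //; apply: measurable_lebRV; apply: measurable_rect => i; exact: measurable_itv.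
  + by apply: IB; apply: measurable_rect => i; exact: measurable_itv.
  rewrite (_ : _ `\` _ = (D `&` A) `\` box_bdry); last first.
    apply/seteqP; split => t [[bt At] nb]; split => //; split => // i.
      have := At i; rewrite /= !in_itv/= lt_min => -> /=.
      have /andP[t0 tT] := bt i; rewrite !lt_neqAle t0 tT !andbT.
      apply/andP; split; apply/eqP => E; apply: nb; rewrite /box_bdry (bigD1 i)//=; left.
        by left.
      by right.
    by have := At i; rewrite /= !in_itv/= lt_min => /and3P[].
  rewrite -(negligible_integral mN _ _ N0)//; last 2 first.
  + by apply: measurableI => //; apply: measurable_lebRV; apply: measurable_rect => i; exact: measurable_itv.
  + by apply: IB; apply: measurable_rect => i; exact: measurable_itv.
  have mA : measurable (A : set (lebRV R p)).
    by apply: measurable_lebRV; apply: measurable_rect => i; exact: measurable_itv.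
  have IA : mu.-integrable (D `&` A) (EFin \o h).
    by apply: IB; apply: measurable_rect => i; exact: measurable_itv.
  rewrite -[LHS]fineK; last by apply: integrable_fin_num => //; exact: measurableI.
  congr EFin; rewrite -[RHS]H -[LHS]/(\int[mu]_(t in D `&` A) h t) Rintegral_mkcondr.
  apply: eq_Rintegral => t _; rewrite /patch indicE.
  by case: (t \in A); rewrite ?mulr1 ?mulr0.
- move=> S mS HS.
  have mDS : measurable (D `&` S : set (lebRV R p)).
    by apply: measurableI => //; exact: measurable_lebRV.
  have mDCS : measurable (D `&` ~` S : set (lebRV R p)).
    by apply: measurableI => //; apply: measurable_lebRV; exact: measurableC.
  have DS : (D `&` S) `|` (D `&` ~` S) = D by rewrite -setIUr setUv setIT.
  move: HD; rewrite -{1}DS integral_setU_EFin//.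
  + by rewrite HS add0e.
  + by rewrite DS; have /measurable_EFinP := measurable_int _ ID.
  + apply/disj_setPS => t [[_ St] [_ nSt]]; exact: nSt.
- move=> F mF tF HF; rewrite setI_bigcupr integral_bigcup//.
  + by rewrite eseries0// => n _ _; exact: HF.
  + exact: trivIset_setIl.
  + by move=> k; apply: measurableI => //; exact: measurable_lebRV.
  + by rewrite -setI_bigcupr; apply: IB; exact: bigcup_measurable.
Qed.

(** The completed measure is an infimum over countable Borel covers; intersecting covers with excess
    [1 / (k + 1)] gives a Borel set exceeding [E] by a null set. *)
Lemma borel_hull (E : set 'rV[R]_p) : E `<=` D -> measurable (E : set (lebRV R p)) ->
  exists B : set 'rV[R]_p, [/\ measurable (B : set (borelRV R p)), B `<=` D,
    E `<=` B & leb R p (B `\` E) = 0%E].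
Proof.
move=> ED mE.
have le_leb (A B : set 'rV[R]_p) : measurable (A : set (lebRV R p)) ->
    measurable (B : set (lebRV R p)) -> A `<=` B -> (leb R p A <= leb R p B)%E.
  by move=> mA mB AB; apply: le_measure => //; rewrite inE.
have fE : leb R p E \is a fin_num.
  by rewrite ge0_fin_numE//; apply: le_lt_trans fD; exact: le_leb.
have H (k : nat) : exists F : (set 'rV[R]_p)^nat,
    [/\ forall i, measurable (F i : set (borelRV R p)), E `<=` \bigcup_i F i &
     (\sum_(i <oo) borel_lebesgue R p (F i) < leb R p E + (k.+1%:R^-1)%:E)%E].
  have k0 : 0 < k.+1%:R^-1 :> R by rewrite invr_gt0.
  have [_ [F [mF EF] <-] lF] := lb_ereal_inf_adherent k0 fE.
  by exists F.
pose F k := sval (cid (H k)).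
have HF k := svalP (cid (H k)).
pose B := D `&` \bigcap_k \bigcup_i F k i.
have mB : measurable (B : set (borelRV R p)).
  apply: measurableI; first exact: measurable_box.
  apply: bigcap_measurable; first by exists 0%N.
  by move=> k _; apply: bigcup_measurable => i _; have [mF _ _] := HF k; exact: mF.
have EB : E `<=` B.
  by move=> t Et; split; [exact: ED|move=> k _; have [_ + _] := HF k; exact].
have mB' := measurable_lebRV mB.
exists B; split => //; first exact: subIsetl.
have BE : (leb R p B <= leb R p E)%E.
  apply/lee_addgt0Pr => e e0.
  have [k ke] : exists k : nat, k.+1%:R^-1 <= e.
    exists (Num.truncn e^-1); rewrite invf_ple ?posrE//.
    exact/ltW/truncnS_gt.
  have [mFk EFk lk] := HF k.
  apply: (@le_trans _ _ (leb R p (\bigcup_i F k i))).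
    apply: le_leb => //; first by apply: measurable_lebRV; apply: bigcup_measurable => i _; exact: mFk.
    by move=> t [_ /(_ k Logic.I)].
  apply: (@le_trans _ _ (\sum_(i <oo) leb R p (F k i))%E).
    apply: measure_sigma_subadditive => //.
    + by move=> i; apply: measurable_lebRV; exact: mFk.
    + by apply: measurable_lebRV; apply: bigcup_measurable => i _; exact: mFk.
  rewrite (eq_eseriesr (g := fun i => borel_lebesgue R p (F k i))); last first.
    by move=> i _; rewrite lebE//; exact: mFk.
  by apply: le_trans (ltW lk) _; rewrite leeD2l// lee_fin.
rewrite measureD//; last by apply: le_lt_trans fD; apply: le_leb => //; exact: subIsetl.
rewrite (_ : B `&` E = E); last by apply/setIidPr.
apply/eqP; rewrite eq_le; apply/andP; split.
  by rewrite lee_subel_addr// add0e.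
by rewrite sube_ge0 ?fE ?orbT//; exact: le_leb.
Qed.

(** Vanishing almost everywhere is tested on Lebesgue measurable sets; [borel_hull] brings them back
    to Borel sets. *)
Lemma perp_ae0 : {ae mu, forall t, D t -> h t = 0}.
Proof.
have H : ae_eq mu D (EFin \o h) (cst 0%E).
  apply: (integral_ae_eq mD); [exact: Ih|exact: measurable_cst|].
  move=> E ED mE; rewrite integral0.
  have [B [mB BD EB BE0]] := borel_hull ED mE.
  have mB' := measurable_lebRV mB.
  have ID : mu.-integrable D (EFin \o h) by exact: Ih.
  have := perp_borel mB; rewrite (_ : D `&` B = B); last by rewrite setIC; exact/setIidPl.
  have mBE : measurable (B `\` E : set (lebRV R p)) by exact: measurableD.
  have IB : mu.-integrable B (EFin \o h) by exact: integrableS ID.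
  rewrite (negligible_integral mBE mB' IB BE0).
  rewrite (_ : B `\` (B `\` E) = E)//; rewrite setDD; exact/setIidPr.
case: H => N [mN N0 sN]; exists N; split => // t /= Ht; apply: sN => /= H1; apply: Ht => Dt.
by have [] := H1 Dt.
Qed.

End orthogonal.

End completeness.

Section parallelogram.
Context {d : measure_display} {X : measurableType d} {R : realType}.
Context (mu : {measure set X -> \bar R}) (D : set X).
Context (mD : measurable D) (finD : (mu D < +oo)%E).
Local Notation sqint := (sqint mu D).
Local Notation nrm2 := (nrm2 mu D).

Lemma nrm2_midpoint f g : sqint f -> sqint g ->
  nrm2 (fun x => 2^-1 * f x + 2^-1 * g x) =
  2^-1 * nrm2 f + 2^-1 * nrm2 g - 4^-1 * nrm2 (fun x => f x - g x).
Proof.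
move=> sf sg; rewrite (nrm2D mD (sqintZ mD _ sf) (sqintZ mD _ sg)) (nrm2B mD sf sg).
rewrite (nrm2Z mD _ sf) (nrm2Z mD _ sg) (ipZl mD _ sf (sqintZ mD _ sg)) (ipZr mD _ sg sf).
by field.
Qed.

Lemma nrm2_cvg (f : nat -> X -> R) g : (forall k, sqint (f k)) -> sqint g ->
  nrm2 (fun x => f k x - g x) @[k --> \oo] --> 0 -> nrm2 (f k) @[k --> \oo] --> nrm2 g.
Proof. by move=> sf sg fg; exact: (ip_cvg mD sf sf sg sg fg fg). Qed.

End parallelogram.

Lemma eighth_le1 (R : realType) k : 0 <= (8^-1 : R) ^+ k <= 1.
Proof. by rewrite exprn_ge0//= exprn_ile1//; lra. Qed.

Lemma cvg_eighth (R : realType) (C : R) : C * 8^-1 ^+ k @[k --> \oo] --> 0.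
Proof.
rewrite -[X in _ --> X](mulr0 C); apply: cvgMr; apply: cvg_expr.
by rewrite ger0_norm//; lra.
Qed.

Section density.
Context {R : realType} {p : nat}.
Context (T : 'rV[R]_p) (T0 : forall i, 0 < T ord0 i).
Local Notation ip := (ip (leb R p) (box T)).
Local Notation nrm2 := (nrm2 (leb R p) (box T)).
Local Notation sqint := (sqint (leb R p) (box T)).
Local Notation trig := (trig T).
Let mD := measurable_box_leb T.

(* The distance of [f] to the trigonometric polynomials is attained in the
   limit, at a function [g] such that [g - f] is orthogonal to all of them. *)
Lemma trig_dense f : sqint f -> exists g : nat -> 'rV[R]_p -> R,
  (forall k, trig (g k)) /\ forall k, nrm2 (fun t => g k t - f t) <= 8^-1 ^+ k.
Proof.
move=> sf.
pose E := [set nrm2 (fun t => v t - f t) | v in trig].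
have hE : has_inf E.
  split; first by exists (nrm2 (fun t => cst 0 t - f t)), (cst 0) => //; exact: trig_cst.
  by exists 0 => _ [v _ <-]; exact: nrm2_ge0.
have infE v : trig v -> inf E <= nrm2 (fun t => v t - f t).
  by move=> tv; apply: ge_inf; [exact: hE.2|exists v].
have e0 k : 0 < 8^-1 ^+ k :> R by rewrite exprn_gt0.
have exv k : exists v, trig v /\ nrm2 (fun t => v t - f t) <= inf E + 8^-1 ^+ k.
  by have [_ [v tv <-] lv] := inf_adherent (e0 k) hE; exists v; split => //; exact: ltW.
pose v k := sval (cid (exv k)).
have tv k : trig (v k) := (svalP (cid (exv k))).1.
have lv k : nrm2 (fun t => v k t - f t) <= inf E + 8^-1 ^+ k := (svalP (cid (exv k))).2.
have sv k := trig_sqint (tv k).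
have svf k := sqintB mD (sv k) sf.
(* The midpoint of two consecutive terms is a competitor, so a quarter of their squared distance is
   at most the mean [(8^-(k+1) + 8^-k) / 2] of the excesses. *)
have vC k : nrm2 (fun t => v k.+1 t - v k t) <= 8 * 8^-1 ^+ k.
  have := nrm2_midpoint mD (svf k.+1) (svf k).
  have := infE _ (trigD (trigZ 2^-1 (tv k.+1)) (trigZ 2^-1 (tv k))).
  rewrite (_ : (fun t => _ + _ - f t) =
    (fun t => 2^-1 * (v k.+1 t - f t) + 2^-1 * (v k t - f t))); last first.
    by apply/funext => t; field.
  rewrite (_ : (fun t => _ - _ - _) = (fun t => v k.+1 t - v k t)); last first.
    by apply/funext => t; ring.
  have := lv k; have := lv k.+1; rewrite exprS.
  have := e0 k; move: (8^-1 ^+ k) => e *; lra.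
have [g [sg vg _]] := L2_fast_complete mD sv vC.
have sgf := sqintB mD sg sf.
have vgf : nrm2 (fun t => (v k t - f t) - (g t - f t)) @[k --> \oo] --> 0.
  rewrite (_ : (fun k => _) = (fun k => nrm2 (fun t => v k t - g t)))//.
  by apply/funext => k; congr (nrm2 _); apply/funext => t; ring.
have cgf := nrm2_cvg mD svf sgf vgf.
have gE : nrm2 (fun t => g t - f t) <= inf E.
  have c : inf E + 1 * 8^-1 ^+ k @[k --> \oo] --> inf E.
    by rewrite -[X in _ --> X]addr0; apply: cvgD; [exact: cvg_cst|exact: cvg_eighth].
  rewrite -(cvg_lim _ cgf)// -[leRHS](cvg_lim _ c)//.
  apply: ler_lim; [exact: cvgP cgf|exact: cvgP c|].
  by apply: nearW => k; rewrite mul1r.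
have perp w : trig w -> ip (fun t => g t - f t) w = 0.
  move=> tw; have sw := trig_sqint tw.
  (* The distance is varied at [v k] in the direction [w], and then [k] tends to infinity. *)
  have H s : 0 <= 2 * s * ip (fun t => g t - f t) w + s ^+ 2 * nrm2 w.
    have Hk k : inf E <= nrm2 (fun t => (v k t - f t)) + 2 * s * ip (fun t => v k t - f t) w + s ^+ 2 * nrm2 w.
      apply: le_trans (infE _ (trigD (tv k) (trigZ s tw))) _.
      rewrite (_ : (fun t => _ - f t) = (fun t => (v k t - f t) + s * w t)); last first.
        by apply/funext => t; ring.
      rewrite (nrm2D mD (svf k) (sqintZ mD s sw)) (nrm2Z mD s sw) (ipZr mD s sw (svf k)).
      by rewrite mulrA.
    have c : nrm2 (fun t => (v k t - f t)) + 2 * s * ip (fun t => v k t - f t) w + s ^+ 2 * nrm2 w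
        @[k --> \oo] --> nrm2 (fun t => g t - f t) + 2 * s * ip (fun t => g t - f t) w + s ^+ 2 * nrm2 w.
      apply: cvgD; last exact: cvg_cst.
      apply: cvgD => //; apply: cvgMr.
      apply: (ip_cvg mD (f' := fun=> w)) => //.
      rewrite (_ : (fun k => _) = cst 0); first exact: cvg_cst.
      apply/funext => k; rewrite (_ : (fun t => w t - w t) = (fun t => 0 * w t)).
        by rewrite (nrm2Z mD 0 sw) expr0n mul0r.
      by apply/funext => t; rewrite subrr mul0r.
    have : inf E <= nrm2 (fun t => g t - f t) + 2 * s * ip (fun t => g t - f t) w + s ^+ 2 * nrm2 w.
      rewrite -(cvg_lim _ c)//; apply: limr_ge; first exact: cvgP c.
      exact: nearW.
    by move: gE; lra.
  have w0 : 0 <= nrm2 w by exact: nrm2_ge0.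
  (* With [a = <g - f, w>] and [b = |w|^2], the choice [s = - a / (b + 1)] gives
     [- (a / (b + 1))^2 (b + 2)]; the added 1 covers [w = 0]. *)
  have := H (- ip (fun t => g t - f t) w / (nrm2 w + 1)).
  set a := ip _ w; set b := nrm2 w.
  rewrite (_ : _ + _ = - (a / (b + 1)) ^+ 2 * (b + 2)); last by field; rewrite /b; apply: lt0r_neq0; lra.
  rewrite mulNr oppr_ge0 pmulr_lle0; last by rewrite /b; lra.
  move=> /(conj (sqr_ge0 (a / (b + 1))))/andP; rewrite -eq_le eq_sym sqrf_eq0 mulf_eq0 invr_eq0.
  by move=> /orP[/eqP //|]; rewrite gt_eqF// /b; lra.
have ae0 := perp_ae0 T0 sgf perp.
have n0 := nrm2_0 mD ae0 sgf.
(* Since [g = f] almost everywhere, the infimum is 0 and the minimising sequence itself approximates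
   [f] at the rate [8^-k]. *)
have inf0 : inf E <= 0.
  rewrite -n0 -(cvg_lim _ cgf)//; apply: limr_ge; first exact: cvgP cgf.
  by apply: nearW => k; exact: infE.
exists v; split => // k; apply: le_trans (lv k) _; lra.
Qed.

End density.

(** * Convex functions of class C^1 *)

Section linear_growth.
Context {R : realType}.

(** Mean value theorem on [[0, s]]. As [a] is arbitrary on the negative axis, the limits of
    quotients are unpacked into estimates at points of the half-line. *)
Lemma C1_Rplus_linear_growth (a a' : R -> R) (M : R) : C1_Rplus a a' ->
  (forall s, 0 <= s -> a' s <= M) -> forall s, 0 <= s -> a s <= a 0 + M * s.
Proof.
move=> [da _] aM s; rewrite le_eqVlt => /orP[/eqP <-|s0]; first by rewrite mulr0 addr0.
have H x : 0 <= x -> forall e, 0 < e -> exists2 r, 0 < r &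
    forall y, 0 <= y -> y != x -> `|x - y| < r -> `|a' x - (a y - a x) / (y - x)| <= e.
  move=> x0 e e0; have /cvgrPdist_le/(_ e e0) := da x x0.
  rewrite near_withinE => -[r /= r0 Hr]; exists r => // y y0 yx xy.
  by apply: Hr => //=; rewrite in_itv/= y0.
have cont x : 0 <= x -> forall e, 0 < e -> exists2 r, 0 < r &
    forall y, 0 <= y -> `|x - y| < r -> `|a x - a y| <= e.
  move=> x0 e e0; have [r r0 Hr] := H x x0 1 ltr01.
  pose C := `|a' x| + 1; have C0 : 0 < C by rewrite ltr_wpDl.
  exists (Num.min r (e / C)); first by rewrite lt_min r0 divr_gt0.
  move=> y y0; rewrite lt_min => /andP[yr ye].
  have [->|yx] := eqVneq y x; first by rewrite subrr normr0 ltW.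
  have := Hr y y0 yx yr; set q := _ / _ => Hq.
  have qC : `|q| <= C.
    rewrite -[q](subKr (a' x)); apply: le_trans (ler_normB _ _) _.
    by rewrite lerD2l.
  have -> : a x - a y = - (q * (y - x)) by rewrite /q mulfVK ?subr_eq0// opprB.
  rewrite normrN normrM distrC; apply: le_trans (ler_wpM2r _ qC) _ => //.
  by rewrite mulrC -ler_pdivlMr// ltW.
have [||c] := @MVT R a a' 0 s s0.
- move=> x; rewrite in_itv/= => /andP[x0 xs].
  have lim : h^-1 *: (a (h *: 1 + x) - a x) @[h --> 0^'] --> a' x.
    apply/cvgrPdist_le => e e0; have [r r0 Hr] := H x (ltW x0) e e0.
    (* Cutting the radius at [x] keeps [x + h] in the half-line. *)
    exists (Num.min r x) => /=; first by rewrite lt_min r0.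
    move=> h /=; rewrite sub0r normrN lt_min => /andP[hr hx] h0.
    have := Hr (h *: 1 + x); rewrite [h *: 1]mulr1 addrK.
    rewrite opprD addrCA subrr addr0 normrN => /(_ _ _ hr).
    rewrite [_ / h]mulrC; apply.
      by have := ler_norm (- h); rewrite normrN; lra.
    by rewrite -subr_eq0 addrK.
  by split; [apply/cvg_ex; exists (a' x)|exact/cvg_lim].
- apply/continuous_within_itvP => //; split.
  + move=> x; rewrite in_itv/= => /andP[x0 xs].
    apply/cvgrPdist_le => e e0; have [r r0 Hr] := cont x (ltW x0) e e0.
    exists (Num.min r x) => /=; first by rewrite lt_min r0.
    move=> y /=; rewrite lt_min => /andP[yr yx]; apply: Hr => //.
    by have := ler_norm (x - y); lra.
  + apply/cvgrPdist_le => e e0; have [r r0 Hr] := cont 0 (lexx 0) e e0.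
    exists r => //= y /= yr y0; apply: Hr => //; exact: ltW.
  + apply/cvgrPdist_le => e e0; have [r r0 Hr] := cont s (ltW s0) e e0.
    exists (Num.min r s) => /=; first by rewrite lt_min r0.
    move=> y /=; rewrite lt_min => /andP[yr yx] ys; apply: Hr => //.
    by have := ler_norm (s - y); lra.
rewrite in_itv/= subr0 => /andP[c0 cs] E.
have := aM c (ltW c0) => acM.
have : a' c * s <= M * s by rewrite ler_pM2r.
lra.
Qed.

End linear_growth.

Section convex_C1.
Context {R : realType} {n : nat}.
Context (f : 'rV[R]_n -> R) (fC1 : Ck 1 (f : 'rV[R]_n -> R^o)) (fconv : strictly_convex f).
Implicit Types x y v w : 'rV[R]_n.

Lemma convex_le x y (l : R) : 0 <= l <= 1 ->
  f (l *: x + (1 - l) *: y) <= l * f x + (1 - l) * f y.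
Proof.
move=> /andP[l0 l1]; have [->|xy] := eqVneq x y.
  by rewrite -scalerDl -mulrDl addrC subrK scale1r mul1r.
move: l0; rewrite le_eqVlt => /orP[/eqP <-|l0].
  by rewrite scale0r mul0r !add0r subr0 scale1r mul1r.
move: l1; rewrite le_eqVlt => /orP[/eqP ->|l1].
  by rewrite subrr scale0r mul0r !addr0 scale1r mul1r.
by apply/ltW/fconv => //; exact/eqP.
Qed.

Lemma continuous_C1 : continuous f.
Proof. by have [] := fC1. Qed.

Lemma continuous_grad i : continuous (fun x => grad f x ord0 i).
Proof.
have [_ /(_ i)[_ c]] := fC1.
by rewrite (_ : (fun x => _) = partial i (f : _ -> R^o))//; apply/funext => x; rewrite mxE.
Qed.

(** The half of differentiability that convexity propagates: an upper bound on increments passes to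
    sums of directions, hence from the axes, where the partial derivatives give it, to every
    direction. *)
Let upper x v := forall e : R, 0 < e -> exists2 r : R, 0 < r &
  forall s : R, 0 < s < r -> f (x + s *: v) - f x <= s * (dotv (grad f x) v + e).

(** [x + s (v + w)] is the midpoint of [x + 2 s v] and [x + 2 s w], whence the halved radius and
    errors. *)
Let upperD x v w : upper x v -> upper x w -> upper x (v + w).
Proof.
move=> Hv Hw e e0; have e2 : 0 < e / 2 by rewrite divr_gt0.
have [r r0 Hr] := Hv _ e2; have [r' r'0 Hr'] := Hw _ e2.
exists (Num.min r r' / 2); first by rewrite divr_gt0// lt_min r0.
move=> s /andP[s0]; rewrite ltr_pdivlMr// lt_min => /andP[sr sr'].
have s2 : 0 < s * 2 by rewrite mulr_gt0.
have := Hr (s * 2); rewrite s2 sr => /(_ isT).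
have := Hr' (s * 2); rewrite s2 sr' => /(_ isT).
have := @convex_le (x + (s * 2) *: v) (x + (s * 2) *: w) (2^-1).
have -> : 0 <= (2^-1 : R) <= 1 by apply/andP; split; lra.
move=> /(_ isT).
have -> : 2^-1 *: (x + (s * 2) *: v) + (1 - 2^-1) *: (x + (s * 2) *: w) = x + s *: (v + w).
  by apply/rowP => i; rewrite !mxE; field.
rewrite dotvDr; lra.
Qed.

Let upper_delta x i c : upper x (c *: delta_mx ord0 i).
Proof.
move=> e e0; have [->|c0] := eqVneq c 0.
  exists 1 => // s /andP[s0 _]; rewrite dotvZdelta mul0r add0r !scale0r scaler0 addr0 subrr.
  by rewrite mulr_ge0 ?ltW.
have [_ /(_ i)[/(_ x) dx _]] := fC1.
have dlim : h^-1 *: (f (h *: delta_mx ord0 i + x) - f x) @[h --> 0^'] --> grad f x ord0 i.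
  by rewrite mxE; exact: dx.
have ec : 0 < e / `|c| by rewrite divr_gt0// normr_gt0.
have [r /= r0 Hr] := (cvgrPdist_le _ _).1 dlim _ ec.
exists (r / `|c|); first by rewrite divr_gt0// normr_gt0.
move=> s /andP[s0]; rewrite ltr_pdivlMr ?normr_gt0// => sr.
have sc0 : s * c != 0 by rewrite mulf_neq0// gt_eqF.
have := Hr (s * c); rewrite /= sub0r normrN normrM (gtr0_norm s0) => /(_ sr sc0).
rewrite dotvZdelta scalerA [x + _]addrC; set q := f _ - f x; set g := grad _ _ _ _.
rewrite -[_ *: q]/((s * c)^-1 * q) => H.
have -> : q = (s * c) * ((s * c)^-1 * q) by rewrite mulrA divff// mul1r.
move: H; set z := _^-1 * q => H.
have : s * c * (z - g) <= s * e.
  apply: le_trans (ler_norm _) _; rewrite normrM normrM (gtr0_norm s0) distrC -mulrA.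
  by rewrite ler_pM2l// mulrC -ler_pdivlMr// normr_gt0.
by lra.
Qed.

Let upper_all x v : upper x v.
Proof.
rewrite [v]row_sum_delta; apply: (big_ind (upper x)).
- move=> e e0; exists 1 => // s /andP[s0 _]; rewrite scaler0 addr0 subrr.
  rewrite (_ : dotv _ 0 = 0) ?add0r ?mulr_ge0 ?ltW//.
  by rewrite /dotv big1// => j _; rewrite [X in _ * X]mxE mulr0.
- by move=> v1 v2; exact: upperD.
- by move=> i _; exact: upper_delta.
Qed.

(** The lower bound follows from the upper one in the direction [- v], because [x] is the midpoint
    of [x + s v] and [x - s v]. *)
Lemma directional_bounds x v (e : R) : 0 < e -> exists2 r : R, 0 < r &
  forall s : R, 0 < s < r -> `|(f (x + s *: v) - f x) / s - dotv (grad f x) v| <= e.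
Proof.
move=> e0; have [r r0 Hr] := upper_all x v e0; have [r' r'0 Hr'] := upper_all x (- v) e0.
exists (Num.min r r'); first by rewrite lt_min r0.
move=> s /andP[s0]; rewrite lt_min => /andP[sr sr'].
have := Hr s; rewrite s0 sr => /(_ isT) H1; have := Hr' s; rewrite s0 sr' => /(_ isT) H2.
have := @convex_le (x + s *: v) (x + s *: (- v)) (2^-1).
have -> : 0 <= (2^-1 : R) <= 1 by apply/andP; split; lra.
move=> /(_ isT).
have -> : 2^-1 *: (x + s *: v) + (1 - 2^-1) *: (x + s *: - v) = x.
  by apply/rowP => i; rewrite !mxE; field.
have E : dotv (grad f x) (- v) = - dotv (grad f x) v.
  by rewrite /dotv -sumrN; apply: eq_bigr => i _; rewrite [X in _ * X]mxE mulrN.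
rewrite E in H2 => H3.
rewrite ler_norml; apply/andP; split.
  by rewrite lerBrDr ler_pdivlMr//; lra.
by rewrite lerBlDr ler_pdivrMr//; lra.
Qed.

Lemma grad_le x y : dotv (grad f x) (y - x) <= f y - f x.
Proof.
apply/ler_addgt0Pr => e e0; have [r r0 Hr] := directional_bounds x (y - x) e0.
pose s := Num.min (r / 2) 2^-1.
have s0 : 0 < s by rewrite lt_min divr_gt0// invr_gt0 ltr0n.
have sr : s < r by rewrite gt_min; apply/orP; left; lra.
have s1 : s <= 1 by rewrite ge_min; apply/orP; right; lra.
have := Hr s; rewrite s0 sr => /(_ isT); rewrite ler_norml => /andP[H _].
have := @convex_le y x s; rewrite s1 (ltW s0) => /(_ isT).
have -> : s *: y + (1 - s) *: x = x + s *: (y - x) by apply/rowP => i; rewrite !mxE; ring.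
move=> H2; have : (f (x + s *: (y - x)) - f x) / s <= f y - f x by rewrite ler_pdivrMr//; lra.
lra.
Qed.

(** The tangent inequality at the midpoint of [x] and [y], where strict convexity leaves a gap. *)
Lemma grad_lt x y : x <> y -> dotv (grad f x) (y - x) < f y - f x.
Proof.
move=> xy; have h0 : 0 < 2^-1 :> R by lra.
have h1 : 2^-1 < 1 :> R by lra.
have := fconv xy h0 h1; have := grad_le x (2^-1 *: x + (1 - 2^-1) *: y).
have -> : 2^-1 *: x + (1 - 2^-1) *: y - x = 2^-1 *: (y - x).
  by apply/rowP => i; rewrite !mxE; field.
rewrite (_ : dotv _ (2^-1 *: _) = 2^-1 * dotv (grad f x) (y - x)); first lra.
by rewrite /dotv mulr_sumr; apply: eq_bigr => i _; rewrite [X in _ * X]mxE mulrCA.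
Qed.

(** A countable sequence of quotients, fit for measurability of the gradient and for dominated
    convergence. *)
Lemma cvg_directional x v :
  m.+1%:R * (f (x + m.+1%:R^-1 *: v) - f x) @[m --> \oo] --> dotv (grad f x) v.
Proof.
apply/cvgrPdist_le => e e0; have [r r0 Hr] := directional_bounds x v e0.
exists (Num.truncn r^-1) => //= m mr.
rewrite distrC [_%:R * _]mulrC -[X in _ * X]invrK; apply: Hr.
rewrite invr_gt0 ltr0n/= invf_plt ?posrE// ?ltr0n//.
by apply: lt_le_trans (truncnS_gt _) _; rewrite ler_nat.
Qed.

(** By the tangent inequality, [s] times a slope is at most an increment of [f] over the length [s],
    which grows like [B s]; dividing by a large [s] leaves [B]. *)
Lemma grad_bounded (A B : R) : 0 <= A -> 0 <= B ->
  (forall x, `|f x| <= A + B * l1norm x) -> forall x i, `|grad f x ord0 i| <= B.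
Proof.
move=> A0 B0 fAB x i.
have l1d (c : R) : l1norm (c *: delta_mx ord0 i : 'rV[R]_n) = `|c|.
  rewrite /l1norm (bigD1 i)//= big1 ?addr0; first by rewrite !mxE !eqxx mulr1.
  by move=> j /negbTE ji; rewrite !mxE ji mulr0 normr0.
have H (s c : R) : 0 < s -> `|c| = 1 -> s * (c * grad f x ord0 i) <= 2 * (A + B * l1norm x) + B * s.
  move=> s0 c1; have := grad_le x (x + (s * c) *: delta_mx ord0 i).
  rewrite addrAC subrr add0r dotvZdelta -mulrA => /le_trans; apply.
  have := fAB (x + (s * c) *: delta_mx ord0 i).
  have := l1normD x ((s * c) *: delta_mx ord0 i).
  rewrite l1d normrM c1 mulr1 (gtr0_norm s0) => l1.
  have := ler_wpM2l B0 l1; rewrite mulrDr => H1 H2; have := fAB x.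
  have := ler_norm (f (x + (s * c) *: delta_mx ord0 i)).
  by have := ler_norm (- f x); rewrite normrN; lra.
have H' (c : R) : `|c| = 1 -> c * grad f x ord0 i <= B.
  move=> c1; apply/ler_addgt0Pr => e e0.
  pose Q := 2 * (A + B * l1norm x).
  have Q0 : 0 <= Q by rewrite mulr_ge0// addr_ge0// mulr_ge0// l1norm_ge0.
  (* Large enough for the part [Q] independent of [s] to be absorbed in [s e]. *)
  pose s := (Q + 1) / e; have s0 : 0 < s by rewrite divr_gt0//; lra.
  have := H s c s0 c1; rewrite -/Q => H1.
  rewrite -(ler_pM2l s0); apply: le_trans H1 _.
  have : s * e = Q + 1 by rewrite /s mulfVK// gt_eqF.
  by lra.
rewrite ler_norml; have := H' 1 (normr1 _); have := H' (-1); rewrite normrN normr1 => /(_ erefl).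
by move=> h1 h2; apply/andP; split; lra.
Qed.

Lemma dotv_le_l1norm x y (B : R) : (forall i, `|x ord0 i| <= B) -> `|dotv x y| <= B * l1norm y.
Proof.
move=> xB; apply: le_trans (ler_norm_sum _ _ _) _; rewrite /l1norm mulr_sumr.
by apply: ler_sum => i _; rewrite normrM ler_wpM2r.
Qed.

Lemma lipschitz_l1norm (B : R) : (forall x i, `|grad f x ord0 i| <= B) ->
  forall x y, `|f y - f x| <= B * l1norm (y - x).
Proof.
move=> fB x y.
have H a b : f a - f b <= B * l1norm (a - b).
  have := grad_le a b; have := dotv_le_l1norm (b - a) (fB a).
  have -> : l1norm (b - a) = l1norm (a - b).
    by apply: eq_bigr => i _; rewrite !mxE distrC.
  by rewrite ler_norml => /andP[h _]; lra.
rewrite ler_norml; apply/andP; split; last exact: H.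
have := H x y; have -> : l1norm (x - y) = l1norm (y - x).
  by apply: eq_bigr => i _; rewrite !mxE distrC.
by lra.
Qed.

End convex_C1.

(** * The integral of a convex integrand *)

Lemma Rintegral_gt0 {d : measure_display} {X : measurableType d} {R : realType}
    (mu : {measure set X -> \bar R}) (D : set X) (f : X -> R) : measurable D ->
  (0 < mu D)%E -> integrableR mu D f -> (forall x, D x -> 0 < f x) ->
  0 < \int[mu]_(x in D) f x.
Proof.
move=> mD D0 If f0; rewrite lt_neqAle Rintegral_ge0 ?andbT; last by move=> x /f0/ltW.
apply/eqP => H.
have mf : measurable_fun D (EFin \o f) by exact: measurable_int If.
have H0 : (\int[mu]_(x in D) `|(EFin \o f) x|)%E = 0%E.
  rewrite (eq_integral (EFin \o f)); last first.
    by move=> x xD; rewrite gee0_abs// lee_fin ltW// f0//; exact: set_mem.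
  by rewrite -[LHS]fineK ?integrable_fin_num//; congr EFin.
have /(ae_eq_integral_abs mu mD mf) [N [mN N0 sN]] := H0.
have : D `<=` N.
  move=> x Dx; apply: sN => /= /(_ Dx) [] fx0; have := f0 x Dx.
  by rewrite fx0 ltxx.
move=> DN; move: D0; rewrite ltNge => /negP; apply; rewrite -N0.
by apply: le_measure => //; rewrite inE.
Qed.

(* Minimising over the unit sphere and using convexity along rays. *)
Lemma convex_coercive {R : realType} {n : nat} (G : 'rV[R]_n -> R) : continuous G ->
  (forall x y l, 0 <= l <= 1 -> G (l *: x + (1 - l) *: y) <= l * G x + (1 - l) * G y) ->
  (forall x, x != 0 -> G 0 < G x) ->
  exists2 c, 0 < c & forall x, 1 <= `|x| -> G 0 + c * `|x| <= G x.
Proof.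
move=> cG convG G0.
pose S := [set x : 'rV[R]_n | `|x| = 1].
have cS : compact S.
  apply: bounded_closed_compact.
    by exists 1; split; [exact: num_real|move=> M M1 x /= ->; exact: ltW].
  rewrite (_ : S = Num.norm @^-1` [set 1]); last by apply/seteqP; split.
  apply: closed_comp; first by move=> x _; exact: norm_continuous.
  exact: closed_eq.
have sphere x : 1 <= `|x| -> S (`|x|^-1 *: x).
  move=> x1; rewrite /S /= normrZ ger0_norm ?invr_ge0// mulVf// gt_eqF//.
  exact: lt_le_trans x1.
have [[x0 Sx0]|/set0P/negP/negPn/eqP S0] := pselect (S !=set0); last first.
  (* The sphere is empty only in dimension 0, where no [x] has norm at least 1. *)
  by exists 1 => // x /sphere; rewrite S0.
have neS : S !=set0 by exists x0.
have [c /set_mem Sc Hc] := EVT_min_rV neS cS (continuous_subspaceT cG).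
have c0 : c != 0 by apply: contra_eq_neq Sc => ->; rewrite normr0 eq_sym oner_eq0.
exists (G c - G 0); first by rewrite subr_gt0; exact: G0.
move=> x x1; have xp : 0 < `|x| by exact: lt_le_trans x1.
have := convG x 0 (`|x|^-1); rewrite invr_ge0 normr_ge0 invf_le1// x1 => /(_ isT).
rewrite scaler0 addr0 => H.
have := Hc _ (mem_set (sphere x x1)) => H2.
have : G c <= `|x|^-1 * G x + (1 - `|x|^-1) * G 0 by exact: le_trans H.
rewrite -(ler_pM2l xp) mulrDr !mulrA mulfV ?gt_eqF// mul1r mulrBr mulr1 mulfV ?gt_eqF//.
by lra.
Qed.

Section integral_functional.
Context {R : realType} {p n : nat}.
Context (T : 'rV[R]_p) (T0 : forall i, 0 < T ord0 i).
Context (F : 'rV[R]_p -> 'rV[R]_n -> R).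
Context (F_meas : forall x, measurable_fun (box T : set (lebRV R p))
                        ((fun t => F t x) : lebRV R p -> measurableTypeR R))
  (F_C1 : forall t, box T t -> Ck 1 (F t : 'rV[R]_n -> R^o))
  (F_convex : forall t, box T t -> strictly_convex (F t)).
Context (K B0 : R) (K0 : 0 <= K)
  (gradK : forall t, box T t -> forall x i, `|grad (F t) x ord0 i| <= K)
  (FB0 : forall t, box T t -> `|F t 0| <= B0).
Local Notation mu := (leb R p).
Local Notation D := (box T).
Local Notation I1 := (integrableR (leb R p) (box T)).
Let mD := measurable_box_leb T.
Let fD := leb_box_lty T.
Implicit Types u v : 'rV[R]_p -> 'rV[R]_n.

Definition mfun_rV u := forall i, measurable_fun (D : set (lebRV R p)) (fun t => u t ord0 i).

Lemma integrable_rV_mfun u : integrable_rV D u -> mfun_rV u.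
Proof. by move=> Iu i; exact: integrableR_mfun (Iu i). Qed.

Lemma mfun_comp u : mfun_rV u -> measurable_fun (D : set (lebRV R p)) (fun t => F t (u t)).
Proof.
move=> mu_; apply: (@measurable_fun_caratheodory R _ (lebRV R p) D mD n F u); [exact: F_meas| |exact: mu_].
by move=> t Dt; exact: continuous_C1 (F_C1 Dt).
Qed.

(** For fixed [x], the gradient is a limit of difference quotients measurable in [t]; it is
    continuous in [x], so it is a Caratheodory function. *)
Lemma mfun_grad u i : mfun_rV u ->
  measurable_fun (D : set (lebRV R p)) (fun t => grad (F t) (u t) ord0 i).
Proof.
move=> mu_; apply: (@measurable_fun_caratheodory R _ (lebRV R p) D mD n
  (fun t x => grad (F t) x ord0 i) u); [|by move=> t Dt; exact: continuous_grad (F_C1 Dt) i|exact: mu_].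
move=> x; apply: (measurable_fun_cvg (h := fun m (t : lebRV R p) =>
   m.+1%:R * (F t (x + m.+1%:R^-1 *: delta_mx ord0 i) - F t x))).
  move=> m; apply: measurable_funM; first exact: measurable_cst.
  by apply: measurable_funB; exact: F_meas.
move=> t Dt; have := @cvg_directional _ _ _ (F_C1 Dt) (F_convex Dt) x (1 *: delta_mx ord0 i).
by rewrite dotvZdelta mul1r scale1r.
Qed.

Lemma integrable_l1norm u : integrable_rV D u -> I1 (fun t => l1norm (u t)).
Proof. by move=> Iu; apply: integrableR_sum mD _ _ _ _ => i; apply: integrableR_norm; exact: Iu. Qed.

Lemma F_lipschitz t : D t -> forall x y, `|F t y - F t x| <= K * l1norm (y - x).
Proof.
by move=> Dt; apply: (lipschitz_l1norm (F_C1 Dt) (F_convex Dt)); exact: gradK.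
Qed.

Lemma integrable_F u : integrable_rV D u -> I1 (fun t => F t (u t)).
Proof.
move=> Iu; apply: (integrableR_le mD (g := fun t => B0 + K * l1norm (u t))).
- exact: mfun_comp (integrable_rV_mfun Iu).
- move=> t Dt; have := F_lipschitz Dt 0 (u t); rewrite subr0 => H.
  rewrite -[F t (u t)](subrK (F t 0)) addrC.
  by apply: le_trans (ler_normD _ _) _; apply: lerD => //; exact: FB0.
- apply: (integrableR_D mD); first exact: integrableR_cst.
  by apply: (integrableR_Z mD); exact: integrable_l1norm.
Qed.

Lemma integrable_grad u i : mfun_rV u -> I1 (fun t => grad (F t) (u t) ord0 i).
Proof.
by move=> mu_; apply: (integrableR_bnd mD fD (mfun_grad i mu_)) => t Dt; exact: gradK.
Qed.

Lemma sqint_grad u i : mfun_rV u -> sqint mu D (fun t => grad (F t) (u t) ord0 i).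
Proof.
by move=> mu_; apply: (sqint_bnd mD fD (mfun_grad i mu_)) => t Dt; exact: gradK.
Qed.

Lemma integrable_shift u (x : 'rV[R]_n) : integrable_rV D u -> integrable_rV D (fun t => x + u t).
Proof.
move=> Iu i; apply: (eq_integrableR mD (f := fun t => x ord0 i + u t ord0 i)).
  by move=> t _; rewrite mxE.
by apply: (integrableR_D mD); [exact: integrableR_cst|exact: Iu].
Qed.

Lemma integrable_cst_rV (x : 'rV[R]_n) : integrable_rV D (cst x).
Proof. by move=> i; exact: integrableR_cst. Qed.

Definition Phi u := \int[mu]_(t in D) F t (u t).

Lemma PhiE u : Phi u = \int[mu]_(t in D) F t (u t).
Proof. by []. Qed.

Lemma Phi_lipschitz u v : integrable_rV D u -> integrable_rV D v ->
  `|Phi u - Phi v| <= K * \int[mu]_(t in D) l1norm (u t - v t).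
Proof.
move=> Iu Iv; have IF := integrable_F Iu; have IF' := integrable_F Iv.
have Iuv : integrable_rV D (fun t => u t - v t).
  move=> i; apply: (eq_integrableR mD (f := fun t => u t ord0 i - v t ord0 i)).
    by move=> t _; rewrite !mxE.
  by apply: (integrableR_B mD); [exact: Iu|exact: Iv].
have Il := integrable_l1norm Iuv.
rewrite /Phi -RintegralB//.
apply: le_trans (le_normr_Rintegral mD (integrableR_B mD IF IF')) _.
rewrite -(RintegralZl K mD Il); apply: le_Rintegral => //.
- by apply: integrableR_norm; exact: (integrableR_B mD IF IF').
- exact: (integrableR_Z mD).
- by move=> t Dt; exact: F_lipschitz.
Qed.

Lemma integral_cst_box (c : R) : \int[mu]_(t in D) c = c * \prod_i T ord0 i.
Proof. by rewrite Rintegral_cst//= leb_box// => i; exact: ltW. Qed.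

Lemma Phi_cst_lipschitz u (x y : 'rV[R]_n) : integrable_rV D u ->
  `|Phi (fun t => y + u t) - Phi (fun t => x + u t)| <= K * \prod_i T ord0 i * l1norm (y - x).
Proof.
move=> Iu; apply: le_trans (Phi_lipschitz (integrable_shift _ Iu) (integrable_shift _ Iu)) _.
have -> : \int[mu]_(t in D) l1norm (y + u t - (x + u t)) = \int[mu]_(t in D) l1norm (y - x).
  by apply: eq_Rintegral => t _; rewrite opprD addrACA subrr addr0.
by rewrite integral_cst_box -mulrA [_ * l1norm _]mulrC.
Qed.

Lemma Phi_shift_continuous u : integrable_rV D u -> continuous (fun x : 'rV[R]_n => Phi (fun t => x + u t)).
Proof.
move=> Iu x; apply/(@cvgrPdist_le _ _ _ (nbhs x)) => e e0.
pose C := K * \prod_i T ord0 i * n%:R + 1.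
have C1 : 0 <= K * \prod_i T ord0 i * n%:R.
  by rewrite !mulr_ge0// prodr_ge0// => i _; exact: ltW.
have C0 : 0 < C by rewrite ltr_wpDl.
near=> y; apply: le_trans (Phi_cst_lipschitz _ _ Iu) _.
have xy : `|x - y| <= e / C by near: y; apply: cvgr_dist_le => //; rewrite divr_gt0.
have P0 : 0 <= K * \prod_i T ord0 i by rewrite mulr_ge0// prodr_ge0// => i _; exact: ltW.
apply: le_trans (ler_wpM2l P0 (l1norm_le_norm _)) _; rewrite mulrA.
apply: (@le_trans _ _ (C * `|x - y|)); first by rewrite ler_wpM2r// lerDl.
by rewrite mulrC -ler_pdivlMr.
Unshelve. all: by end_near. Qed.

Lemma Phi_convex u (x y : 'rV[R]_n) (l : R) : integrable_rV D u -> 0 <= l <= 1 ->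
  Phi (fun t => l *: x + (1 - l) *: y + u t) <=
  l * Phi (fun t => x + u t) + (1 - l) * Phi (fun t => y + u t).
Proof.
move=> Iu l01.
have Ix := integrable_F (integrable_shift x Iu); have Iy := integrable_F (integrable_shift y Iu).
rewrite /Phi -(RintegralZl l mD Ix) -(RintegralZl (1 - l) mD Iy) -RintegralD//; last 2 first.
- exact: (integrableR_Z mD).
- exact: (integrableR_Z mD).
apply: le_Rintegral => //.
- exact: integrable_F (integrable_shift _ Iu).
- by apply: (integrableR_D mD); exact: (integrableR_Z mD).
move=> t Dt; have -> : l *: x + (1 - l) *: y + u t = l *: (x + u t) + (1 - l) *: (y + u t).
  by apply/rowP => i; rewrite !mxE; ring.
exact: convex_le (F_convex Dt) _ _ _ l01.
Qed.

Lemma leb_box_gt0 : (0 < leb R p D)%E.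
Proof. by rewrite leb_box ?lte_fin ?prodr_gt0// => i; exact: ltW. Qed.

Lemma critical_coercive u : (0 < n)%N -> integrable_rV D u ->
  (forall i, \int[mu]_(t in D) grad (F t) (u t) ord0 i = 0) ->
  forall A : R, exists r : R, forall x : 'rV[R]_n, r <= enorm x -> A <= Phi (cst x).
Proof.
move=> n0 Iu crit.
pose G (x : 'rV[R]_n) := Phi (fun t => x + u t).
have G0 x : x != 0 -> G 0 < G x.
  move=> x0; rewrite /G /Phi -subr_gt0.
  have Ix := integrable_F (integrable_shift x Iu); have I0 := integrable_F (integrable_shift 0 Iu).
  have mu_ := integrable_rV_mfun Iu.
  have Ig i := integrable_grad i mu_.
  have Id : I1 (fun t => dotv (grad (F t) (u t)) x).
    apply: (integrableR_sum mD) => i.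
    apply: (eq_integrableR mD (f := fun t => x ord0 i * grad (F t) (u t) ord0 i)).
      by move=> t _; rewrite mulrC.
    exact: (integrableR_Z mD).
  have d0 : \int[mu]_(t in D) dotv (grad (F t) (u t)) x = 0.
    rewrite (integral_sumR mD); last first.
      move=> i; apply: (eq_integrableR mD (f := fun t => x ord0 i * grad (F t) (u t) ord0 i)).
        by move=> t _; rewrite mulrC.
      exact: (integrableR_Z mD).
    rewrite big1// => i _; under eq_Rintegral do rewrite mulrC.
    by rewrite (RintegralZl _ mD (Ig i)) crit mulr0.
  have IB := integrableR_B mD Ix I0.
  (* The integrand is the gap between [F t] and its tangent at [u t], positive by strict convexity;
     the tangent term integrates to 0. *)
  have : 0 < \int[mu]_(t in D) (F t (x + u t) - F t (0 + u t) - dotv (grad (F t) (u t)) x).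
    apply: (Rintegral_gt0 mD leb_box_gt0 (integrableR_B mD IB Id)) => t Dt.
    rewrite subr_gt0 add0r -[in dotv _ x](addrK (u t) x).
    apply: (grad_lt (F_C1 Dt) (F_convex Dt)) => E; move/eqP: x0; apply.
    by apply: (addIr (u t)); rewrite add0r -E.
  by rewrite (RintegralB mD IB Id) (RintegralB mD Ix I0) d0 subr0.
have [c c0 Hc] := convex_coercive (Phi_shift_continuous Iu)
  (fun x y l => @Phi_convex u x y l Iu) G0.
pose C := K * \int[mu]_(t in D) l1norm (u t).
have GC x : G x - C <= Phi (cst x).
  have := Phi_lipschitz (integrable_shift x Iu) (integrable_cst_rV x).
  have -> : \int[mu]_(t in D) l1norm (x + u t - cst x t) = \int[mu]_(t in D) l1norm (u t).
    by apply: eq_Rintegral => t _; rewrite addrAC subrr add0r.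
  by rewrite -/(G x) -/C ler_norml => /andP[_]; lra.
(* As [enorm x <= n |x|] for the supremum norm, this radius makes [|x|] at least 1, for the growth
   estimate to apply, and at least [|A + C - G 0| / c], for it to reach [A]. *)
move=> A; exists (n%:R * (1 + `|A + C - G 0| / c)) => x rx.
have xn : 1 + `|A + C - G 0| / c <= `|x|.
  rewrite -(@ler_pM2l _ n%:R) ?ltr0n//; apply: le_trans rx _.
  by apply: le_trans (enorm_le_l1norm x) _; exact: l1norm_le_norm.
have q0 : 0 <= `|A + C - G 0| / c by rewrite divr_ge0// ltW.
have := Hc x; rewrite -/(G 0) -/(G x) => H.
have x1 : 1 <= `|x| by lra.
have := H x1; have := GC x.
have : `|A + C - G 0| <= c * `|x|.
  by rewrite mulrC -ler_pdivrMr//; lra.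
have := ler_norm (A + C - G 0); lra.
Qed.

(** Take [s = 1 / (m + 1)], divide by [s] and let [m] tend to infinity, for [v] and for [- v]. The
    quadratic polynomial stands for the variation of the Dirichlet integral, so that no derivative
    of [u] appears; [c = b = 0] covers minima over constants. *)
Lemma euler_lagrange u v (c b : R) : integrable_rV D u -> integrable_rV D v ->
  (forall s : R, 0 <= c * s ^+ 2 + b * s + (Phi (fun t => u t + s *: v t) - Phi u)) ->
  b + \int[mu]_(t in D) dotv (grad (F t) (u t)) (v t) = 0.
Proof.
move=> Iu Iv H.
have one_sided (w : 'rV[R]_p -> 'rV[R]_n) (b' : R) : integrable_rV D w ->
    (forall s : R, 0 <= c * s ^+ 2 + b' * s + (Phi (fun t => u t + s *: w t) - Phi u)) ->
    0 <= b' + \int[mu]_(t in D) dotv (grad (F t) (u t)) (w t).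
  move=> Iw Hw.
  have Iuw (s : R) : integrable_rV D (fun t => u t + s *: w t).
    move=> i; apply: (eq_integrableR mD (f := fun t => u t ord0 i + s * w t ord0 i)).
      by move=> t _; rewrite !mxE.
    by apply: (integrableR_D mD); [exact: Iu|apply: (integrableR_Z mD); exact: Iw].
  pose q m t : R := m.+1%:R * (F t (u t + m.+1%:R^-1 *: w t) - F t (u t)).
  have Iq m : I1 (q m).
    by apply: (integrableR_Z mD); apply: (integrableR_B mD); exact: integrable_F.
  have mdot : measurable_fun (D : set (lebRV R p)) (fun t => dotv (grad (F t) (u t)) (w t)).
    apply: measurable_sum => i; apply: measurable_funM.
      exact: mfun_grad (integrable_rV_mfun Iu).
    exact: integrable_rV_mfun.
  have := @dominated_cvgR _ _ R mu D mD q (fun t => dotv (grad (F t) (u t)) (w t))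
    (fun t => K * l1norm (w t)) (fun m => integrableR_mfun (Iq m)) mdot.
  case.
  - by apply: aeW => t Dt; exact: (@cvg_directional _ _ _ (F_C1 Dt) (F_convex Dt)).
  - by apply: (integrableR_Z mD); exact: integrable_l1norm.
  - move=> m t Dt; rewrite /q normrM ger0_norm//.
    apply: le_trans (ler_wpM2l _ (F_lipschitz Dt _ _)) _ => //.
    rewrite addrAC subrr add0r mulrCA ler_wpM2l//.
    rewrite /l1norm mulr_sumr; apply: ler_sum => i _.
    by rewrite mxE normrM ger0_norm// mulrA mulfV ?mul1r.
  move=> _ cq.
  have lim : c * m.+1%:R^-1 + b' + \int[mu]_(t in D) q m t @[m --> \oo] -->
      c * 0 + b' + \int[mu]_(t in D) dotv (grad (F t) (u t)) (w t).
    apply: cvgD => //; apply: cvgD; last exact: cvg_cst.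
    by apply: cvgMr; exact: cvg_harmonic.
  have <- : limn (fun m => c * m.+1%:R^-1 + b' + \int[mu]_(t in D) q m t) =
      b' + \int[mu]_(t in D) dotv (grad (F t) (u t)) (w t).
    by rewrite (cvg_lim _ lim)// mulr0 add0r.
  apply: limr_ge; first exact: cvgP lim.
  apply: nearW => m; have := Hw m.+1%:R^-1.
  rewrite /q RintegralZl//; last by apply: (integrableR_B mD); exact: integrable_F.
  rewrite RintegralB//; [|exact: integrable_F..].
  rewrite -!/(Phi _); set X := Phi _ - Phi _ => HX.
  have m0 : 0 < m.+1%:R :> R by [].
  rewrite (_ : _ + _ = m.+1%:R * (c * m.+1%:R^-1 ^+ 2 + b' * m.+1%:R^-1 + X)).
    by rewrite mulr_ge0// ltW.
  by field; rewrite gt_eqF.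
have ge := one_sided v b Iv H.
have Iv' : integrable_rV D (fun t => - v t).
  move=> i; apply: (eq_integrableR mD (f := fun t => (-1) * v t ord0 i)).
    by move=> t _; rewrite !mxE mulN1r.
  by apply: (integrableR_Z mD); exact: Iv.
have H' (s : R) : 0 <= c * s ^+ 2 + - b * s + (Phi (fun t => u t + s *: - v t) - Phi u).
  have := H (- s); rewrite sqrrN mulrN mulNr.
  by rewrite (_ : (fun t => _) = (fun t => u t + s *: - v t))//; apply/funext => t; rewrite scaleNr scalerN.
have := one_sided _ _ Iv' H'.
have -> : \int[mu]_(t in D) dotv (grad (F t) (u t)) (- v t) =
    - \int[mu]_(t in D) dotv (grad (F t) (u t)) (v t).
  rewrite -mulN1r -RintegralZl//.
    apply: eq_Rintegral => t _; rewrite mulN1r /dotv -sumrN.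
    by apply: eq_bigr => i _; rewrite [X in _ * X]mxE mulrN.
  apply: (integrableR_le mD (g := fun t => K * l1norm (v t))).
  - apply: measurable_sum => i; apply: measurable_funM.
      exact: mfun_grad (integrable_rV_mfun Iu).
    exact: integrable_rV_mfun.
  - by move=> t Dt; apply: dotv_le_l1norm; exact: gradK.
  - by apply: (integrableR_Z mD); exact: integrable_l1norm.
lra.
Qed.

Lemma coercive_critical :
  (forall A : R, exists r : R, forall x : 'rV[R]_n, r <= enorm x -> A <= Phi (cst x)) ->
  exists x : 'rV[R]_n, forall i, \int[mu]_(t in D) grad (F t) x ord0 i = 0.
Proof.
move=> co; have [r Hr] := co (Phi (cst 0) + 1).
have cPhi : continuous (fun x : 'rV[R]_n => Phi (cst x)).
  rewrite (_ : (fun x => _) = fun x : 'rV[R]_n => Phi (fun t => x + cst 0 t)).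
    exact: Phi_shift_continuous (integrable_cst_rV 0).
  by apply/funext => x; congr (Phi _); apply/funext => t; rewrite /= addr0.
pose S := [set x : 'rV[R]_n | `|x| <= Num.max r 0].
have cS : compact S.
  apply: bounded_closed_compact.
    exists (Num.max r 0); split; first exact: num_real.
    by move=> M M1 x /= h; apply: le_trans h (ltW M1).
  rewrite (_ : S = Num.norm @^-1` [set y | y <= Num.max r 0]); last by apply/seteqP; split.
  apply: closed_comp; first by move=> x _; exact: norm_continuous.
  exact: closed_le.
have neS : S !=set0 by exists 0; rewrite /S /= normr0 le_max lexx orbT.
have [x /set_mem Sx Hx] := EVT_min_rV neS cS (continuous_subspaceT cPhi).
have xmin y : Phi (cst x) <= Phi (cst y).
  have [yS|yS] := leP `|y| (Num.max r 0); first by apply: Hx; exact: mem_set.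
  have y0 : Phi (cst x) <= Phi (cst 0) by apply: Hx; apply: mem_set; rewrite /S /= normr0 le_max lexx orbT.
  apply: (le_trans y0); apply: le_trans (Hr y _); first by rewrite lerDl.
  have ry : r <= `|y| by apply: le_trans (ltW yS); rewrite le_max lexx.
  apply: (le_trans ry); apply: rV_norm_le; first exact: enorm_ge0.
  by move=> i; exact: coord_le_enorm.
exists x => i.
have := @euler_lagrange (cst x) (cst (delta_mx ord0 i)) 0 0 (integrable_cst_rV _) (integrable_cst_rV _).
rewrite add0r => <-; first last.
  move=> s; rewrite !mul0r !add0r subr_ge0; exact: (xmin (x + s *: delta_mx ord0 i)).
apply: eq_Rintegral => t _.
by have := dotvZdelta (grad (F t) x) 1 i; rewrite scale1r mul1r.
Qed.

End integral_functional.

(** * Minimisation of the energy *)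

(** Young's inequality [L sqrt(M q) <= q / 4 + L^2 M]. The weight [1/4] spends half of the
    coefficient [1/2] of the Dirichlet integral in the energy. *)
Lemma mul_le_weighted (R : realFieldType) (L z q M : R) :
  0 <= L -> 0 <= z -> 0 <= q -> 0 <= M -> z ^+ 2 <= M * q ->
  L * z <= 4^-1 * q + L ^+ 2 * M.
Proof.
move=> L0 z0 q0 M0 zq.
have m0 : 0 <= 4^-1 * q + L ^+ 2 * M.
  by rewrite addr_ge0 ?mulr_ge0 ?invr_ge0 ?sqr_ge0.
rewrite -(ler_pXn2r (n:=2)) ?nnegrE// ?mulr_ge0//.
have := ler_wpM2l (sqr_ge0 L) zq.
rewrite exprMn => /le_trans; apply.
have := sqr_ge0 (4^-1 * q - L ^+ 2 * M); rewrite sqrrB sqrrD; lra.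
Qed.

Lemma natr_mul_sum (R : pzSemiRingType) n (c : R) : n%:R * c = \sum_(j < n) c.
Proof. by rewrite sumr_const card_ord mulr_natl. Qed.

Section dirichlet_form.
Context {R : realType} {p : nat}.
Context (T : 'rV[R]_p) (T0 : forall i, 0 < T ord0 i).
Local Notation mu := (leb R p).
Local Notation D := (box T).
Local Notation sqint := (sqint (leb R p) (box T)).
Local Notation trig := (trig T).
Local Notation trig0 := (trig0 T).
Local Notation grad2 := (grad2 T).
Let mD := measurable_box_leb T.
Let fD := leb_box_lty T.
Implicit Types f g h : 'rV[R]_p -> R.

Lemma sqint_pd i f : trig f -> sqint (pd i f).
Proof. by move=> tf; apply: trig_sqint; exact: trig_pd. Qed.

Lemma grad2_ge0 f : 0 <= grad2 f f.
Proof. by apply: sumr_ge0 => i _; exact: nrm2_ge0. Qed.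

Lemma grad2_midpoint f g : trig f -> trig g ->
  grad2 (fun t => 2^-1 * f t + 2^-1 * g t) (fun t => 2^-1 * f t + 2^-1 * g t) =
  2^-1 * grad2 f f + 2^-1 * grad2 g g -
    4^-1 * grad2 (fun t => f t - g t) (fun t => f t - g t).
Proof.
move=> tf tg; rewrite !grad2E !mulr_sumr -big_split -sumrB; apply: eq_bigr => i _.
rewrite (pdD i (trigZ _ tf) (trigZ _ tg)) (pdZ i _ tf) (pdZ i _ tg) (pdB i tf tg).
exact (nrm2_midpoint mD (sqint_pd i tf) (sqint_pd i tg)).
Qed.

Lemma pd_cstD i a f : trig f -> pd i (fun t => a + f t) = pd i f.
Proof.
move=> tf; have H := pdD i (trig_cst T a) tf.
by rewrite [LHS]H pd_cst; apply/funext => t; rewrite add0r.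
Qed.

Lemma grad2_cstD a f : trig f -> grad2 (fun t => a + f t) (fun t => a + f t) = grad2 f f.
Proof. by move=> tf; apply: eq_bigr => i _; rewrite pd_cstD. Qed.

(** Cauchy-Schwarz, Poincare and Young. In [energy_lower], [L] is the Lipschitz constant of the
    integrand. *)
Lemma L1_le_grad2 (L : R) f : trig0 f -> 0 <= L ->
  L * \int[mu]_(t in D) `|f t| <=
  4^-1 * grad2 f f + L ^+ 2 * (\prod_i T ord0 i * cP T).
Proof.
move=> tf L0; have st := trig_sqint (trig0_trig tf).
set z := \int[mu]_(t in D) `|f t|.
have z0 : 0 <= z by exact: Rintegral_ge0.
have V0 : 0 <= \prod_i T ord0 i by apply: prodr_ge0 => i _; exact: ltW.
have H1 := integral_norm_le mD fD st; rewrite leb_box/= in H1; last by move=> i; exact: ltW.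
have H2 := poincare T0 tf.
have zq : z ^+ 2 <= \prod_i T ord0 i * cP T * grad2 f f.
  by apply: (le_trans H1); rewrite -mulrA ler_wpM2l.
exact (mul_le_weighted L0 z0 (grad2_ge0 f) (mulr_ge0 V0 (cP_ge0 T)) zq).
Qed.

End dirichlet_form.

Section minimisation.
Context {R : realType} {p n : nat}.
Context (T : 'rV[R]_p) (T0 : forall i, 0 < T ord0 i).
Context (F : 'rV[R]_p -> 'rV[R]_n -> R).
Context (F_meas : forall x, measurable_fun (box T : set (lebRV R p))
                        ((fun t => F t x) : lebRV R p -> measurableTypeR R))
  (F_C1 : forall t, box T t -> Ck 1 (F t : 'rV[R]_n -> R^o))
  (F_convex : forall t, box T t -> strictly_convex (F t)).
Context (K B0 : R) (K0 : 0 <= K)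
  (gradK : forall t, box T t -> forall x i, `|grad (F t) x ord0 i| <= K)
  (FB0 : forall t, box T t -> `|F t 0| <= B0).
Context (co : forall A : R, exists r : R, forall x : 'rV[R]_n, r <= enorm x -> A <= Phi T F (cst x)).
Local Notation mu := (leb R p).
Local Notation D := (box T).
Local Notation sqint := (sqint (leb R p) (box T)).
Local Notation trig := (trig T).
Local Notation trig0 := (trig0 T).
Local Notation grad2 := (grad2 T).
Local Notation Phi := (Phi T F).
Local Notation V := (\prod_i T ord0 i).
Let mD := measurable_box_leb T.
Let fD := leb_box_lty T.
Implicit Types u v w : 'I_n -> 'rV[R]_p -> R.

Definition vec u : 'rV[R]_p -> 'rV[R]_n := fun t => \row_j u j t.

(** The derivatives are the classical ones: the energy is used on trigonometric polynomials only,
    not on their limits. *)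
Definition energy u : R := 2^-1 * \sum_j grad2 (u j) (u j) + Phi (vec u).

Lemma energyE u : energy u = 2^-1 * \sum_j grad2 (u j) (u j) + Phi (vec u).
Proof. by []. Qed.

Lemma integrable_vec u : (forall j, sqint (u j)) -> integrable_rV D (vec u).
Proof.
move=> su j; apply: (eq_integrableR mD (f := u j)); first by move=> t _; rewrite mxE.
exact: (sqint_integrable mD fD).
Qed.

Lemma Phi_vec_lipschitz u v : (forall j, sqint (u j)) -> (forall j, sqint (v j)) ->
  `|Phi (vec u) - Phi (vec v)| <= K * \sum_j \int[mu]_(t in D) `|u j t - v j t|.
Proof.
move=> su sv.
have := Phi_lipschitz F_meas F_C1 F_convex gradK FB0 (integrable_vec su) (integrable_vec sv).
have -> : \int[mu]_(t in D) l1norm (vec u t - vec v t) = \sum_j \int[mu]_(t in D) `|u j t - v j t|.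
  rewrite -(integral_sumR mD); last first.
    move=> j; apply: integrableR_norm; apply: (integrableR_B mD).
    - exact: (sqint_integrable mD fD (su j)).
    - exact: (sqint_integrable mD fD (sv j)).
  by apply: eq_Rintegral => t _; apply: eq_bigr => j _; rewrite !mxE.
by [].
Qed.

(** The parallelogram identity for the Dirichlet part and convexity for the rest; [1/8] is the [1/4]
    of the identity times the coefficient [1/2]. *)
Lemma energy_midpoint u v : (forall j, trig (u j)) -> (forall j, trig (v j)) ->
  energy (fun j t => 2^-1 * u j t + 2^-1 * v j t) <=
  2^-1 * energy u + 2^-1 * energy v -
    8^-1 * \sum_j grad2 (fun t => u j t - v j t) (fun t => u j t - v j t).
Proof.
move=> tu tv; rewrite /energy.
rewrite (eq_bigr (fun j => 2^-1 * grad2 (u j) (u j) + 2^-1 * grad2 (v j) (v j) -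
   4^-1 * grad2 (fun t => u j t - v j t) (fun t => u j t - v j t))); last first.
  by move=> j _; exact: grad2_midpoint.
rewrite sumrB big_split/= -!mulr_sumr.
have Iu := integrable_vec (fun j => trig_sqint (tu j)).
have Iv := integrable_vec (fun j => trig_sqint (tv j)).
have IF := integrable_F F_meas F_C1 F_convex gradK FB0.
have : Phi (vec (fun j t => 2^-1 * u j t + 2^-1 * v j t)) <= 2^-1 * Phi (vec u) + 2^-1 * Phi (vec v).
  rewrite !PhiE -(RintegralZl _ mD (IF _ Iu)) -(RintegralZl _ mD (IF _ Iv)).
  rewrite -(RintegralD mD (integrableR_Z mD _ (IF _ Iu)) (integrableR_Z mD _ (IF _ Iv))).
  apply: (le_Rintegral mD).
  - apply: IF; apply: integrable_vec => j; apply: trig_sqint.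
    exact: trigD (trigZ _ (tu j)) (trigZ _ (tv j)).
  - exact: (integrableR_D mD (integrableR_Z mD _ (IF _ Iu)) (integrableR_Z mD _ (IF _ Iv))).
  move=> t Dt; have h : 0 <= (2^-1 : R) <= 1 by apply/andP; split; lra.
  have := convex_le (F_convex Dt) (vec u t) (vec v t) h.
  rewrite (_ : 1 - 2^-1 = 2^-1 :> R); last by field.
  rewrite (_ : _ + _ = vec (fun j t => 2^-1 * u j t + 2^-1 * v j t) t)//.
  by apply/rowP => j; rewrite !mxE.
lra.
Qed.

(** Replacing [x + u] by [x] in the potential costs at most the L^1 norm of [u] times [K], which
    half of the Dirichlet part absorbs up to a constant. *)
Lemma energy_lower (x : 'rV[R]_n) u : (forall j, trig0 (u j)) ->
  4^-1 * \sum_j grad2 (u j) (u j) + Phi (cst x) - n%:R * (K ^+ 2 * (V * cP T)) <=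
  energy (fun j t => x ord0 j + u j t).
Proof.
move=> tu; rewrite /energy.
have tu' j := trig0_trig (tu j).
have tx j := trig_cst T (x ord0 j).
have -> : \sum_j grad2 (fun t => x ord0 j + u j t) (fun t => x ord0 j + u j t) =
    \sum_j grad2 (u j) (u j).
  by apply: eq_bigr => j _; exact: (grad2_cstD _ (tu' j)).
have := @Phi_vec_lipschitz (fun j => cst (x ord0 j)) (fun j t => x ord0 j + u j t)
  (fun j => trig_sqint (tx j)) (fun j => trig_sqint (trigD (tx j) (tu' j))).
rewrite (_ : vec (fun j => cst (x ord0 j)) = cst x); last first.
  by apply/funext => t; apply/rowP => j; rewrite mxE.
rewrite (eq_bigr (fun j => \int[mu]_(t in D) `|u j t|)); last first.
  by move=> j _; apply: eq_Rintegral => t _; rewrite opprD addrA subrr add0r normrN.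
rewrite mulr_sumr => H.
have H2 : \sum_j K * \int[mu]_(t in D) `|u j t| <=
    4^-1 * \sum_j grad2 (u j) (u j) + n%:R * (K ^+ 2 * (V * cP T)).
  rewrite mulr_sumr natr_mul_sum -big_split/=.
  by apply: ler_sum => j _; exact: L1_le_grad2.
by move: H; rewrite ler_norml => /andP[_ H]; lra.
Qed.

(** Nonnegative far out by coercivity, Lipschitz on the ball that remains. *)
Lemma Phi_cst_bounded_below : exists m : R, forall x : 'rV[R]_n, m <= Phi (cst x).
Proof.
have [x Hx] := coercive_critical T0 F_meas F_C1 F_convex K0 gradK FB0 co.
have [r Hr] := co 0.
pose C := K * V * (n%:R * `|r|).
exists (Num.min 0 (Phi (cst 0) - C)) => y.
have [ry|yr] := leP r (enorm y); first by rewrite ge_min Hr.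
have V0 : 0 <= V by apply: prodr_ge0 => i _; exact: ltW.
have := Phi_cst_lipschitz T0 F_meas F_C1 F_convex gradK FB0 0 y (integrable_cst_rV T (0 : 'rV[R]_n)).
rewrite (_ : (fun t => y + _) = cst y); last by apply/funext => t; rewrite /= addr0.
rewrite (_ : (fun t => 0 + _) = cst 0); last by apply/funext => t; rewrite /= addr0.
rewrite subr0 => H.
have : K * V * l1norm y <= C.
  rewrite /C ler_wpM2l ?mulr_ge0// /l1norm natr_mul_sum.
  apply: ler_sum => j _; apply: le_trans (coord_le_enorm y j) _.
  by apply: ltW; apply: (lt_le_trans yr); exact: ler_norm.
rewrite ge_min; move: H; rewrite ler_norml => /andP[H _] H'; apply/orP; right; lra.
Qed.

(* The constant parts of a minimising sequence stay bounded by coercivity; they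
   are frozen at a cluster point, which perturbs the energy by [O(8^-m)]. *)
Lemma minimising_sequence : exists (I C : R) (x : 'rV[R]_n) (g : nat -> 'I_n -> 'rV[R]_p -> R),
  [/\ forall u, (forall j, trig (u j)) -> I <= energy u, forall m j, trig0 (g m j) &
   forall m, energy (fun j t => x ord0 j + g m j t) <= I + C * 8^-1 ^+ m].
Proof.
have [m0 Hm0] := Phi_cst_bounded_below.
pose E := [set energy u | u in [set u | forall j, trig (u j)]].
have splt u : (forall j, trig (u j)) -> exists (c : 'rV[R]_n) g,
    (forall j, trig0 (g j)) /\ u = (fun j t => c ord0 j + g j t).
  move=> tu; have H j := cid (trig_split (tu j)).
  pose c := \row_j projT1 (H j); have Hg j := cid (projT2 (H j)).
  exists c, (fun j => projT1 (Hg j)); split; first by move=> j; exact: (projT2 (Hg j)).1.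
  by apply/funext => j; rewrite [LHS](projT2 (Hg j)).2 /c mxE.
have V0 : 0 <= V by apply: prodr_ge0 => i _; exact: ltW.
pose Q := n%:R * (K ^+ 2 * (V * cP T)).
have hE : has_inf E.
  split; first by exists (energy (fun=> cst 0)), (fun=> cst 0) => // j; exact: trig_cst.
  exists (m0 - Q) => _ [u /splt[c [g [tg ->]]] <-].
  apply: le_trans (energy_lower c tg); rewrite lerD2r; apply: le_trans (Hm0 c) _.
  by rewrite lerDr mulr_ge0// sumr_ge0// => j _; exact: grad2_ge0.
have infE u : (forall j, trig (u j)) -> inf E <= energy u.
  by move=> tu; apply: ge_inf; [exact: hE.2|exists u].
have e0 k : 0 < 8^-1 ^+ k :> R by rewrite exprn_gt0.
have exk k : exists c g, (forall j, trig0 (g j)) /\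
    energy (fun j t => (c : 'rV[R]_n) ord0 j + g j t) <= inf E + 8^-1 ^+ k.
  have [_ [u tu <-] lu] := inf_adherent (e0 k) hE.
  by have [c [g [tg Eu]]] := splt u tu; exists c, g; split => //; rewrite -Eu; exact: ltW.
pose c k := projT1 (cid (exk k)); have exg k := cid (projT2 (cid (exk k))).
pose g k := projT1 (exg k).
have tg k : forall j, trig0 (g k j) := (projT2 (exg k)).1.
have lg k : energy (fun j t => c k ord0 j + g k j t) <= inf E + 8^-1 ^+ k := (projT2 (exg k)).2.
(* A constant part beyond radius [r] would make the energy at least [inf E + 2], as [energy_lower]
   loses [Q], whereas it is at most [inf E + 8^-k]. *)
have [r Hr] := co (inf E + 2 + Q).
have ck k : `|c k| <= `|r|.
  apply: rV_norm_le => // i; apply: le_trans (coord_le_enorm _ i) _.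
  apply: le_trans (ler_norm r); rewrite leNgt; apply/negP => /ltW/Hr H.
  have := energy_lower (c k) (tg k); have := lg k; have /andP[_] := eighth_le1 R k.
  have : 0 <= 4^-1 * \sum_j grad2 (g k j) (g k j).
    by rewrite mulr_ge0// sumr_ge0// => j _; exact: grad2_ge0.
  by rewrite -/Q; lra.
pose S := [set x : 'rV[R]_n | `|x| <= `|r|].
have cS : compact S.
  apply: bounded_closed_compact.
    exists `|r|; split; first exact: num_real.
    by move=> M M1 x /= h; apply: le_trans h (ltW M1).
  rewrite (_ : S = Num.norm @^-1` [set y | y <= `|r|]); last by apply/seteqP; split.
  apply: closed_comp; first by move=> x _; exact: norm_continuous.
  exact: closed_le.
have cS' : (c @ \oo) S by exists 0%N => // k _; exact: ck.
have [x [_ clx]] := cS (c @ \oo) _ cS'.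
(* A cluster point is approached at arbitrarily late indices; [m <= k] keeps the excess energy below
   [8^-m]. *)
have sub m : exists k, (m <= k)%N /\ `|c k - x| <= 8^-1 ^+ m.
  have tail : (c @ \oo) [set y | exists2 k, (m <= k)%N & y = c k].
    by exists m => // k mk; exists k.
  have nb : nbhs x [set y | `|y - x| <= 8^-1 ^+ m].
    apply: filterS (nbhsx_ballx x _ (e0 m)) => y.
    by rewrite -ball_normE /= distrC => /ltW.
  by have [y [[k mk ->] yx]] := clx _ _ tail nb; exists k.
pose s m := projT1 (cid (sub m)).
have sm m : (m <= s m)%N := (projT2 (cid (sub m))).1.
have cx m : `|c (s m) - x| <= 8^-1 ^+ m := (projT2 (cid (sub m))).2.
(* 1 for the excess energy, the rest for moving each coordinate of the constant part by at most
   [8^-m]. *)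
pose C := 1 + K * (n%:R * V).
exists (inf E), C, x, (fun m => g (s m)); split => //.
move=> m; have le8 : 8^-1 ^+ s m <= 8^-1 ^+ m :> R.
  by apply: ler_wiXn2l => //; lra.
have tc j : trig (fun t => x ord0 j + g (s m) j t).
  exact: trigD (trig_cst T _) (trig0_trig (tg _ j)).
have tc' j : trig (fun t => c (s m) ord0 j + g (s m) j t).
  exact: trigD (trig_cst T _) (trig0_trig (tg _ j)).
have := Phi_vec_lipschitz (fun j => trig_sqint (tc j)) (fun j => trig_sqint (tc' j)).
have : \sum_j \int[mu]_(t in D) `|x ord0 j + g (s m) j t - (c (s m) ord0 j + g (s m) j t)| <=
    n%:R * V * 8^-1 ^+ m.
  rewrite -mulrA natr_mul_sum; apply: ler_sum => j _.
  rewrite (eq_Rintegral _ (g := cst `|x ord0 j - c (s m) ord0 j|)); last first.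
    by move=> t _ /=; rewrite opprD addrACA subrr addr0.
  rewrite (integral_cst_box T0) mulrC ler_wpM2l//; apply: le_trans (cx m).
  by apply: le_trans (rV_coord_le _ j); rewrite !mxE distrC.
have eqg : \sum_j grad2 (fun t => x ord0 j + g (s m) j t) (fun t => x ord0 j + g (s m) j t) =
    \sum_j grad2 (fun t => c (s m) ord0 j + g (s m) j t) (fun t => c (s m) ord0 j + g (s m) j t).
  by apply: eq_bigr => j _; rewrite !(grad2_cstD _ (trig0_trig (tg (s m) j))).
move=> H2 H; have H3 := le_trans (ler_norm _) (le_trans H (ler_wpM2l K0 H2)).
rewrite /energy eqg /C mulrDl mul1r -[K * _ * _]mulrA addrA -lerBlDr.
apply: le_trans (le_trans (lg (s m)) _); last by rewrite lerD2l.
by rewrite /energy -addrA lerD2l lerBlDr addrC -lerBlDr.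
Qed.

End minimisation.

(** * Regularity of weak solutions *)

Lemma cvg_le0 (R : realType) (a b : nat -> R) : (forall k, 0 <= a k <= b k) ->
  b k @[k --> \oo] --> 0 -> a k @[k --> \oo] --> 0.
Proof.
move=> ab b0; apply: (squeeze_cvgr _ (@cvg_cst _ 0 _ _ _) b0); exact: nearW.
Qed.

Lemma cvg_le2 (R : realType) (a b c : nat -> R) : (forall k, 0 <= a k <= 2 * b k + 2 * c k) ->
  b k @[k --> \oo] --> 0 -> c k @[k --> \oo] --> 0 -> a k @[k --> \oo] --> 0.
Proof.
move=> abc b0 c0; apply: (cvg_le0 abc).
rewrite -[X in _ --> X](addr0 0) -[X in _ --> X + X](mulr0 2).
by apply: cvgD; apply: cvgMr.
Qed.

Section regularity.
Context {R : realType} {p : nat}.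
Context (T : 'rV[R]_p) (T0 : forall i, 0 < T ord0 i).
Local Notation mu := (leb R p).
Local Notation D := (box T).
Local Notation ip := (ip (leb R p) (box T)).
Local Notation nrm2 := (nrm2 (leb R p) (box T)).
Local Notation sqint := (sqint (leb R p) (box T)).
Local Notation trig := (trig T).
Local Notation trig0 := (trig0 T).
Local Notation grad2 := (grad2 T).
Let mD := measurable_box_leb T.
Let fD := leb_box_lty T.
Implicit Types f g h : 'rV[R]_p -> R.

Lemma nrm2_self f : sqint f -> nrm2 (fun t => f t - f t) = 0.
Proof.
move=> sf; apply: (nrm2_0 mD); last exact: sqintB.
by apply: nearW => t _; rewrite subrr.
Qed.

Lemma nrm2_cst_cvg f : sqint f -> nrm2 (fun t => f t - f t) @[k --> \oo] --> 0.
Proof. by move=> sf; rewrite (nrm2_self sf); exact: cvg_cst. Qed.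

Lemma ip_cvg_l (f : nat -> 'rV[R]_p -> R) g h : (forall k, sqint (f k)) -> sqint g -> sqint h ->
  nrm2 (fun t => f k t - g t) @[k --> \oo] --> 0 -> ip (f k) h @[k --> \oo] --> ip g h.
Proof.
move=> sf sg sh fg.
exact: (@ip_cvg _ _ _ mu D mD f (fun=> h) g h sf (fun=> sh) sg sh fg (nrm2_cst_cvg sh)).
Qed.

Lemma nrm2_pd_le_grad2 i f : nrm2 (pd i f) <= grad2 f f.
Proof.
rewrite !grad2E (bigD1 i)//= lerDl sumr_ge0// => j _; exact: nrm2_ge0.
Qed.

(** By Poincare's inequality, control of the gradients also gives control of the functions. *)
Lemma trig0_fast_cvg (g : nat -> 'rV[R]_p -> R) (C : R) : (forall k, trig0 (g k)) ->
  (forall k, grad2 (fun t => g k.+1 t - g k t) (fun t => g k.+1 t - g k t) <= C * 8^-1 ^+ k) ->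
  exists h (dh : 'I_p -> 'rV[R]_p -> R),
    [/\ sqint h, forall i, sqint (dh i),
        nrm2 (fun t => g k t - h t) @[k --> \oo] --> 0 &
        forall i, nrm2 (fun t => pd i (g k) t - dh i t) @[k --> \oo] --> 0].
Proof.
move=> tg gC; have tg' k := trig0_trig (tg k).
have [h [sh gh _]] : exists h, [/\ sqint h, nrm2 (fun t => g k t - h t) @[k --> \oo] --> 0 &
    {ae mu, forall t, D t -> g k t @[k --> \oo] --> h t}].
  apply: (L2_fast_complete mD (C := cP T * C)) => k; first exact: trig_sqint.
  apply: le_trans (poincare T0 (trig0B (tg _) (tg _))) _.
  by rewrite -mulrA ler_wpM2l ?cP_ge0.
have dg i : exists dh, [/\ sqint dh, nrm2 (fun t => pd i (g k) t - dh t) @[k --> \oo] --> 0 &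
    {ae mu, forall t, D t -> pd i (g k) t @[k --> \oo] --> dh t}].
  apply: (L2_fast_complete mD (C := C)) => k; first exact: sqint_pd.
  have := gC k; apply: le_trans; apply: le_trans (nrm2_pd_le_grad2 i _).
  by rewrite (pdB i (tg' _) (tg' _)).
exists h, (fun i => projT1 (cid (dg i))); split => // i.
  by have [] := projT2 (cid (dg i)).
by have [] := projT2 (cid (dg i)).
Qed.

(** Constants are orthogonal to [r k - f], so dropping the constant term of an approximation does
    not increase its distance to [f]. *)
Lemma trig0_dense f : sqint f -> \int[mu]_(t in D) f t = 0 ->
  exists r : nat -> 'rV[R]_p -> R,
    (forall k, trig0 (r k)) /\ forall k, nrm2 (fun t => r k t - f t) <= 8^-1 ^+ k.
Proof.
move=> sf f0; have [q [tq qf]] := trig_dense T0 sf.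
have H k := cid (trig_split (tq k)); have H' k := cid (projT2 (H k)).
pose c k := projT1 (H k); pose r k := projT1 (H' k).
have tr k : trig0 (r k) := (projT2 (H' k)).1.
have qE k : q k = fun t => c k + r k t := (projT2 (H' k)).2.
exists r; split => // k; apply: le_trans (qf k).
have sr := trig_sqint (trig0_trig (tr k)); have srf := sqintB mD sr sf.
have sc : sqint (cst (c k)) := trig_sqint (trig_cst T (c k)).
have -> : (fun t => q k t - f t) = fun t => cst (c k) t + (r k t - f t).
  by apply/funext => t; rewrite qE addrA.
rewrite (nrm2D mD sc srf).
have -> : ip (cst (c k)) (fun t => r k t - f t) = 0.
  rewrite ipE (RintegralZl _ mD (sqint_integrable mD fD srf)).
  have -> : \int[mu]_(t in D) (r k t - f t) =
      \int[mu]_(t in D) r k t - \int[mu]_(t in D) f t.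
    exact (RintegralB mD (sqint_integrable mD fD sr) (sqint_integrable mD fD sf)).
  by rewrite f0 (integral_trig0 T0 (tr k)) subrr mulr0.
by rewrite mulr0 addr0 lerDr nrm2_ge0.
Qed.

(* A weak solution [h] of [lap h = f] obtained as a limit of trigonometric
   polynomials is also the limit of the explicit solutions [y k] of
   [lap (y k) = r k], where [r k] tends to [f]; for these, all second derivatives
   are controlled by the Laplacian. *)
Lemma weak_solution_regular (g : nat -> 'rV[R]_p -> R) h dh f :
  (forall k, trig0 (g k)) -> sqint h -> (forall i, sqint (dh i)) -> sqint f ->
  nrm2 (fun t => g k t - h t) @[k --> \oo] --> 0 ->
  (forall i, nrm2 (fun t => pd i (g k) t - dh i t) @[k --> \oo] --> 0) ->
  (forall v, trig v -> \sum_i ip (dh i) (pd i v) + ip f v = 0) ->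
  exists (y : nat -> 'rV[R]_p -> R) (C : R),
    [/\ forall k, trig0 (y k),
        nrm2 (fun t => y k t - h t) @[k --> \oo] --> 0,
        (forall i, nrm2 (fun t => pd i (y k) t - dh i t) @[k --> \oo] --> 0) /\
        nrm2 (fun t => lap (y k) t - f t) @[k --> \oo] --> 0,
        (forall k, nrm2 (fun t => y k.+1 t - y k t) <= C * 8^-1 ^+ k) /\
        (forall k i, nrm2 (fun t => pd i (y k.+1) t - pd i (y k) t) <= C * 8^-1 ^+ k) &
        forall k i j, nrm2 (fun t => pd i (pd j (y k.+1)) t - pd i (pd j (y k)) t) <= C * 8^-1 ^+ k].
Proof.
move=> tg sh sdh sf gh gdh weak; have tg' k := trig0_trig (tg k).
(* Testing against 1 yields the condition under which the Laplacian can be inverted. *)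
have f0 : \int[mu]_(t in D) f t = 0.
  have := weak _ (trig_cst T 1); rewrite big1 ?add0r => [|i _].
    rewrite ipE => <-; apply: eq_Rintegral => t _; by rewrite mulr1.
  rewrite pd_cst ipC ipE -[RHS](mul0r (fine (mu D))) -Rintegral_cst//.
  by apply: eq_Rintegral => t _; rewrite mul0r.
have [r [tr rf]] := trig0_dense sf f0.
have H k := cid2 (trig0_lap_inv T0 (tr k)); pose y k := s2val (H k).
have ty k : trig0 (y k) := s2valP (H k).
have ty' k := trig0_trig (ty k); have tr' k := trig0_trig (tr k).
have lapy k : lap (y k) = r k := s2valP' (H k).
pose d k t := y k.+1 t - y k t.
have td k : trig0 (d k) := trig0B (ty _) (ty _).
have td' k := trig0_trig (td k).
have pdd k i : pd i (d k) = fun t => pd i (y k.+1) t - pd i (y k) t := pdB i (ty' _) (ty' _).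
have pdpdd k i j : pd i (pd j (d k)) = fun t => pd i (pd j (y k.+1)) t - pd i (pd j (y k)) t.
  by rewrite pdd; exact (pdB i (trig_pd j (ty' k.+1)) (trig_pd j (ty' k))).
(* [2 (8^-(k+1) + 8^-k) <= 4 * 8^-k]. *)
have d2 k i j : nrm2 (pd i (pd j (d k))) <= 4 * 8^-1 ^+ k.
  apply: le_trans (nrm2_pd_pd_le T0 i j (td' k)) _.
  have -> : lap (d k) = fun t => r k.+1 t - r k t.
    rewrite -!lapy; apply/funext => t; rewrite /lap -sumrB; apply: eq_bigr => a _.
    by rewrite pdpdd.
  apply: le_trans (nrm2_triangle mD (trig_sqint (tr' _)) sf (trig_sqint (tr' _))) _.
  rewrite (nrm2BC mu D f (r k)).
  have := rf k; have := rf k.+1; rewrite exprS => H1 H2.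
  have : 0 <= 8^-1 ^+ k :> R by rewrite exprn_ge0.
  by lra.
(* Derivatives keep the frequency 0 absent, so Poincare's inequality descends from the second
   derivatives to the first, then to the functions. *)
have gpd k i : grad2 (pd i (d k)) (pd i (d k)) <= (4 * p%:R) * 8^-1 ^+ k.
  rewrite [4 * _]mulrC -mulrA natr_mul_sum; apply: ler_sum => a _; exact: d2.
have d1 k i : nrm2 (pd i (d k)) <= cP T * (4 * p%:R) * 8^-1 ^+ k.
  apply: le_trans (poincare T0 (trig0_pd i (td k))) _.
  by rewrite -mulrA ler_wpM2l ?cP_ge0.
have gd k : grad2 (d k) (d k) <= p%:R * (cP T * (4 * p%:R)) * 8^-1 ^+ k.
  by rewrite -mulrA natr_mul_sum; apply: ler_sum => a _; exact: d1.
have d0 k : nrm2 (d k) <= cP T * (p%:R * (cP T * (4 * p%:R))) * 8^-1 ^+ k.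
  apply: le_trans (poincare T0 (td k)) _.
  by rewrite -mulrA ler_wpM2l ?cP_ge0.
have [z [dz [sz sdz yz ydz]]] := trig0_fast_cvg ty gd.
have rf0 : nrm2 (fun t => r k t - f t) @[k --> \oo] --> 0.
  apply: (cvg_le0 _ (cvg_eighth 1)).
  by move=> k; rewrite nrm2_ge0 mul1r; exact: rf.
have weak' v : trig v -> \sum_i ip (dz i) (pd i v) + ip f v = 0.
  move=> tv; have sv := trig_sqint tv.
  have : \sum_i ip (pd i (y k)) (pd i v) + ip (r k) v @[k --> \oo] -->
      \sum_i ip (dz i) (pd i v) + ip f v.
    apply: cvgD.
      apply: cvg_sumr => i.
      by apply: ip_cvg_l => //; [move=> k; exact: sqint_pd|exact: sqint_pd].
    by apply: ip_cvg_l => // k; exact: trig_sqint.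
  move=> /cvg_lim <-//; apply: cvg_lim => //.
  rewrite (_ : (fun k => _) = cst 0); first exact: cvg_cst.
  by apply/funext => k; rewrite -lapy (ip_lap T0 (ty' k) tv) subrr.
have sB i := sqintB mD (sdh i) (sdz i).
pose e k t := g k t - y k t.
have te k : trig0 (e k) := trig0B (tg _) (ty _).
have pde k i : pd i (e k) = fun t => pd i (g k) t - pd i (y k) t := pdB i (tg' _) (ty' _).
have eB i : nrm2 (fun t => pd i (e k) t - (dh i t - dz i t)) @[k --> \oo] --> 0.
  apply: (cvg_le2 _ (gdh i) (ydz i)).
  move=> k; rewrite nrm2_ge0/=.
  have := nrm2_addle mD (sqintB mD (sqint_pd i (tg' k)) (sdh i)) (sqintB mD (sdz i) (sqint_pd i (ty' k))).
  rewrite (nrm2BC mu D (dz i)).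
  apply: le_trans; rewrite le_eqVlt; apply/orP; left; apply/eqP; congr (nrm2 _).
  by apply/funext => t; rewrite pde; ring.
(* Uniqueness: both limits satisfy the same weak equation, and the difference of the two is tested
   with [e k], whose gradient tends to [dh - dz]. *)
have B0 : \sum_i nrm2 (fun t => dh i t - dz i t) = 0.
  have : \sum_i ip (fun t => dh i t - dz i t) (pd i (e k)) @[k --> \oo] -->
      \sum_i nrm2 (fun t => dh i t - dz i t).
    apply: cvg_sumr => i; under eq_cvg do rewrite ipC.
    by apply: ip_cvg_l => // k; exact: sqint_pd (trig0_trig (te k)).
  move=> /cvg_lim <-//; apply: cvg_lim => //.
  rewrite (_ : (fun k => _) = cst 0); first exact: cvg_cst.
  apply/funext => k; have tek := trig0_trig (te k).
  rewrite (eq_bigr (fun i => ip (dh i) (pd i (e k)) - ip (dz i) (pd i (e k)))); last first.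
    by move=> i _; exact (ipBl mD (sdh i) (sdz i) (sqint_pd i tek)).
  apply/eqP; rewrite sumrB subr_eq0 -(inj_eq (addIr (ip f (e k)))).
  by rewrite (weak _ tek) (weak' _ tek).
have dhz i : {ae mu, forall t, D t -> dh i t - dz i t = 0}.
  apply: (nrm2_eq0 mD (sB i)).
  by have := psumr_eq0P (fun i _ => nrm2_ge0 mu D _) B0 => /(_ i isT).
have ydh i : nrm2 (fun t => pd i (y k) t - dh i t) @[k --> \oo] --> 0.
  apply: (cvg_le2 _ (ydz i) (@cvg_cst _ 0 _ _ _)).
  move=> k; rewrite nrm2_ge0/=.
  apply: le_trans (nrm2_triangle mD (sqint_pd i (ty' k)) (sdz i) (sdh i)) _.
  rewrite (nrm2BC mu D (dz i)) (nrm2_0 mD (dhz i) (sB i)).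
  exact: lexx.
(* The gradients of [e k] tend to 0, and neither [g k] nor [y k] has a constant term, so Poincare's
   inequality applies. *)
have e0 : nrm2 (e k) @[k --> \oo] --> 0.
  have lim0 : cP T * grad2 (e k) (e k) @[k --> \oo] --> 0.
    rewrite -[X in _ --> X](mulr0 (cP T)) -B0; apply: cvgMr; apply: cvg_sumr => i.
    by apply: (nrm2_cvg mD) => // k; exact: sqint_pd (trig0_trig (te k)).
  apply: (cvg_le0 _ lim0).
  move=> k; rewrite nrm2_ge0 /=; exact (poincare T0 (te k)).
have yh : nrm2 (fun t => y k t - h t) @[k --> \oo] --> 0.
  apply: (cvg_le2 _ e0 gh).
  move=> k; rewrite nrm2_ge0/=.
  apply: le_trans (nrm2_triangle mD (trig_sqint (ty' k)) (trig_sqint (tg' k)) sh) _.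
  by rewrite (nrm2BC mu D (y k)); exact: lexx.
pose C0 := cP T * (p%:R * (cP T * (4 * p%:R))).
pose C1 := cP T * (4 * p%:R).
have C00 : 0 <= C0 by rewrite !mulr_ge0 ?cP_ge0.
have C10 : 0 <= C1 by rewrite !mulr_ge0 ?cP_ge0.
have up (a b c : R) k : a <= b * 8^-1 ^+ k -> b <= c -> a <= c * 8^-1 ^+ k.
  by move=> /le_trans + bc; apply; rewrite ler_wpM2r// exprn_ge0.
exists y, (C0 + C1 + 4); split => //; [split => //|split|].
- by rewrite (_ : (fun k => _) = fun k => nrm2 (fun t => r k t - f t))//; apply/funext => k; rewrite lapy.
- by move=> k; apply: (up _ C0); [exact: d0|lra].
- by move=> k i; rewrite -pdd; apply: (up _ C1); [exact: d1|lra].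
- by move=> k i j; rewrite -pdpdd; apply: (up _ 4); [exact: d2|lra].
Qed.

End regularity.

(** * The Euler-Lagrange equation *)

Lemma cvg_sqr0 (R : realType) (a : nat -> R) : a k ^+ 2 @[k --> \oo] --> 0 -> a k @[k --> \oo] --> 0.
Proof.
move=> a0; apply: norm_cvg0.
rewrite (_ : (fun k => `|a k|) = fun k => Num.sqrt (a k ^+ 2)); last first.
  by apply/funext => k; rewrite sqrtr_sqr.
rewrite -[X in _ --> X]sqrtr0; apply: continuous_cvg a0; exact: sqrt_continuous.
Qed.

(** Here [I] is the infimum of the energy; [S] and [P] are the Dirichlet sum and the potential of a
    near-minimiser of excess [c]; [b] and [q] come from expanding the Dirichlet sum after a
    perturbation of size [s], and [P'] is the new potential. *)
Lemma first_variation (R : realFieldType) (I S P P' c s b q : R) :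
  2^-1 * S + P <= I + c -> I <= 2^-1 * (S + (2 * s * b + s ^+ 2 * q)) + P' ->
  0 <= 2^-1 * q * s ^+ 2 + b * s + (P' - P) + c.
Proof.
move=> H1 H2; rewrite (_ : _ * s ^+ 2 = 2^-1 * (s ^+ 2 * q)); last by ring.
by move: (s ^+ 2 * q) H2 => sq; rewrite -mulrA (mulrC s); lra.
Qed.

Section weak_solution.
Context {R : realType} {p n : nat}.
Context (T : 'rV[R]_p) (T0 : forall i, 0 < T ord0 i).
Context (F : 'rV[R]_p -> 'rV[R]_n -> R).
Context (F_meas : forall x, measurable_fun (box T : set (lebRV R p))
                        ((fun t => F t x) : lebRV R p -> measurableTypeR R))
  (F_C1 : forall t, box T t -> Ck 1 (F t : 'rV[R]_n -> R^o))
  (F_convex : forall t, box T t -> strictly_convex (F t)).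
Context (K B0 : R) (K0 : 0 <= K)
  (gradK : forall t, box T t -> forall x i, `|grad (F t) x ord0 i| <= K)
  (FB0 : forall t, box T t -> `|F t 0| <= B0).
Context (co : forall A : R, exists r : R, forall x : 'rV[R]_n, r <= enorm x -> A <= Phi T F (cst x)).
Local Notation mu := (leb R p).
Local Notation D := (box T).
Local Notation ip := (ip (leb R p) (box T)).
Local Notation nrm2 := (nrm2 (leb R p) (box T)).
Local Notation sqint := (sqint (leb R p) (box T)).
Local Notation trig := (trig T).
Local Notation trig0 := (trig0 T).
Local Notation grad2 := (grad2 T).
Local Notation Phi := (Phi T F).
Local Notation energy := (energy T F).
Let mD := measurable_box_leb T.
Let fD := leb_box_lty T.

Lemma integral_norm_cvg (f : nat -> 'rV[R]_p -> R) : (forall k, sqint (f k)) ->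
  nrm2 (f k) @[k --> \oo] --> 0 -> \int[mu]_(t in D) `|f k t| @[k --> \oo] --> 0.
Proof.
move=> sf f0; apply: cvg_sqr0; apply: (@cvg_le0 _ _ (fun k => fine (mu D) * nrm2 (f k))).
  by move=> k; rewrite sqr_ge0/=; exact: (integral_norm_le mD fD (sf k)).
by rewrite -[X in _ --> X](mulr0 (fine (mu D))); exact: cvgMr.
Qed.

Lemma Phi_vec_cvg (w : nat -> 'I_n -> 'rV[R]_p -> R) u :
  (forall k j, sqint (w k j)) -> (forall j, sqint (u j)) ->
  (forall j, nrm2 (fun t => w k j t - u j t) @[k --> \oo] --> 0) ->
  Phi (vec (w k)) @[k --> \oo] --> Phi (vec u).
Proof.
move=> sw su wu; apply/subr_cvg0; apply: norm_cvg0.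
apply: (@cvg_le0 _ _ (fun k => K * \sum_j \int[mu]_(t in D) `|w k j t - u j t|)).
  move=> k; rewrite normr_ge0/=.
  exact: (Phi_vec_lipschitz F_meas F_C1 F_convex gradK FB0 (sw k) su).
rewrite -[X in _ --> X](mulr0 K); apply: cvgMr.
have := @cvg_sumr R nat \oo _ _ (index_enum 'I_n)
  (fun j k => \int[mu]_(t in D) `|w k j t - u j t|) (fun=> 0).
have -> : \sum_(j < n) (0 : R) = 0 by rewrite big1.
by apply=> j; exact (integral_norm_cvg (fun k => sqintB mD (sw k j) (su j)) (wu j)).
Qed.

(** Minimality is used at the perturbed approximations [w k + s v]. For fixed [s], [k] tends to
    infinity, which gives the inequality required by [euler_lagrange]; there [s] tends to 0. *)
Lemma weak_solution_exists : exists (x : 'rV[R]_n) (g : nat -> 'I_n -> 'rV[R]_p -> R)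
    (h : 'I_n -> 'rV[R]_p -> R) (dh : 'I_n -> 'I_p -> 'rV[R]_p -> R),
  let f j t := grad (F t) (vec (fun j t => x ord0 j + h j t) t) ord0 j in
  [/\ (forall k j, trig0 (g k j)) /\ (forall j, sqint (f j)),
      (forall j, sqint (h j)) /\ (forall j i, sqint (dh j i)),
      forall j, nrm2 (fun t => g k j t - h j t) @[k --> \oo] --> 0,
      forall j i, nrm2 (fun t => pd i (g k j) t - dh j i t) @[k --> \oo] --> 0 &
      forall j v, trig v -> \sum_i ip (dh j i) (pd i v) + ip (f j) v = 0].
Proof.
have [I [C [x [g [minI tg energyg]]]]] :=
  minimising_sequence T0 F_meas F_C1 F_convex K0 gradK FB0 co.
have tg' k j := trig0_trig (tg k j).
pose w k j t := x ord0 j + g k j t.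
have tw k j : trig (w k j) := trigD (trig_cst T (x ord0 j)) (tg' k j).
have C0 : 0 <= C.
  by have := energyg 0%N; have := minI _ (tw 0%N); rewrite expr0 mulr1 /w; lra.
(* The midpoint has energy at least [I] and both ends at most [I + C 8^-k], so an eighth of the
   Dirichlet distance is at most [C 8^-k]. *)
have fast k j : grad2 (fun t => g k.+1 j t - g k j t) (fun t => g k.+1 j t - g k j t) <=
    8 * C * 8^-1 ^+ k.
  rewrite -mulrA; have := energy_midpoint F_meas F_C1 F_convex gradK FB0 (tw k.+1) (tw k).
  have := minI (fun j t => 2^-1 * w k.+1 j t + 2^-1 * w k j t)
     (fun j => trigD (trigZ _ (tw k.+1 j)) (trigZ _ (tw k j))).
  have := energyg k.+1; have := energyg k.
  rewrite (bigD1 j)//= -/(w k) -/(w k.+1).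
  have : 0 <= \sum_(l < n | l != j) grad2 (fun t => w k.+1 l t - w k l t)
      (fun t => w k.+1 l t - w k l t).
    by apply: sumr_ge0 => l _; exact: grad2_ge0.
  have -> : (fun t => w k.+1 j t - w k j t) = (fun t => g k.+1 j t - g k j t).
    by apply/funext => t; rewrite /w opprD addrACA subrr add0r.
  move: (energy _) (energy _) (energy _) => E1 E2 E3.
  have : C * 8^-1 ^+ k.+1 <= C * 8^-1 ^+ k.
    by rewrite ler_wpM2l// ler_wiXn2l//; lra.
  move: (C * _) (C * _) (\sum_(l < n | l != j) _) (grad2 _ _) => c1 c2 s q.
  lra.
pose H j := cid (trig0_fast_cvg T0 (fun k => tg k j) (fun k => fast k j)).
pose h j := projT1 (H j); pose H' j := cid (projT2 (H j)); pose dh j := projT1 (H' j).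
have Hdh j := projT2 (H' j).
have sh j : sqint (h j) by have [A _ _ _] := Hdh j; exact A.
have sdh j i : sqint (dh j i) by have [_ A _ _] := Hdh j; exact (A i).
have gh j : nrm2 (fun t => g k j t - h j t) @[k --> \oo] --> 0 by have [_ _ A _] := Hdh j; exact A.
have gdh j i : nrm2 (fun t => pd i (g k j) t - dh j i t) @[k --> \oo] --> 0.
  by have [_ _ _ A] := Hdh j; exact (A i).
pose u j t := x ord0 j + h j t.
have su j : sqint (u j) := sqintD mD (trig_sqint (trig_cst T (x ord0 j))) (sh j).
have mu_ : mfun_rV T (vec u) by apply: integrable_rV_mfun; exact: integrable_vec.
exists x, g, h, dh => f.
have sf j : sqint (f j) := sqint_grad F_meas F_C1 F_convex gradK j mu_.
split=> // j v tv.
(* Perturbing a single component decouples the system into scalar equations. *)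
pose vj l t := if l == j then v t else 0.
have tvj l : trig (vj l).
  by rewrite /vj; case: (l == j); [exact: tv|exact: trig_cst].
pose b := \sum_i ip (dh j i) (pd i v).
pose c := 2^-1 * grad2 v v.
have EL : b + \int[mu]_(t in D) dotv (grad (F t) (vec u t)) (vec vj t) = 0.
  apply: (euler_lagrange F_meas F_C1 F_convex K0 gradK FB0 (c := c)).
  - exact: integrable_vec.
  - by apply: integrable_vec => l; exact: trig_sqint.
  move=> s.
  have Evec k : (fun t => vec (w k) t + s *: vec vj t) = vec (fun l t => w k l t + s * vj l t).
    by apply/funext => t; apply/rowP => l; rewrite !mxE.
  have -> : (fun t => vec u t + s *: vec vj t) = vec (fun l t => u l t + s * vj l t).
    by apply/funext => t; apply/rowP => l; rewrite !mxE.
  have lim : c * s ^+ 2 + (\sum_i ip (pd i (g k j)) (pd i v)) * s +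
      (Phi (vec (fun l t => w k l t + s * vj l t)) - Phi (vec (w k))) + C * 8^-1 ^+ k
      @[k --> \oo] -->
    c * s ^+ 2 + b * s + (Phi (vec (fun l t => u l t + s * vj l t)) - Phi (vec u)) + 0.
    have cw l : nrm2 (fun t => w k l t - u l t) @[k --> \oo] --> 0.
      rewrite (_ : (fun k => _) = (fun k => nrm2 (fun t => g k l t - h l t))) //.
      by apply/funext => k; congr (nrm2 _); apply/funext => t; rewrite /w /u opprD addrACA subrr add0r.
    apply: cvgD; last exact: cvg_eighth.
    apply: cvgD.
      apply: cvgD; first exact: cvg_cst.
      apply: cvgM; last exact: cvg_cst.
      apply: cvg_sumr => i; apply: ip_cvg_l => //.
        by move=> k; exact: sqint_pd.
      exact: sqint_pd.
    apply: cvgB.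
      apply: Phi_vec_cvg.
      - by move=> k l; apply: trig_sqint; exact: trigD (tw k l) (trigZ s (tvj l)).
      - by move=> l; exact: (sqintD mD (su l) (sqintZ mD s (trig_sqint (tvj l)))).
      move=> l; rewrite (_ : (fun k => _) = (fun k => nrm2 (fun t => w k l t - u l t))) //.
      by apply/funext => k; congr (nrm2 _); apply/funext => t; rewrite opprD addrACA subrr addr0.
    by apply: Phi_vec_cvg => // k l; exact: trig_sqint (tw k l).
  (* The added 0 is the limit of the excess energy [C 8^-k]. *)
  rewrite -[X in _ <= X]addr0; apply: (cvgr_to_ge lim); apply: nearW => k.
  have := minI (fun l t => w k l t + s * vj l t) (fun l => trigD (tw k l) (trigZ s (tvj l))).
  have := energyg k; rewrite -/(w k) !energyE.
  have -> : \sum_l grad2 (fun t => w k l t + s * vj l t) (fun t => w k l t + s * vj l t) =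
     \sum_l grad2 (w k l) (w k l) +
       (2 * s * \sum_i ip (pd i (g k j)) (pd i v) + s ^+ 2 * grad2 v v).
    rewrite (bigD1 j)//= [in RHS](bigD1 j)//= -addrA [X in _ = _ + X]addrC addrA; congr (_ + _); last first.
      apply: eq_bigr => l lj; congr (grad2 _ _); apply/funext => t;
        by rewrite /vj (negbTE lj) mulr0 addr0.
    have -> : (fun t => w k j t + s * vj j t) = (fun t => w k j t + s * v t).
      by apply/funext => t; rewrite /vj eqxx.
    rewrite !grad2E !mulr_sumr -!big_split; apply: eq_bigr => i _ /=.
    rewrite (pdD i (tw k j) (trigZ s tv)) (pdZ i s tv).
    have sw_ := sqint_pd i (tw k j); have sv_ := sqint_pd i tv.
    rewrite -[ip _ _]/(nrm2 _) (nrm2D mD sw_ (sqintZ mD s sv_)) (nrm2Z mD s sv_).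
    rewrite ipC (ipZl mD s sv_ sw_) ipC /w (pd_cstD i _ (tg' k j)) -!addrA.
    by rewrite mulrA.
  move=> H1 H2; exact (first_variation H1 H2).
rewrite -[RHS]EL; congr (_ + _); rewrite ipE; apply: eq_Rintegral => t _.
rewrite /dotv (bigD1 j)//= big1 ?addr0; last by move=> l lj; rewrite !mxE /vj (negbTE lj) mulr0.
by rewrite [vec vj t _ _]mxE /vj eqxx.
Qed.

End weak_solution.

(** * Traces *)

Section L2_vec.
Context {R : realType} {p n : nat} (T : 'rV[R]_p).
Local Notation mu := (leb R p).
Local Notation D := (box T).
Local Notation nrm2 := (nrm2 (leb R p) (box T)).
Local Notation sqint := (sqint (leb R p) (box T)).
Let mD := measurable_box_leb T.
Implicit Types u : 'I_n -> 'rV[R]_p -> R.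

Lemma integral_enorm_sqr u : (forall j, sqint (u j)) ->
  (\int[mu]_(t in D) (enorm (vec u t) ^+ 2)%:E = (\sum_j nrm2 (u j))%:E)%E.
Proof.
move=> su.
have I2 j : integrableR mu D (fun t => u j t ^+ 2) by have [] := su j.
transitivity (\int[mu]_(t in D) (\sum_j u j t ^+ 2)%:E)%E.
  apply: eq_integral => t _; congr EFin; rewrite enorm_sqr; apply: eq_bigr => j _.
  by rewrite mxE.
have Is := integrableR_sum mD (index_enum 'I_n) I2.
rewrite -[LHS]fineK; last exact (integrable_fin_num mD Is).
congr EFin; transitivity (\int[mu]_(t in D) \sum_j u j t ^+ 2); first by [].
rewrite (integral_sumR mD _ I2); apply: eq_bigr => j _.
by rewrite nrm2E; apply: eq_Rintegral => t _; rewrite expr2.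
Qed.

Lemma L2_vec u : (forall j, sqint (u j)) -> L2 D (vec u).
Proof.
move=> su; split; last by rewrite integral_enorm_sqr// ltry.
apply/(measurable_fun_coord mD) => j.
rewrite (_ : (fun t => _) = u j); last by apply/funext => t; rewrite mxE.
by have [] := su j.
Qed.

Lemma L2_coord_sqint (u : 'rV[R]_p -> 'rV[R]_n) j : L2 D u -> sqint (fun t => u t ord0 j).
Proof.
move=> [mu_ Iu]; have mc := (measurable_fun_coord mD u).1 mu_.
apply/(sqintP mu mD); split; first exact: mc.
have me : measurable_fun (D : set (lebRV R p)) (fun t => enorm (u t) ^+ 2).
  rewrite (_ : (fun t => _) = fun t => \sum_(i < n) (u t ord0 i) ^+ 2); last first.
    by apply/funext => t; rewrite enorm_sqr.
  by apply: measurable_sum => i; apply: measurable_funX; exact: mc.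
refine (le_lt_trans (ge0_le_integral mu mD _ _ _ _) Iu).
- by move=> t _; rewrite lee_fin sqr_ge0.
- by apply/measurable_EFinP; apply: measurable_funX; exact: mc.
- by apply/measurable_EFinP; exact: me.
- by move=> t _; rewrite lee_fin enorm_sqr (bigD1 j)//= lerDl sumr_ge0// => i _; exact: sqr_ge0.
Qed.

Lemma L2_cvg_vec (w : nat -> 'I_n -> 'rV[R]_p -> R) u :
  (forall k j, sqint (w k j)) -> (forall j, sqint (u j)) ->
  (forall j, nrm2 (fun t => w k j t - u j t) @[k --> \oo] --> 0) ->
  L2_cvg D (fun k => vec (w k)) (vec u).
Proof.
move=> sw su wu; rewrite /L2_cvg.
have E k : (\int[mu]_(t in D) (enorm (vec (w k) t - vec u t) ^+ 2)%:E =
    (\sum_j nrm2 (fun t => w k j t - u j t)%R)%:E)%E.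
  rewrite -integral_enorm_sqr; last by move=> j; exact (sqintB mD (sw k j) (su j)).
  by apply: eq_integral => t _; congr (enorm _ ^+ 2)%:E; apply/rowP => j; rewrite !mxE.
rewrite (_ : (fun k => _) = fun k => (\sum_j nrm2 (fun t => w k j t - u j t)%R)%:E); last first.
  by apply/funext.
apply: cvg_EFin; first by apply: nearW.
have := @cvg_sumr R nat \oo _ _ (index_enum 'I_n)
  (fun j k => nrm2 (fun t => w k j t - u j t)) (fun=> 0).
have -> : \sum_(j < n) (0 : R) = 0 by rewrite big1.
by apply=> j; exact (wu j).
Qed.

End L2_vec.

Section weak_derivatives.
Context {R : realType} {p : nat} (T : 'rV[R]_p) (T0 : forall i, 0 < T ord0 i).
Local Notation ip := (ip (leb R p) (box T)).
Local Notation nrm2 := (nrm2 (leb R p) (box T)).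
Local Notation sqint := (sqint (leb R p) (box T)).
Local Notation trig := (trig T).

(** Each [y k] is integrated by parts against [v], then [k] tends to infinity; this covers all
    smooth periodic test functions at once. *)
Lemma ip_pd_limit (y : nat -> 'rV[R]_p -> R) u du i v : (forall k, trig (y k)) ->
  sqint u -> sqint du -> nrm2 (fun t => y k t - u t) @[k --> \oo] --> 0 ->
  nrm2 (fun t => pd i (y k) t - du t) @[k --> \oo] --> 0 -> C1per T i v ->
  ip u (pd i v) = - ip du v.
Proof.
move=> ty su sdu yu ydu Cv; have [_ cv cdv _] := Cv.
have sv := sqint_continuous T cv; have sdv := sqint_continuous T cdv.
have L1 := ip_cvg_l (fun k => trig_sqint (ty k)) su sdv yu.
have L2 := ip_cvg_l (fun k => sqint_pd i (ty k)) sdu sv ydu.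
have L3 : ip (y k) (pd i v) @[k --> \oo] --> - ip du v.
  rewrite (_ : (fun k => _) = fun k => - ip (pd i (y k)) v); first exact: cvgN.
  by apply/funext => k; rewrite (ip_pd T0 (trig_C1per i (ty k)) Cv) opprK.
exact: (cvg_unique _ L1 L3).
Qed.

End weak_derivatives.

(** The difference of the two sides is [(b + a) (x^2 + y^2) - a (x + y)^2 + y^2], with nonnegative
    coefficients. *)
Lemma face_integrand_le (R : realFieldType) (a b x y : R) : 0 <= b -> - b <= a <= 0 ->
  a * (2 * x * y) + x * x <= (1 + b) * (x ^+ 2 + y ^+ 2).
Proof.
move=> b0 /andP[ba a0].
have H : 0 <= (b + a) * (x ^+ 2 + y ^+ 2) + - a * (x + y) ^+ 2 + y ^+ 2.
  have A : 0 <= b + a by lra.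
  have B : 0 <= - a by lra.
  apply: addr_ge0 (sqr_ge0 y); apply: addr_ge0 (mulr_ge0 B (sqr_ge0 _)).
  exact: mulr_ge0 A (addr_ge0 (sqr_ge0 x) (sqr_ge0 y)).
rewrite -subr_ge0; apply: le_trans H _; rewrite le_eqVlt; apply/orP; left; apply/eqP; ring.
Qed.

Section trace.
Context {R : realType} {q : nat} (T : 'rV[R]_q.+1) (T0 : forall i, 0 < T ord0 i).
Variable i : 'I_q.+1.
Local Notation T' := (\row_k T ord0 (lift i k)).
Local Notation nrm2_box := (nrm2 (leb R q.+1) (box T)).
Local Notation nrm2_face := (nrm2 (leb R q) (box T')).
Local Notation sqint_face := (sqint (leb R q) (box T')).
Local Notation trig := (trig T).
Let mD := measurable_box_leb T.
Let fD := leb_box_lty T.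
Let mD' := measurable_box_leb T'.

Lemma sqint_vinsert (f : 'rV[R]_q.+1 -> R) c : trig f ->
  sqint_face (fun s => f (vinsert i c s)).
Proof.
move=> tf; apply: sqint_continuous => s.
apply: (@continuous_comp _ _ _ (fun s => vinsert i c s) f).
  exact: continuous_vinsert_face.
exact: trig_continuous tf _.
Qed.

(* Integrate [d/dt^i ((t^i - T^i) f^2)] over the box. *)
Lemma nrm2_vinsert_le (f : 'rV[R]_q.+1 -> R) : trig f ->
  T ord0 i * nrm2_face (fun s => f (vinsert i 0 s)) <=
  (1 + T ord0 i) * (nrm2_box f + nrm2_box (pd i f)).
Proof.
move=> tf; have Ti := T0 i.
(* This weight vanishes on the far face and equals [- T^i] on the near one, so only the near face
   survives. *)
pose a (t : 'rV[R]_q.+1) : R := t ord0 i - T ord0 i.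
have da t : is_derive t (delta_mx ord0 i) (a : _ -> R^o) 1.
  apply/(@is_derive_line R _ R^o (fun x => x + a t) a 0 t (delta_mx ord0 i)).
    by move=> h; rewrite /a !mxE !eqxx /= mulr1 addr0 addrA.
  rewrite -[X in is_derive _ _ _ X]addr0; apply: is_deriveD.
have ca : continuous a.
  move=> t; apply: (@cvgB _ _ _ (nbhs t) _ (fun t => t ord0 i) (fun=> T ord0 i)).
    exact: coord_continuous.
  exact: cvg_cst.
pose f2 t := f t * f t.
have tf2 : trig f2 := trigM tf tf.
have [_ pf2] := C1perM (trig_C1per i tf) (trig_C1per i tf).
have dg t : derivable ((fun t => a t * f2 t) : _ -> R^o) t (delta_mx ord0 i).
  by apply: derivableM; [have [] := da t|exact: trig_derivable tf2].
have pg : pd i (fun t => a t * f2 t) = fun t => a t * (2 * f t * pd i f t) + f2 t.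
  apply/funext => t; rewrite !pdE.
  have [dat Dat] := da t; have := congr1 (fun g => g t) pf2; rewrite [LHS]pdE => Df2.
  have -> := deriveM dat (trig_derivable tf2).
  rewrite Dat [X in _ *: X]Df2.
  by rewrite /f2 /GRing.scale/= pdE; ring.
have cpg : continuous (pd i (fun t => a t * f2 t)).
  have tg := trigM (trigZ 2 tf) (trig_pd i tf).
  rewrite pg => t; apply: (@cvgD _ _ _ (nbhs t) _ (fun t => a t * (2 * f t * pd i f t)) f2).
    by apply: (@cvgM _ _ (nbhs t)); [exact: ca|exact: trig_continuous tg _].
  exact: trig_continuous tf2 _.
have := integral_pd Ti dg cpg.
have sf := trig_sqint tf; have sdf := sqint_pd i tf.
have -> : \int[leb R q]_(s in box T') (a (vinsert i (T ord0 i) s) * f2 (vinsert i (T ord0 i) s) -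
      a (vinsert i 0 s) * f2 (vinsert i 0 s)) =
    T ord0 i * nrm2_face (fun s => f (vinsert i 0 s)).
  rewrite nrm2E -(RintegralZl _ mD'); last exact: (sqint_mul mD' (sqint_vinsert 0 tf) (sqint_vinsert 0 tf)).
  apply: eq_Rintegral => s _; rewrite /a !mxE unlift_none/= subrr mul0r !sub0r mulNr opprK.
  by [].
move=> <-.
have I1 : integrableR (leb R q.+1) (box T) (fun t => f t ^+ 2) by have [] := sf.
have I2 : integrableR (leb R q.+1) (box T) (fun t => pd i f t ^+ 2) by have [] := sdf.
have -> : (1 + T ord0 i) * (nrm2_box f + nrm2_box (pd i f)) =
    \int[leb R q.+1]_(t in box T) ((1 + T ord0 i) * (f t ^+ 2 + pd i f t ^+ 2)).
  rewrite (RintegralZl _ mD (integrableR_D mD I1 I2)) (RintegralD mD I1 I2) !nrm2E.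
  by congr (_ * (_ + _)); apply: eq_Rintegral => t _; rewrite expr2.
apply: (le_Rintegral mD).
- exact: (sqint_integrable mD fD (sqint_continuous T cpg)).
- exact: (integrableR_Z mD _ (integrableR_D mD I1 I2)).
move=> t Dt; rewrite pg.
have /andP[t0 tT] := Dt i.
rewrite /f2; apply: face_integrand_le; first exact: ltW.
by rewrite /a; apply/andP; split; lra.
Qed.

Context {n : nat}.

Lemma periodic_trace_vec (phi : nat -> 'I_n -> 'rV[R]_q.+1 -> R) w
    (z : 'I_n -> 'I_q.+1 -> 'rV[R]_q.+1 -> R) :
  (forall k j, trig (phi k j)) -> (forall j, sqint (leb R q.+1) (box T) (w j)) ->
  (forall j l, sqint (leb R q.+1) (box T) (z j l)) ->
  (forall j, nrm2_box (fun t => phi k j t - w j t) @[k --> \oo] --> 0) ->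
  (forall j l, nrm2_box (fun t => pd l (phi k j) t - z j l t) @[k --> \oo] --> 0) ->
  (forall j, exists C, forall k,
     nrm2_box (fun t => phi k.+1 j t - phi k j t) +
     nrm2_box (fun t => pd i (phi k.+1 j) t - pd i (phi k j) t) <= C * 8^-1 ^+ k) ->
  periodic_trace T i (vec w).
Proof.
move=> tphi sw sz pw pz fast; have Ti := T0 i.
have G j : exists g, [/\ sqint_face g,
    nrm2_face (fun s => phi k j (vinsert i 0 s) - g s) @[k --> \oo] --> 0 &
    {ae leb R q, forall s, box T' s -> phi k j (vinsert i 0 s) @[k --> \oo] --> g s}].
  have [C HC] := fast j.
  apply: (L2_fast_complete mD' (C := (T ord0 i)^-1 * ((1 + T ord0 i) * C))) => k.
    exact: sqint_vinsert.
  have := nrm2_vinsert_le (trigB (tphi k.+1 j) (tphi k j)).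
  rewrite (pdB i (tphi _ j) (tphi _ j)) => H.
  rewrite -mulrA ler_pdivlMl// -mulrA; apply: le_trans H _.
  by rewrite ler_wpM2l ?HC// addr_ge0// ltW.
pose g j := projT1 (cid (G j)).
have sg j : sqint_face (g j) by have [] := projT2 (cid (G j)).
have gl j : nrm2_face (fun s => phi k j (vinsert i 0 s) - g j s) @[k --> \oo] --> 0.
  by have [] := projT2 (cid (G j)).
have face k j s : phi k j (vinsert i (T ord0 i) s) = phi k j (vinsert i 0 s).
  by rewrite vinsert_period (trig_periodic _ _ (tphi k j)).
(* By periodicity the approximations restrict to the same functions on both faces, so one limit [g]
   is the trace on each. *)
have tr c : (forall k j s, phi k j (vinsert i c s) = phi k j (vinsert i 0 s)) ->
    is_trace T i c (vec w) (vec g).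
  move=> Hc; split; first exact: L2_vec.
  exists (fun k => vec (phi k)), (fun l => vec (fun j => z j l)); split.
  - by move=> k; have [] := trig_CooT (tphi k).
  - split; first exact: L2_vec.
    by apply: L2_cvg_vec => // k j; exact: trig_sqint.
  - move=> l; split; first by apply: L2_vec => j; exact: sz.
    rewrite (_ : (fun k => _) = fun k => vec (fun j => pd l (phi k j))); last first.
      apply/funext => k; apply/funext => t; apply: partial_row => j.
      exact: trig_derivable (tphi k j).
    apply: L2_cvg_vec; [by move=> k j; exact: sqint_pd|by move=> j; exact: sz|by move=> j; exact: pz].
  - rewrite (_ : (fun k => _) = fun k => vec (fun j s => phi k j (vinsert i 0 s))); last first.
      by apply/funext => k; apply/funext => s; apply/rowP => j; rewrite !mxE Hc.
    by apply: L2_cvg_vec; [move=> k j; exact: sqint_vinsert|exact: sg|exact: gl].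
by exists (vec g); split; apply: tr.
Qed.

End trace.

(** Faces have dimension [p.-1], which computes when [p] is a successor; the index [i] excludes
    [p = 0]. *)
Lemma periodic_trace_limit {R : realType} {p n : nat} (T : 'rV[R]_p) (i : 'I_p)
    (phi : nat -> 'I_n -> 'rV[R]_p -> R) w (z : 'I_n -> 'I_p -> 'rV[R]_p -> R) :
  (forall i, 0 < T ord0 i) ->
  (forall k j, trig T (phi k j)) -> (forall j, sqint (leb R p) (box T) (w j)) ->
  (forall j l, sqint (leb R p) (box T) (z j l)) ->
  (forall j, nrm2 (leb R p) (box T) (fun t => phi k j t - w j t) @[k --> \oo] --> 0) ->
  (forall j l, nrm2 (leb R p) (box T) (fun t => pd l (phi k j) t - z j l t) @[k --> \oo] --> 0) ->
  (forall j, exists C, forall k,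
     nrm2 (leb R p) (box T) (fun t => phi k.+1 j t - phi k j t) +
     nrm2 (leb R p) (box T) (fun t => pd i (phi k.+1 j) t - pd i (phi k j) t) <= C * 8^-1 ^+ k) ->
  periodic_trace T i (vec w).
Proof.
case: p T i phi w z => [|q] T i phi w z T0; first by case: i.
exact: periodic_trace_vec.
Qed.

(** * Solutions *)

Section solution.
Context {R : realType} {p n : nat}.
Context (T : 'rV[R]_p) (T0 : forall i, 0 < T ord0 i).
Local Notation mu := (leb R p).
Local Notation D := (box T).
Local Notation ip := (ip (leb R p) (box T)).
Local Notation nrm2 := (nrm2 (leb R p) (box T)).
Local Notation sqint := (sqint (leb R p) (box T)).
Local Notation trig := (trig T).
Let mD := measurable_box_leb T.
Let fD := leb_box_lty T.

Lemma integral_dotv (u : 'I_n -> 'rV[R]_p -> R) (w : 'rV[R]_p -> 'rV[R]_n) :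
  (forall j, sqint (u j)) -> (forall j, sqint (fun t => w t ord0 j)) ->
  \int[mu]_(t in D) dotv (vec u t) (w t) = \sum_j ip (u j) (fun t => w t ord0 j).
Proof.
move=> su sw.
transitivity (\int[mu]_(t in D) \sum_j u j t * w t ord0 j).
  by apply: eq_Rintegral => t _; apply: eq_bigr => j _; rewrite mxE.
rewrite (integral_sumR mD); last by move=> j; exact (sqint_mul mD (su j) (sw j)).
by apply: eq_bigr => j _; rewrite ipE.
Qed.

Lemma integrable_dotv (u : 'I_n -> 'rV[R]_p -> R) (w : 'rV[R]_p -> 'rV[R]_n) :
  (forall j, sqint (u j)) -> (forall j, sqint (fun t => w t ord0 j)) ->
  integrableR mu D (fun t => dotv (vec u t) (w t)).
Proof.
move=> su sw.
have I j : integrableR mu D (fun t => u j t * w t ord0 j) := sqint_mul mD (su j) (sw j).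
apply: eq_integrableR (integrableR_sum mD (index_enum 'I_n) I) => // t _.
by apply: eq_bigr => j _; rewrite mxE.
Qed.

Lemma CooT_coord_sqint (v : 'rV[R]_p -> 'rV[R]_n) j : (0 < p)%N -> CooT T v ->
  sqint (fun t => v t ord0 j).
Proof.
move=> p0 Cv; have [[_ cv _ _] _] := CooT_C1per (Ordinal p0) j Cv.
exact: sqint_continuous.
Qed.

Lemma CooT_partial_sqint (v : 'rV[R]_p -> 'rV[R]_n) i j : CooT T v ->
  sqint (fun t => partial i v t ord0 j).
Proof.
move=> Cv; have [[_ _ cdv _] E] := CooT_C1per i j Cv.
rewrite (_ : (fun t => _) = pd i (fun t => v t ord0 j)); last by apply/funext.
exact: sqint_continuous.
Qed.

Lemma weak_partial_vec (u du : 'I_n -> 'rV[R]_p -> R) i : 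
  (forall j, sqint (u j)) -> (forall j, sqint (du j)) ->
  (forall j v, C1per T i v -> ip (u j) (pd i v) = - ip (du j) v) ->
  weak_partial T i (vec u) (vec du).
Proof.
move=> su sdu H v Cv; have p0 : (0 < p)%N by case: (p) i {H} => [[]|].
rewrite (integral_dotv su (fun j => CooT_partial_sqint i j Cv)).
rewrite (integral_dotv sdu (fun j => CooT_coord_sqint j p0 Cv)).
rewrite -sumrN; apply: eq_bigr => j _; have [Cvj E] := CooT_C1per i j Cv.
by rewrite -(H j _ Cvj); congr (ip _ _); apply/funext.
Qed.

(** The weak equation passes from trigonometric test functions to all periodic ones by integrating
    the approximate solutions by parts. *)
Lemma ip_lap_limit (y : nat -> 'rV[R]_p -> R) dh f v : (forall k, trig (y k)) ->
  (forall i, sqint (dh i)) -> sqint f -> sqint v ->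
  (forall i, nrm2 (fun t => pd i (y k) t - dh i t) @[k --> \oo] --> 0) ->
  nrm2 (fun t => lap (y k) t - f t) @[k --> \oo] --> 0 ->
  (forall i, C1per T i v) ->
  \sum_i ip (dh i) (pd i v) = - ip f v.
Proof.
move=> ty sdh sf sv ydh yf Cv.
have L1 : \sum_i ip (pd i (y k)) (pd i v) @[k --> \oo] --> \sum_i ip (dh i) (pd i v).
  apply: cvg_sumr => i; apply: ip_cvg_l => //; first by move=> k; exact: sqint_pd.
  by have [_ _ cdv _] := Cv i; exact: sqint_continuous.
have L2 : \sum_i ip (pd i (y k)) (pd i v) @[k --> \oo] --> - ip f v.
  rewrite (_ : (fun k => _) = fun k => - ip (lap (y k)) v).
    by apply: cvgN; apply: ip_cvg_l => // k; apply: trig_sqint; exact: trig_lap.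
  apply/funext => k; rewrite /lap (ip_suml mD); [|by move=> i; exact: sqint_pd (trig_pd i (ty k))|by []].
  rewrite -sumrN; apply: eq_bigr => i _.
  by rewrite (ip_pd T0 (trig_C1per i (trig_pd i (ty k))) (Cv i)) opprK.
exact: (cvg_unique _ L1 L2).
Qed.

Context (p_gt0 : (0 < p)%N).
Context (F : 'rV[R]_p -> 'rV[R]_n -> R).
Context (F_meas : forall x, measurable_fun (box T : set (lebRV R p))
                        ((fun t => F t x) : lebRV R p -> measurableTypeR R))
  (F_C1 : forall t, box T t -> Ck 1 (F t : 'rV[R]_n -> R^o))
  (F_convex : forall t, box T t -> strictly_convex (F t)).
Context (K B0 : R) (K0 : 0 <= K)
  (gradK : forall t, box T t -> forall x i, `|grad (F t) x ord0 i| <= K)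
  (FB0 : forall t, box T t -> `|F t 0| <= B0).

Lemma solution_exists :
  (forall A : R, exists r : R, forall x : 'rV[R]_n, r <= enorm x -> A <= Phi T F (cst x)) ->
  exists u, is_solution T (fun t => grad (F t)) u.
Proof.
move=> co.
have [x [g [h [dh [[tg sf] [sh sdh] gh gdh weak]]]]] :=
  weak_solution_exists T0 F_meas F_C1 F_convex K0 gradK FB0 co.
pose u j t := x ord0 j + h j t.
pose f j t := grad (F t) (vec u t) ord0 j.
have reg j := cid (weak_solution_regular T0 (fun k => tg k j) (sh j) (sdh j) (sf j)
  (gh j) (gdh j) (weak j)).
pose y k j := projT1 (reg j) k.
have ty0 k j : trig0 T (y k j) by have [C [A _ _ _ _]] := projT2 (reg j); exact (A k).
have ty k j := trig0_trig (ty0 k j).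
have yh j : nrm2 (fun t => y k j t - h j t) @[k --> \oo] --> 0.
  by have [C [_ A _ _ _]] := projT2 (reg j); exact A.
have ydh j i : nrm2 (fun t => pd i (y k j) t - dh j i t) @[k --> \oo] --> 0.
  by have [C [_ _ [A _] _ _]] := projT2 (reg j); exact (A i).
have yf j : nrm2 (fun t => lap (y k j) t - f j t) @[k --> \oo] --> 0.
  by have [C [_ _ [_ A] _ _]] := projT2 (reg j); exact A.
have fast j : exists C, forall k, [/\ nrm2 (fun t => y k.+1 j t - y k j t) <= C * 8^-1 ^+ k,
    forall i, nrm2 (fun t => pd i (y k.+1 j) t - pd i (y k j) t) <= C * 8^-1 ^+ k &
    forall i l, nrm2 (fun t => pd i (pd l (y k.+1 j)) t - pd i (pd l (y k j)) t) <= C * 8^-1 ^+ k].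
  by have [C [_ _ _ [A B] E]] := projT2 (reg j); exists C => k; split; [exact (A k)|exact (B k)|exact (E k)].
have su j : sqint (u j) := sqintD mD (trig_sqint (trig_cst T (x ord0 j))) (sh j).
pose w k j t := x ord0 j + y k j t.
have tw k j : trig (w k j) := trigD (trig_cst T (x ord0 j)) (ty k j).
have pdw k i j : pd i (w k j) = pd i (y k j) := pd_cstD i (x ord0 j) (ty k j).
have wB k k' j : (fun t => w k j t - w k' j t) = (fun t => y k j t - y k' j t).
  by apply/funext => t; rewrite /w opprD addrACA subrr add0r.
have wu j : nrm2 (fun t => w k j t - u j t) @[k --> \oo] --> 0.
  rewrite (_ : (fun k => _) = fun k => nrm2 (fun t => y k j t - h j t)); first exact: yh.
  apply/funext => k; congr (nrm2 _); apply/funext => t.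
  by rewrite /w /u opprD addrACA subrr add0r.
have wdh j i : nrm2 (fun t => pd i (w k j) t - dh j i t) @[k --> \oo] --> 0.
  by under eq_fun do rewrite pdw; exact: ydh.
(* A trace of a first derivative asks for approximations whose own derivatives converge, hence for
   limits of the second derivatives. *)
have Z j i l : exists z, [/\ sqint z,
    nrm2 (fun t => pd l (pd i (y k j)) t - z t) @[k --> \oo] --> 0 &
    {ae mu, forall t, D t -> pd l (pd i (y k j)) t @[k --> \oo] --> z t}].
  have [C HC] := fast j; apply: (L2_fast_complete mD (C := C)) => k.
    exact: sqint_pd (trig_pd i (ty k j)).
  by have [_ _ A] := HC k; exact (A l i).
pose z i j l := projT1 (cid (Z j i l)).
have sz i j l : sqint (z i j l) by have [A _ _] := projT2 (cid (Z j i l)); exact A.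
have zl i j l : nrm2 (fun t => pd l (pd i (y k j)) t - z i j l t) @[k --> \oo] --> 0.
  by have [_ A _] := projT2 (cid (Z j i l)); exact A.
exists (vec u), (fun i => vec (fun j => dh j i)), (fun t => grad (F t) (vec u t)).
split.
- split.
  + exact: L2_vec.
  + by move=> i; apply: L2_vec => j; exact: sdh.
  + move=> i; apply: weak_partial_vec => // j v Cv.
    exact: (ip_pd_limit T0 (fun k => tw k j) (su j) (sdh j i) (wu j) (wdh j i) Cv).
- split; first by move=> j; exact: (sqint_integrable mD fD (sf j)).
  move=> v Cv.
  have sv j : sqint (fun t => v t ord0 j) := CooT_coord_sqint j p_gt0 Cv.
  have spv i j : sqint (fun t => partial i v t ord0 j) := CooT_partial_sqint i j Cv.
  have -> : \int[mu]_(t in D) dotv (grad (F t) (vec u t)) (v t) =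
      \sum_j ip (f j) (fun t => v t ord0 j).
    rewrite -(integral_dotv sf sv); apply: eq_Rintegral => t _; congr dotv.
    by apply/rowP => j; rewrite [RHS]mxE.
  rewrite (integral_sumR mD); last first.
    move=> i; exact (integrable_dotv (fun j => sdh j i) (spv i)).
  rewrite (eq_bigr (fun i => \sum_j ip (dh j i) (pd i (fun t => v t ord0 j)))); last first.
    move=> i _; rewrite (integral_dotv (fun j => sdh j i) (spv i)); apply: eq_bigr => j _.
    by congr (ip _ _); apply/funext => t; have [_] := CooT_C1per i j Cv; exact.
  rewrite exchange_big -sumrN; apply: eq_bigr => j _ /=.
  apply: (ip_lap_limit (fun k => ty k j) (sdh j) (sf j) (sv j) (ydh j) (yf j)) => i.
  by have [] := CooT_C1per i j Cv.
(* The weak Laplacian was chosen to be [grad (F t) (u t)] itself, so the equation holds at every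
   point. *)
- exact: nearW.
move=> i; split.
  apply: (periodic_trace_limit T0 tw su sdh wu wdh) => j.
  have [C HC] := fast j; exists (C + C) => k; rewrite wB !pdw mulrDl.
  by have [A B _] := HC k; exact: lerD A (B i).
move=> l; apply: (@periodic_trace_limit _ _ _ T i (fun k j => pd l (y k j)) (fun j => dh j l) (z l) T0).
- by move=> k j; exact: trig_pd.
- by move=> j; exact: sdh.
- exact: sz.
- by move=> j; exact: ydh.
- exact: zl.
move=> j; have [C HC] := fast j; exists (C + C) => k; rewrite mulrDl.
by have [_ A B] := HC k; exact: lerD (A l) (B i l).
Qed.

End solution.

Lemma solution_critical (R : realType) (p n : nat) (T : 'rV[R]_p)
    (F : 'rV[R]_p -> 'rV[R]_n -> R) u :
  (forall j, measurable_fun (box T : set (lebRV R p)) (fun t => grad (F t) (u t) ord0 j)) ->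
  is_solution T (fun t => grad (F t)) u ->
  forall j, \int[leb R p]_(t in box T) grad (F t) (u t) ord0 j = 0.
Proof.
move=> mG [du [f [_ [If weak] fG _]]] j.
have mf : measurable_fun (box T : set (lebRV R p)) (fun t => f t ord0 j).
  exact: integrableR_mfun (If j).
(* A constant field is an admissible test function with zero derivatives; this one singles out the
   [j]-th mean value. *)
pose v : 'rV[R]_p -> 'rV[R]_n := cst (delta_mx ord0 j).
have Cv : CooT T v.
  have := trig_CooT (fun l => trig_cst T ((delta_mx ord0 j : 'rV[R]_n) ord0 l)).
  by congr CooT; apply/funext => t; apply/rowP => l; rewrite [LHS]mxE.
have := weak v Cv.
have -> : \int[leb R p]_(t in box T) (\sum_(al < p) dotv (du al t) (partial al v t)) = 0.
  rewrite -[RHS](mul0r (fine (leb R p (box T)))) -Rintegral_cst; last exact: measurable_box_leb.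
  apply: eq_Rintegral => t _; rewrite big1// => al _; rewrite /partial derive_cst.
  by rewrite /dotv big1// => l _; rewrite [X in _ * X]mxE mulr0.
move=> /esym/eqP; rewrite oppr_eq0 => /eqP H; rewrite -[RHS]H.
transitivity (\int[leb R p]_(t in box T) f t ord0 j).
  have E : {ae leb R p, forall t, box T t -> grad (F t) (u t) ord0 j = f t ord0 j}.
    have [N [mN N0 sN]] := fG; exists N; split => // t /= Ht; apply: sN => /= H1.
    by apply: Ht => Dt; rewrite H1.
  exact (ae_eq_Rintegral (measurable_box_leb T) (mG j) mf E).
apply: eq_Rintegral => t _; rewrite /dotv (bigD1 j)//= big1 ?addr0 => [|l lj].
  by rewrite /v /= [X in _ * X]mxE !eqxx mulr1.
by rewrite /v /= [X in _ * X]mxE (negbTE lj) andbF mulr0.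
Qed.

Theorem theorem2 (R : realType) (p n : nat) (p_gt0 : (0 < p)%N) (n_gt0 : (0 < n)%N)
  (T : 'rV[R]_p) (T_gt0 : forall i, 0 < T ord0 i)
  (F : 'rV[R]_p -> 'rV[R]_n -> R)
  (F_meas : forall x, measurable_fun (box T : set (lebRV R p))
                        ((fun t => F t x) : lebRV R p -> measurableTypeR R))
  (F_C1 : forall t, box T t -> Ck 1 (F t : 'rV[R]_n -> R^o))
  (F_bound : exists (a a' : R -> R) (b : 'rV[R]_p -> R),
     [/\ C1_Rplus a a' /\ (forall s, 0 <= s -> 0 <= a s),
         exists M : R, forall s, 0 <= s -> a' s <= M,
         {within box T, continuous b} /\ (forall t, box T t -> 0 <= b t)
       & forall x t, box T t ->
           `|F t x| <= a (enorm x) * b t /\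
           enorm (grad (F t) x) <= a (enorm x) * b t])
  (F_convex : forall t, box T t -> strictly_convex (F t)) :
  let S1 := exists u, is_solution T (fun t => grad (F t)) u in
  let S2 := exists x : 'rV[R]_n,
    integral_rV (box T) (fun t => grad (F t) x) = 0 in
  let S3 := forall A : R, exists r : R, forall x : 'rV[R]_n,
    r <= enorm x -> A <= \int[leb R p]_(t in box T) F t x in
  (S1 <-> S2) /\ (S2 <-> S3).
Proof.
have [a [a' [b [[Ca a0] [M aM] [cb b0] FB]]]] := F_bound.
have [Kb bK] := continuous_box_bounded cb.
(* Absolute values of the bounds make the growth constants nonnegative, as [grad_bounded]
   requires. *)
have la s : 0 <= s -> a s <= a 0 + `|M| * s.
  move=> s0; apply: le_trans (C1_Rplus_linear_growth Ca aM s0) _.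
  by rewrite lerD2l ler_wpM2r// ler_norm.
have Kb0 t : box T t -> 0 <= Kb by move=> /bK; exact: le_trans.
have FK t x : box T t -> `|F t x| <= a 0 * `|Kb| + `|M| * `|Kb| * l1norm x.
  move=> Dt; apply: le_trans (FB x t Dt).1 _.
  rewrite mulrAC -mulrDl; apply: ler_pM.
  - by apply: a0; exact: enorm_ge0.
  - exact: b0.
  - apply: le_trans (la _ (enorm_ge0 x)) _.
    by rewrite lerD2l ler_wpM2l// enorm_le_l1norm.
  apply: le_trans (ler_norm _) _; apply: le_trans (bK t Dt) (ler_norm _).
have A0 : 0 <= a 0 * `|Kb| by rewrite mulr_ge0// a0.
have K0 : 0 <= `|M| * `|Kb| by rewrite mulr_ge0.
have gradK t : box T t -> forall x i, `|grad (F t) x ord0 i| <= `|M| * `|Kb|.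
  by move=> Dt; exact (grad_bounded (F_C1 _ Dt) (F_convex _ Dt) A0 K0 (fun x => FK t x Dt)).
have FB0 t : box T t -> `|F t 0| <= a 0 * `|Kb|.
  move=> Dt; apply: le_trans (FK t 0 Dt) _.
  by rewrite /l1norm big1 ?mulr0 ?addr0// => i _; rewrite mxE normr0.
move=> S1 S2 S3.
have S13 : S1 -> S3.
  move=> [u su]; have [du [f [[L2u _ _] _ _ _]]] := su.
  have squ j := L2_coord_sqint j L2u.
  have Iu : integrable_rV (box T) u.
    by move=> j; exact: (sqint_integrable (measurable_box_leb T) (leb_box_lty T) (squ j)).
  apply: (critical_coercive T_gt0 F_meas F_C1 F_convex K0 gradK FB0 n_gt0 Iu).
  apply: solution_critical su => j.
  exact (mfun_grad F_meas F_C1 F_convex j (integrable_rV_mfun Iu)).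
have S23 : S2 -> S3.
  move=> [x Hx].
  apply: (critical_coercive T_gt0 F_meas F_C1 F_convex K0 gradK FB0 n_gt0 (integrable_cst_rV T x)).
  by move=> i; have := congr1 (fun y : 'rV[R]_n => y ord0 i) Hx; rewrite !mxE.
have S32 : S3 -> S2.
  move=> co; have [x Hx] := coercive_critical T_gt0 F_meas F_C1 F_convex K0 gradK FB0 co.
  by exists x; apply/rowP => i; rewrite !mxE; exact: Hx.
have S31 : S3 -> S1 := solution_exists T_gt0 p_gt0 F_meas F_C1 F_convex K0 gradK FB0.
by split; [split=> [/S13/S32|/S23/S31]|split=> [/S23|/S32]].
Qed.
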